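(* Let $n\ge1$, let $\theta\in(0,\pi]$ and let $\mathbf{a}=(a_1,\dots,a_n)$, $0\le a_1\le\dots\le a_n$ integers, index an irreducible representation of $SO(2n+1)$. Set $m=a_n$ and $\tilde a_k=a_k+k-\frac12$. Let $\tilde b_1>\tilde b_2>\dots>\tilde b_m$ be the complement of $\{\tilde a_1,\dots,\tilde a_n\}$ in $\left\{\frac12,\frac32,\dots,m+n-\frac12\right\}$. Then $$r_{\mathbf a}(\theta)=\frac{(2n-1)!}{(2n+2m-1)!\,\left(2\sin\frac\theta2\right)^{2n-1}}\left(\prod_{k=1}^m\left(\tilde b_k^2+\partial_\theta^2\right)\right)\left(2\sin\frac\theta2\right)^{2n+2m-1}.$$
   Context: Irreducible representations $\rho_{\mathbf a}$ of $SO(2n+1)$ are indexed by integer strings $\mathbf a=(a_1,\dots,a_n)$ with $0\le a_1\le\dots\le a_n$; $\rho_{\mathbf a}$ is the representation whose highest weight has coordinates, in decreasing order, $(a_n,a_{n-1},\dots,a_1)$. $d_{\mathbf a}$ and $\chi_{\mathbf a}$ are its dimension and character, and $r_{\mathbf a}(\theta)=\chi_{\mathbf a}(R(1,2;\theta))/d_{\mathbf a}$ is the character ratio at the rotation $R(1,2;\theta)$ by angle $\theta$ in the first coordinate $2$-plane (identity on the remaining coordinates). $\partial_\theta$ denotes differentiation in $\theta$. *)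

(* Defs.v *)
From HB Require Import structures.
From mathcomp Require Import all_boot all_order all_algebra.
From mathcomp Require Import complex.
From mathcomp Require Import all_classical all_reals all_analysis.

Set Implicit Arguments.
Unset Strict Implicit.
Unset Printing Implicit Defensive.

Import Order.TTheory GRing.Theory Num.Theory.
Import numFieldNormedType.Exports.

Local Open Scope classical_set_scope.
Local Open Scope ring_scope.
Local Open Scope complex_scope.

Definition SO (R : realType) (N : nat) : set 'M[R]_N :=
  [set g | g^T *m g = 1%:M /\ \det g = 1].

(* Rotation by [theta] in the coordinate plane [(p, q)], for [p != q]. *)
Definition plane_rot (R : realType) (N : nat) (p q : 'I_N) (theta : R)
    : 'M[R]_N :=
  \matrix_(i, j)
    if (i == p) && (j == p) || (i == q) && (j == q) then cos theta
    else if (i == p) && (j == q) then - sin theta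
    else if (i == q) && (j == p) then sin theta
    else (i == j)%:R.

(* The rotation written R(1,2;theta): coordinates are numbered from 0 here. *)
Definition rot12 (R : realType) (n : nat) (theta : R) : 'M[R]_((2 * n).+1) :=
  plane_rot (inord 0) (inord 1) theta.

(* The maximal torus of SO(2n+1): angle [phi k] in the plane (2k, 2k+1). *)
Definition torus (R : realType) (n : nat) (phi : 'I_n -> R)
    : 'M[R]_((2 * n).+1) :=
  \prod_(k < n) plane_rot (inord (2 * k)) (inord (2 * k).+1) (phi k).

(* A representation is a function on all matrices of which only the
   restriction to SO(N) matters; it acts on column vectors. Continuity is
   required of the real and imaginary parts of every matrix entry. *)
Definition is_representation (R : realType) (N d : nat)
    (rho : 'M[R]_N -> 'M[R[i]]_d) : Prop :=
  [/\ rho 1%:M = 1%:M,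
      (forall g h, SO g -> SO h -> rho (g *m h) = rho g *m rho h) &
      (forall i j,
         {within @SO R N, continuous (fun g => complex.Re (rho g i j))} /\
         {within @SO R N, continuous (fun g => complex.Im (rho g i j))})].

(* The subspaces of column vectors are coded by the row spaces of the
   matrices [U], whence the transpose of [rho g]. *)
Definition is_irreducible (R : realType) (N d : nat)
    (rho : 'M[R]_N -> 'M[R[i]]_d) : Prop :=
  (0 < d)%N /\
  forall U : 'M[R[i]]_d, (forall g, SO g -> stablemx U (rho g)^T) ->
    \rank U = 0%N \/ \rank U = d.

Definition expi (R : realType) (x : R) : R[i] := cos x +i* sin x.

Definition is_weight (R : realType) (n d : nat)
    (rho : 'M[R]_((2 * n).+1) -> 'M[R[i]]_d) (lam : 'rV[int]_n) : Prop :=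
  exists2 v : 'cV[R[i]]_d, v != 0 &
    forall phi : 'I_n -> R,
      rho (torus phi) *m v = expi (\sum_(j < n) (lam 0 j)%:~R * phi j) *: v.

(* Simple roots of type B_n: e_i - e_(i+1) for i < n - 1, and, the second
   term then being zero, e_(n-1) for i = n - 1. *)
Definition simple_root (n : nat) (i : 'I_n) : 'rV[int]_n :=
  \row_j ((j == i)%:R - ((j : nat) == i.+1)%:R).

Definition is_highest_weight (R : realType) (n d : nat)
    (rho : 'M[R]_((2 * n).+1) -> 'M[R[i]]_d) (lam : 'rV[int]_n) : Prop :=
  is_weight rho lam /\
  forall mu, is_weight rho mu ->
    exists c : 'I_n -> nat, lam - mu = \sum_(i < n) simple_root i *+ c i.

(* [a] lists a_1 <= ... <= a_n; the weight is (a_n, ..., a_1). *)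
Definition weight_of (n : nat) (a : n.-tuple nat) : 'rV[int]_n :=
  \row_(i < n) (nth 0%N (rev a) i)%:Z.

Definition char_ratio (R : realType) (n d : nat)
    (rho : 'M[R]_((2 * n).+1) -> 'M[R[i]]_d) (theta : R) : R[i] :=
  \tr (rho (rot12 n theta)) / d%:R.

(* a_k + k - 1/2 for 1 <= k <= n. *)
Definition atilde (R : realType) (n : nat) (a : n.-tuple nat) : seq R :=
  [seq (nth 0%N a k.-1)%:R + k%:R - 2^-1 | k <- iota 1 n].

(* 1/2, 3/2, ..., N - 1/2. *)
Definition half_integers (R : realType) (N : nat) : seq R :=
  [seq k%:R - 2^-1 | k <- iota 1 N].

Definition sqr_plus_D2 (R : realType) (b : R) (f : R -> R) : R -> R :=
  fun x => b ^+ 2 * f x + f^`(2)%classic x.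

(* The composite of the operators b_k^2 + D^2, for b_k in [b]. *)
Definition prod_sqr_plus_D2 (R : realType) (b : seq R) (f : R -> R)
    : R -> R :=
  foldr (@sqr_plus_D2 R) f b.

(* Main.v *)
Require Import Defs.
From HB Require Import structures.
From mathcomp Require Import all_boot all_order all_algebra.
From mathcomp Require Import fingroup perm.
From mathcomp Require Import complex.
From mathcomp Require Import all_classical all_reals all_analysis.
From mathcomp Require Import ring lra zify.

Set Implicit Arguments.
Unset Strict Implicit.
Unset Printing Implicit Defensive.

Import Order.TTheory GRing.Theory Num.Theory.
Import numFieldNormedType.Exports.

Local Open Scope ring_scope.
Local Open Scope complex_scope.

(* Idea. By continuity the restriction of [rho] to a circle of plane rotations
   is diagonalizable with integer frequencies, so [rho] can be differentiated
   there; the bracket relations between these derivatives come from an explicit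
   factorization in SO(3). By Schur's lemma the Casimir element is a scalar,
   and on the maximal torus this is a Laplace eigenvalue equation for the
   product of the Weyl denominator and the character: all the exponents nu of
   this product have the same length as lambda + delta (delta the half-sum of
   the positive roots). As the product is alternating under the Weyl group and
   its exponents lie below lambda + delta, they all lie in the orbit of
   lambda + delta, whose coordinates are the a~_k. Restricted to angles (x, 0, ..., 0), this makes
   (2 sin(x/2))^(2n-1) r_a(x) a combination of the 2n exponentials
   exp(+- i a~_k x). So is the right-hand side, since the operator
   b~_k^2 + D^2 kills the exponentials exp(+- i b~_k x). Both sides are
   x^(2n-1) + o(x^(2n-1)) at 0, and a combination of 2n distinct exponentials
   which is o(x^(2n-1)) vanishes. *)

(** * Representations of the circle *)

(** It is enough to know which exponents may occur in the numerator: on the circle the coefficients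
    are then forced by the behaviour at 0. The count is tight, because exactly 2n-1 positive roots
    (e_1 and e_1 +- e_k) have a nonzero first coordinate, one less than the number of frequencies +-
    a~_k. The obstacle is that the angles (x, 0, ..., 0) are singular: for n > 1 the Weyl
    denominator vanishes identically on them, so restricting the numerator gives 0 = 0. The roots
    without first coordinate have to be divided out beforehand. Their product has exponents with
    first coordinate 0, so it acts separately on each slice of the numerator with a given first
    coordinate, and can be cancelled slice by slice at generic angles. The factorization in SO(3)
    stands in for exponential coordinates near 1: it writes a conjugated rotation as a product of
    rotations in coordinate planes, along which differentiability is already known. *)

Lemma complex_eq (R : ringType) (x y : R[i]) :
  complex.Re x = complex.Re y -> complex.Im x = complex.Im y -> x = y.
Proof. by case: x => a b; case: y => c d /= -> ->. Qed.

Section Expi.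
Variable R : realType.
Implicit Types x y t : R.

Lemma expi0 : expi (0 : R) = 1.
Proof. by apply: complex_eq; rewrite /= ?cos0 ?sin0. Qed.

Lemma expiD x y : expi (x + y) = expi x * expi y.
Proof. by apply: complex_eq; rewrite /= ?cosD ?sinD // addrC mulrC; congr (_ + _); exact: mulrC. Qed.

Lemma expi_neq0 x : expi x != 0.
Proof.
apply/eqP => e; move: (expiD x (- x)); rewrite subrr expi0 e mul0r.
by move/eqP; rewrite oner_eq0.
Qed.

Lemma expiN x : expi (- x) = (expi x)^-1.
Proof.
apply: (mulfI (expi_neq0 x)); rewrite divff ?expi_neq0 //.
by rewrite -expiD subrr expi0.
Qed.

Lemma expiMn x k : expi (x *+ k) = expi x ^+ k.
Proof.
elim: k => [|k IH]; first by rewrite mulr0n expi0 expr0.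
by rewrite mulrS exprS expiD IH.
Qed.

Lemma expi_sum (I : Type) (r : seq I) (P : pred I) (F : I -> R) :
  expi (\sum_(i <- r | P i) F i) = \prod_(i <- r | P i) expi (F i).
Proof. by apply: (big_morph _ expiD expi0). Qed.

Lemma expi_2pi : expi (2 * pi : R) = 1.
Proof.
by apply: complex_eq => /=; rewrite mulr_natl ?cos2pi ?sin2pi.
Qed.

Lemma expi_2piZ (k : int) : expi (k%:~R * (2 * pi) : R) = 1.
Proof.
rewrite mulrzl; case: k => k; rewrite ?NegzE ?mulrNz -pmulrn.
  by rewrite expiMn expi_2pi expr1n.
by rewrite expiN expiMn expi_2pi expr1n invr1.
Qed.

Lemma expi_neq1 x : 0 < `|x| < 2 * pi -> expi x != 1.
Proof.
move=> /andP[x0 x1]; apply/eqP => /(congr1 (@complex.Re R)) /= c; have := @sin_gt0_pi R (`|x| / 2).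
have -> : 0 < `|x| / 2 < pi by apply/andP; split; lra.
move=> /(_ isT) s0.
have : cos (`|x|) = 1 by have [xp|xn] := leP 0 x; rewrite ?cosN //; rewrite ?(ger0_norm xp) ?(ltr0_norm xn) ?cosN.
have -> : `|x| = `|x| / 2 + `|x| / 2 by lra.
rewrite cosD => c1; have := cos2Dsin2 (`|x| / 2); rewrite !expr2 => c2.
by have := mulr_gt0 s0 s0; lra.
Qed.

Lemma expi_eq1 x : expi x = 1 -> exists k : int, x = k%:~R * (2 * pi).
Proof.
move=> ex; have p0 := @pi_gt0 R; have p2 : 0 < 2 * pi :> R by lra.
pose k := Num.floor (x / (2 * pi)); exists k.
pose y := x - k%:~R * (2 * pi).
have ey : expi y = 1 by rewrite /y expiD ex expiN expi_2piZ invr1 mulr1.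
have k1 : k%:~R <= x / (2 * pi) by exact: floor_le_tmp.
have k2 : x / (2 * pi) < k%:~R + 1 by rewrite -intrD1 floorD1_gt.
have y0 : 0 <= y by rewrite subr_ge0 -ler_pdivlMr.
have y1 : y < 2 * pi.
  by rewrite ltrBlDr -[X in X + _]mul1r -mulrDl -ltr_pdivrMr // addrC.
have [yz|yn] := eqVneq y 0; last first.
  have : expi y != 1 by apply: expi_neq1; rewrite ger0_norm // y1 andbT lt_def yn.
  by rewrite ey eqxx.
by apply/eqP; rewrite -subr_eq0; apply/eqP.
Qed.

Lemma expi_onto (z : R[i]) : complex.Re z ^+ 2 + complex.Im z ^+ 2 = 1 ->
  0 < complex.Re z -> exists2 x, `|x| <= pi / 2 & z = expi x.
Proof.
case: z => a b /= ab a0.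
have b1 : b ^+ 2 < 1 by have := exprn_gt0 2 a0; lra.
have /andP[b3 b4] : -1 < b < 1 by rewrite -ltr_norml -(@expr_lt1 _ 2) // real_normK ?num_real.
have b2 : -1 <= b <= 1 by rewrite !ltW.
exists (asin b).
  have [h _] := asin_def b2; rewrite ler_norml; exact: h.
apply: complex_eq => /=; last by rewrite asinK // in_itv /= b2.
rewrite cos_asin //; have -> : 1 - b ^+ 2 = a ^+ 2 by lra.
by rewrite sqrtr_sqr gtr0_norm.
Qed.

Lemma sqr_inj_Re_gt0 (z w : R[i]) : 0 < complex.Re z -> 0 < complex.Re w ->
  z ^+ 2 = w ^+ 2 -> z = w.
Proof.
move=> z0 w0 /eqP; rewrite eqf_sqr => /orP[/eqP//|/eqP e].
by move: z0; rewrite e raddfN /= oppr_gt0 ltNge ltW.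
Qed.

(* Any sequence tending to 0 would do in place of 2 pi / 2^r; powers of 2
   make successive terms related by squaring. *)
Lemma eq_continuous_dyadic (f g : R -> R) (r0 : nat) :
  continuous f -> continuous g ->
  (forall r (p : int), (r0 <= r)%N ->
     f (p%:~R * (2 * pi / 2 ^+ r)) = g (p%:~R * (2 * pi / 2 ^+ r))) ->
  f =1 g.
Proof.
move=> cf cg fg t.
pose h x := f x - g x.
have p0 := @pi_gt0 R.
pose d (r : nat) : R := 2 * pi / 2 ^+ r.
have d0 r : 0 < d r by rewrite divr_gt0 ?exprn_gt0 //; lra.
pose u (r : nat) : R := (Num.floor (t / d r))%:~R * d r.
have ud r : `|t - u r| <= d r.
  have k1 : (Num.floor (t / d r))%:~R <= t / d r by exact: floor_le_tmp.
  have k2 : t / d r < (Num.floor (t / d r))%:~R + 1 by rewrite -intrD1 floorD1_gt.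
  rewrite ler_pdivlMr // in k1; rewrite ltr_pdivrMr // mulrDl mul1r in k2.
  rewrite /u; have := d0 r; rewrite ger0_norm; lra.
have dcvg : (d @ \oo --> (0 : R))%classic.
  have -> : d = (fun r => (2 * pi) * (2^-1) ^+ r).
    by apply/funext => r; rewrite /d exprVn.
  rewrite -[X in (_ --> X)%classic](mulr0 (2 * pi)); apply: cvgMr.
  by apply: cvg_expr; rewrite gtr0_norm //; lra.
have ucvg : (u @ \oo --> t)%classic.
  apply/cvgrPdist_le => e e0.
  near=> r; apply: le_trans (ud r) _.
  near: r; move/cvgrPdist_le: dcvg => /(_ e e0); apply: filterS => r.
  by rewrite sub0r normrN ger0_norm // ltW.
have hcvg : (h (u r) @[r --> \oo] --> h t)%classic.
  by apply: cvg_comp ucvg _; apply: cvgB; [apply: cf | apply: cg].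
have : (h (u r) @[r --> \oo] --> (0 : R))%classic.
  apply: cvg_near_cst; near=> r.
  rewrite /h /u fg ?subrr //; near: r; exact: nbhs_infty_ge.
move=> h0; have : h t = 0 by apply: (cvg_unique (@Rhausdorff R) hcvg h0).
by rewrite /h => /eqP; rewrite subr_eq0 => /eqP.
Unshelve. all: by end_near. Qed.

End Expi.

Section ContinuousComplex.
Variable R : realType.

Definition ccont (f : R -> R[i]) : Prop :=
  continuous (fun t => complex.Re (f t)) /\ continuous (fun t => complex.Im (f t)).

Lemma ReD (x y : R[i]) : complex.Re (x + y) = complex.Re x + complex.Re y.
Proof. by case: x => a b; case: y. Qed.

Lemma ImD (x y : R[i]) : complex.Im (x + y) = complex.Im x + complex.Im y.
Proof. by case: x => a b; case: y. Qed.

Lemma ccont_cst (c : R[i]) : ccont (fun=> c).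
Proof. by split=> x; apply: cvg_cst. Qed.

Lemma ccontD f g : ccont f -> ccont g -> ccont (fun t => f t + g t).
Proof.
move=> [f1 f2] [g1 g2]; split.
  under eq_fun do rewrite ReD.
  by move=> x; apply: cvgD; [exact: f1 | exact: g1].
under eq_fun do rewrite ImD.
by move=> x; apply: cvgD; [exact: f2 | exact: g2].
Qed.

Lemma Re_mul (x y : R[i]) :
  complex.Re (x * y) = complex.Re x * complex.Re y - complex.Im x * complex.Im y.
Proof. by case: x => a b; case: y. Qed.

Lemma Im_mul (x y : R[i]) :
  complex.Im (x * y) = complex.Re x * complex.Im y + complex.Im x * complex.Re y.
Proof. by case: x => a b; case: y. Qed.

Lemma ccontM f g : ccont f -> ccont g -> ccont (fun t => f t * g t).
Proof.
move=> [f1 f2] [g1 g2]; split.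
  under eq_fun do rewrite Re_mul.
  by move=> x; apply: cvgB; apply: cvgM; [exact: f1 | exact: g1 | exact: f2 | exact: g2].
under eq_fun do rewrite Im_mul.
by move=> x; apply: cvgD; apply: cvgM; [exact: f1 | exact: g2 | exact: f2 | exact: g1].
Qed.

Lemma ccont_sum (I : Type) (r : seq I) (F : I -> R -> R[i]) :
  (forall i, ccont (F i)) -> ccont (fun t => \sum_(i <- r) F i t).
Proof.
move=> cF; elim: r => [|i r IH].
  by under eq_fun do rewrite big_nil; exact: ccont_cst.
by under eq_fun do rewrite big_cons; exact: ccontD.
Qed.

Lemma ccont_expi (k : R) : ccont (fun t => expi (k * t)).
Proof.
have ck (x : R) : (k * y @[y --> x] --> k * x)%classic.
  by apply: cvgM; [exact: cvg_cst | exact: cvg_id].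
split=> x /=; apply: (cvg_comp _ _ (ck x)).
  exact: continuous_cos.
exact: continuous_sin.
Qed.

Lemma eq_ccont_dyadic (f g : R -> R[i]) (r0 : nat) :
  ccont f -> ccont g ->
  (forall r (p : int), (r0 <= r)%N ->
     f (p%:~R * (2 * pi / 2 ^+ r)) = g (p%:~R * (2 * pi / 2 ^+ r))) ->
  f =1 g.
Proof.
move=> [f1 f2] [g1 g2] fg t; apply: complex_eq.
  by apply: (eq_continuous_dyadic f1 g1 (r0 := r0)) => r p /fg ->.
by apply: (eq_continuous_dyadic f2 g2 (r0 := r0)) => r p /fg ->.
Qed.

(** For large r the value c(2 pi / 2^r) has positive real part, so it is the only square root of its
    predecessor in the right half-plane. The integer k read off at one level r0 therefore persists
    at all finer levels, and density of the dyadic angles finishes. *)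
Lemma circle_char (c : R -> R[i]) :
  (forall s t, c (s + t) = c s * c t) -> c 0 = 1 -> c (2 * pi) = 1 -> ccont c ->
  exists k : int, forall t, c t = expi (k%:~R * t).
Proof.
move=> cD c0 c2 cc.
have cMn t k : c (t *+ k) = c t ^+ k.
  elim: k => [|k IH]; first by rewrite mulr0n c0.
  by rewrite mulrS exprS cD IH.
have cN t : c (- t) = (c t)^-1.
  have h : c t * c (- t) = 1 by rewrite -cD subrr c0.
  have ct : c t != 0 by apply/eqP => e; move/eqP: h; rewrite e mul0r eq_sym oner_eq0.
  by apply: (mulfI ct); rewrite h divff.
have cz t (p : int) : c (p%:~R * t) = c t ^ p.
  rewrite mulrzl; case: p => p; rewrite ?NegzE ?mulrNz -pmulrn ?cN cMn //.
pose d (r : nat) : R := 2 * pi / 2 ^+ r.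
have dS r : d r = d r.+1 *+ 2.
  rewrite /d exprS -(mulr_natr (_ / _)); field; rewrite expf_neq0 //.
have dX r : d r *+ (2 ^ r) = 2 * pi.
  by rewrite /d -(mulr_natr (_ / _)) natrX divfK // expf_neq0.
have dcvg : (d @ \oo --> (0 : R))%classic.
  have -> : d = (fun r => (2 * pi) * (2^-1) ^+ r).
    by apply/funext => r; rewrite /d exprVn.
  rewrite -[X in (_ --> X)%classic](mulr0 (2 * pi)); apply: cvgMr.
  by apply: cvg_expr; rewrite gtr0_norm //; lra.
have [r0 r0P] : exists r0, forall r, (r0 <= r)%N -> 0 < complex.Re (c (d r)).
  have : (complex.Re (c (d r)) @[r --> \oo] --> complex.Re (c 0))%classic.
    by apply: (@cvg_comp _ _ _ d (fun t => complex.Re (c t)) _ _ _ dcvg); exact: cc.1.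
  rewrite c0 /= => /cvgr_gt /(_ 0 ltr01) [r0 _ h]; exists r0 => r; exact: h.
have norm1 z q : (0 < q)%N -> z ^+ q = 1 :> R[i] ->
    complex.Re z ^+ 2 + complex.Im z ^+ 2 = 1.
  move=> q0 /(congr1 Num.norm); rewrite normrX normr1 => /eqP.
  rewrite pexpr_eq1 // => /eqP n1; have := add_Re2_Im2 z.
  by rewrite n1 expr1n => /(congr1 (@complex.Re R)).
have cd1 r : c (d r) ^+ (2 ^ r) = 1 by rewrite -cMn dX.
have [x xpi cx] : exists2 x, `|x| <= pi / 2 & c (d r0) = expi x.
  by apply: expi_onto; [apply: norm1 (cd1 r0); rewrite expn_gt0 | exact: r0P].
have : expi (x *+ 2 ^ r0) = 1 by rewrite expiMn -cx cd1.
move=> /expi_eq1 [k xk]; exists k.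
have xk' : x = k%:~R * d r0.
  have h : (2 ^+ r0 : R) != 0 by rewrite expf_neq0.
  have e : x * 2 ^+ r0 = k%:~R * (2 * pi) by rewrite -xk -natrX mulr_natr.
  by apply: (mulIf h); rewrite e /d; field.
have kr j : c (d (r0 + j)%N) = expi (k%:~R * d (r0 + j)%N).
  elim: j => [|j IH]; first by rewrite addn0 -xk'.
  have dj : d r0 = d (r0 + j.+1)%N * 2 ^+ j.+1.
    by rewrite /d exprD; field; rewrite !expf_neq0.
  have pj : 2 <= 2 ^+ j.+1 :> R by rewrite exprS ler_peMr // exprn_ege1 // ler1n.
  have p0 := @pi_gt0 R.
  rewrite addnS; apply: sqr_inj_Re_gt0.
  - by rewrite -addnS; apply: r0P; exact: leq_addr.
  (* As [x = k * d r0] has modulus at most pi/2, the finer angle has modulus at most pi/4, so its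
     cosine is positive. *)
  - rewrite -addnS /=; apply: cos_gt0_pihalf; rewrite -ltr_norml.
    have : `|k%:~R * d (r0 + j.+1)%N| * 2 <= pi / 2.
      have nx : `|x| = `|k%:~R * d (r0 + j.+1)%N| * 2 ^+ j.+1.
        by rewrite xk' dj mulrA [LHS]normrM [X in _ * X]ger0_norm // exprn_ge0.
      by apply: le_trans xpi; rewrite nx ler_wpM2l.
    lra.
  - by rewrite -cMn -dS IH dS mulrnAr expiMn.
apply: (eq_ccont_dyadic (r0 := r0)) => //; first exact: ccont_expi.
move=> r p rr; rewrite cz -/(d r) -(subnKC rr) kr.
rewrite [RHS](_ : _ = expi (p%:~R * (k%:~R * d (r0 + (r - r0))%N))); last by congr expi; ring.
rewrite [in RHS]mulrzl; case: p => p; rewrite ?NegzE ?mulrNz -pmulrn ?expiN expiMn //.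
Qed.

End ContinuousComplex.

(** Finite families suffice: a finite subfamily whose span has the largest dimension (at most d^2)
    spans every [A i], and a basis diagonalizing it diagonalizes its span. *)
Lemma commuting_diagonalizable_family (F : fieldType) (I : Type) (d : nat)
    (A : I -> 'M[F]_d) :
  (forall i j, A i *m A j = A j *m A i) -> (forall i, diagonalizable (A i)) ->
  exists2 P : 'M[F]_d, P \in unitmx &
    forall i, is_diag_mx (P *m A i *m invmx P).
Proof.
move=> cA dA.
pose S (s : seq I) := (\sum_(i <- s) <<mxvec (A i)>>)%MS.
pose p (k : nat) := `[< exists s, \rank (S s) = k >].
have p0 : p 0%N by apply/asboolP; exists [::]; rewrite /S big_nil mxrank0.
have pmax k : p k -> (k <= d * d)%N.
  by move=> /asboolP [s <-]; exact: rank_leq_row.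
case: (ex_maxnP (ex_intro p _ p0) pmax) => k /asboolP [s sk] kmax.
have Ain i : (mxvec (A i) <= S s)%MS.
  have sub : (S s <= S (i :: s))%MS by rewrite /S big_cons addsmxSr.
  have := mxrank_leqif_sup sub => -[_ /esym].
  have -> : \rank (S s) == \rank (S (i :: s)).
    rewrite eqn_leq mxrankS // sk; apply: kmax; apply/asboolP.
    by exists (i :: s).
  move=> h; apply: submx_trans h; rewrite /S big_cons.
  by apply: submx_trans (addsmxSl _ _); rewrite genmxE.
have [|P Pu /allP Pd] := (codiagonalizableP [seq A i | i <- s]).1.
  have h (X : 'M[F]_d) (r : seq I) : X \in [seq A i | i <- r] -> exists i, X = A i.
    elim: r => //= i r IH; rewrite inE => /orP[/eqP ->|/IH//]; by exists i.
  split=> [X Y|X] /h[i ->]; last exact: dA.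
  by move=> /h[j ->]; exact: cA.
exists P => // i.
pose f (X : 'M[F]_d) := P *m X *m invmx P.
have fZ a X : f (a *: X) = a *: f X by rewrite /f -scalemxAr -scalemxAl.
have fD X Y : f (X + Y) = f X + f Y by rewrite /f mulmxDr mulmxDl.
have : (mxvec (A i) <= S s)%MS by [].
have : forall X, X \in [seq A i | i <- s] -> is_diag_mx (f X).
  by move=> X Xs; have := Pd X Xs; rewrite /= /similar_to conjumx.
rewrite -/(f (A i)); move: (A i); rewrite /S.
have f0 : f 0 = 0 by rewrite /f mulmx0 mul0mx.
clearbody f; clear - fZ fD f0.
elim: s => [|i s IH] X Xd.
  rewrite big_nil submx0 => /eqP /(congr1 vec_mx); rewrite mxvecK => ->.
  by rewrite linear0 f0 mx0_is_diag.
rewrite big_cons => /sub_addsmxP [[u v] /= e].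
have /sub_rVP [a ea] : (u *m <<mxvec (A i)>> <= mxvec (A i))%MS.
  by apply: submx_trans (submxMl _ _) _; rewrite genmxE.
move/(congr1 vec_mx): e; rewrite mxvecK ea => ->.
rewrite linearD linearZ /= mxvecK fD fZ.
apply/is_diag_mxP => j k jk; rewrite !mxE.
have /is_diag_mxP -> // : is_diag_mx (f (A i)) by apply: Xd; rewrite mem_head.
have /is_diag_mxP -> // : is_diag_mx (f (vec_mx (v *m (\sum_(i <- s) <<mxvec (A i)>>)%MS))).
  apply: IH => [Y Ys|]; first by apply: Xd; rewrite inE Ys orbT.
  by rewrite vec_mxK submxMl.
by rewrite mulr0 addr0.
Qed.

Section CircleRep.
Variable R : realType.

Lemma expi_prim_root (q : nat) : (0 < q)%N ->
  q.-primitive_root (expi (2 * pi / q%:R : R)).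
Proof.
move=> q0; rewrite /primitive_root_of_unity q0; apply/forallP => i.
rewrite unity_rootE -expiMn; apply/eqP.
have qn : q%:R != 0 :> R by rewrite pnatr_eq0 -lt0n.
have [->|ne] := eqVneq i.+1 q.
  by rewrite -(mulr_natr (_ / _)) divfK // expi_2pi eqxx.
apply/negbTE; apply: expi_neq1.
have p0 := @pi_gt0 R.
have iq : (i.+1 < q)%N by rewrite ltn_neqAle ne ltn_ord.
rewrite -(mulr_natr (_ / _)) -mulrA ger0_norm; last first.
  by rewrite mulr_ge0 ?mulr_ge0 ?invr_ge0 //; lra.
rewrite mulr_gt0 ?mulr_gt0 ?invr_gt0 ?ltr0n //=.
by rewrite gtr_pMr ?mulr_gt0 // mulrC ltr_pdivrMr ?ltr0n // mul1r ltr_nat.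
Qed.

(** The minimal polynomial divides X^q - 1, which splits with distinct roots. *)
Lemma diagonalizable_finite_order (d q : nat) (A : 'M[R[i]]_d.+1) :
  (0 < q)%N -> A ^+ q = 1 -> diagonalizable A.
Proof.
move=> q0 Aq; apply/diagonalizableP.
have pr := expi_prim_root q0; set z := expi _ in pr.
exists [seq z ^+ i | i <- iota 0 q].
  rewrite map_inj_in_uniq ?iota_uniq // => i j; rewrite !mem_iota /= add0n => iq jq.
  by move/eqP; rewrite (eq_prim_root_expr pr) !modn_small // => /eqP.
rewrite big_map.
have -> : iota 0 q = index_iota 0 q by rewrite /index_iota subn0.
rewrite factor_Xn_sub_1 //; apply: mxminpoly_min.
by rewrite rmorphB rmorphXn /= horner_mx_X Aq rmorph1 subrr.
Qed.

(** At the angles 2 pi p / 2^r every [T i] has finite order, so all these commuting matrices are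
    diagonal in one basis. Continuity extends this to all angles, where each diagonal entry is a
    character of the circle. Continuity alone thus makes [T] an explicit smooth function. *)
Lemma circle_rep_diag (I : Type) (d : nat) (T : I -> R -> 'M[R[i]]_d) :
  (forall i s t, T i (s + t) = T i s *m T i t) ->
  (forall i, T i 0 = 1%:M) -> (forall i, T i (2 * pi) = 1%:M) ->
  (forall i j s t, T i s *m T j t = T j t *m T i s) ->
  (forall i a b, ccont (fun t => T i t a b)) ->
  exists2 P : 'M[R[i]]_d, P \in unitmx & exists k : I -> 'I_d -> int,
    forall i t, T i t =
      invmx P *m diag_mx (\row_j expi ((k i j)%:~R * t)) *m P.
Proof.
case: d T => [|d] T TD T0 T2 Tc Tcont.
  exists 1%:M; first exact: unitmx1.
  by exists (fun=> fun=> 0) => i t; apply/matrixP => -[].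
have TMn i t n : T i (t *+ n) = T i t ^+ n.
  elim: n => [|n IH]; first by rewrite mulr0n T0.
  by rewrite mulrS exprS TD IH.
pose x (r : nat) (p : int) : R := p%:~R * (2 * pi / 2 ^+ r).
have [P Pu Pd] : exists2 P : 'M[R[i]]_d.+1, P \in unitmx &
    forall u : I * nat * int, is_diag_mx (P *m T u.1.1 (x u.1.2 u.2) *m invmx P).
  apply: (commuting_diagonalizable_family
    (A := fun u : I * nat * int => T u.1.1 (x u.1.2 u.2))).
    by move=> u v; exact: Tc.
  move=> [[i r] p] /=; apply: (@diagonalizable_finite_order _ (2 ^ r)).
    by rewrite expn_gt0.
  rewrite -TMn /x; have -> : p%:~R * (2 * pi / 2 ^+ r) *+ 2 ^ r = p%:~R * (2 * pi) :> R.
    rewrite -(mulr_natr (_ * (_ / _))) natrX -mulrA divfK // expf_neq0 //.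
  rewrite mulrzl; have T2n n : T i (2 * pi *+ n) = 1.
    by rewrite TMn T2; exact: expr1n.
  case: p => p; rewrite ?NegzE ?mulrNz -pmulrn ?T2n //.
  have := TD i (- (2 * pi *+ p.+1)) (2 * pi *+ p.+1).
  by rewrite addNr T0 T2n [_ *m 1](mulmx1 _) => <-.
exists P => //.
pose f i t := P *m T i t *m invmx P.
have fcont i a b : ccont (fun t => f i t a b).
  have -> : (fun t => f i t a b) =
      (fun t => \sum_k (\sum_l P a l * T i t l k) * invmx P k b).
    by apply/funext => t; rewrite !mxE; apply: eq_bigr => k _; rewrite !mxE.
  apply: ccont_sum => k; apply: ccontM; last exact: ccont_cst.
  by apply: ccont_sum => l; apply: ccontM; [exact: ccont_cst | exact: Tcont].
have fd i t a b : a != b -> f i t a b = 0.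
  move=> ab; move: t; apply: (eq_ccont_dyadic (r0 := 0) (fcont i a b) (ccont_cst 0)).
  by move=> r p _; have /is_diag_mxP := Pd (i, r, p); apply.
have fD i s t : f i (s + t) = f i s *m f i t.
  by rewrite /f TD !mulmxA mulmxKV.
have fe i j : exists k : int, forall t, f i t j j = expi (k%:~R * t).
  apply: (@circle_char R (fun t => f i t j j)) => [s t|||].
  - rewrite fD mxE (bigD1 j) //= big1 ?addr0 // => k kj.
    by rewrite [f i s j k]fd ?mul0r // eq_sym.
  - by rewrite /f T0 mulmx1 mulmxV // mxE eqxx.
  - by rewrite /f T2 mulmx1 mulmxV // mxE eqxx.
  - exact: (fcont i j j).
pose k i j := projT1 (cid (fe i j)); exists k => i t.
have -> : diag_mx (\row_j expi ((k i j)%:~R * t)) = f i t.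
  apply/matrixP => a b; rewrite mxE mxE; case: (eqVneq a b) => [->|ab].
    by rewrite mulr1n /k; case: cid => /= q ->.
  by rewrite fd // mulr0n.
by rewrite /f !mulmxA mulVmx // mul1mx -mulmxA mulVmx // mulmx1.
Qed.

End CircleRep.

(** * Derivatives at 0 of complex and matrix-valued curves *)

Section ComplexDerivative.
Variable R : realType.
Implicit Types (f g : R -> R[i]) (l : R[i]).

(** Only the derivative at 0 is coded: every curve to be differentiated passes through the identity
    at time 0. *)
Definition cderive f l : Prop :=
  is_derive (0 : R) 1 (fun t => complex.Re (f t)) (complex.Re l) /\
  is_derive (0 : R) 1 (fun t => complex.Im (f t)) (complex.Im l).

Lemma cderive_unique f l l' : cderive f l -> cderive f l' -> l = l'.
Proof.
move=> [a b] [c d]; apply: complex_eq.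
  by rewrite -(@derive_val _ _ _ _ _ _ _ a) -(@derive_val _ _ _ _ _ _ _ c).
by rewrite -(@derive_val _ _ _ _ _ _ _ b) -(@derive_val _ _ _ _ _ _ _ d).
Qed.

Lemma cderive_cst l : cderive (fun=> l) 0.
Proof. by split; exact: is_derive_cst. Qed.

Lemma cderiveD f g l l' :
  cderive f l -> cderive g l' -> cderive (fun t => f t + g t) (l + l').
Proof.
move=> [a b] [c d]; split; rewrite ?ReD ?ImD.
  under eq_fun do rewrite ReD.
  exact: is_deriveD.
under eq_fun do rewrite ImD.
exact: is_deriveD.
Qed.

Lemma cderiveM f g l l' : cderive f l -> cderive g l' ->
  cderive (fun t => f t * g t) (f 0 * l' + l * g 0).
Proof.
move=> [a b] [c d]; split.
  have -> : (fun t => complex.Re (f t * g t)) =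
     (fun t => complex.Re (f t)) * (fun t => complex.Re (g t)) -
     (fun t => complex.Im (f t)) * (fun t => complex.Im (g t)).
    by apply/funext => t; exact: Re_mul.
  apply: is_derive_eq; rewrite ReD !Re_mul /GRing.scale /=; ring.
have -> : (fun t => complex.Im (f t * g t)) =
   (fun t => complex.Re (f t)) * (fun t => complex.Im (g t)) +
   (fun t => complex.Im (f t)) * (fun t => complex.Re (g t)).
  by apply/funext => t; exact: Im_mul.
apply: is_derive_eq; rewrite ImD !Im_mul /GRing.scale /=; ring.
Qed.

Lemma cderive_sum (I : Type) (r : seq I) (F : I -> R -> R[i]) (L : I -> R[i]) :
  (forall i, cderive (F i) (L i)) ->
  cderive (fun t => \sum_(i <- r) F i t) (\sum_(i <- r) L i).
Proof.
move=> h; elim: r => [|i r IH].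
  by rewrite big_nil; under eq_fun do rewrite big_nil; exact: cderive_cst.
by rewrite big_cons; under eq_fun do rewrite big_cons; exact: cderiveD.
Qed.

Lemma cderive_comp f l (x : R -> R) (x' : R) : cderive f l ->
  x 0 = 0 -> is_derive (0 : R) 1 x x' -> cderive (fun t => f (x t)) (x'%:C * l).
Proof.
move=> [a b] x0 dx; split.
  have -> : complex.Re (x'%:C * l) = complex.Re l * x' by rewrite Re_mul /=; ring.
  apply: (@is_derive1_comp _ (fun t => complex.Re (f t))) => //; by rewrite x0.
have -> : complex.Im (x'%:C * l) = complex.Im l * x' by rewrite Im_mul /=; ring.
apply: (@is_derive1_comp _ (fun t => complex.Im (f t))) => //; by rewrite x0.
Qed.

Lemma cderive_real (x : R -> R) (x' : R) :
  is_derive (0 : R) 1 x x' -> cderive (fun t => (x t)%:C) x'%:C.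
Proof. by move=> h; split => //=; exact: is_derive_cst. Qed.

Lemma cderive_expi (k : R) : cderive (fun t => expi (k * t)) (k%:C * 'i%C).
Proof.
have dk : is_derive (0 : R) 1 (fun t => k * t) k.
  have -> : (fun t => k * t) = k *: (@id R).
    by apply/funext.
  apply: is_derive_eq; rewrite /GRing.scale /= mulr1 //.
apply: cderive_comp => //; last exact: mulr0.
split => /=.
  by apply: is_derive_eq; rewrite sin0 oppr0.
by apply: is_derive_eq; rewrite cos0.
Qed.

End ComplexDerivative.

Section MatrixDerivative.
Variable R : realType.

Definition mxderive (m n : nat) (F : R -> 'M[R[i]]_(m, n)) (L : 'M[R[i]]_(m, n)) :=
  forall i j, cderive (fun t => F t i j) (L i j).

Lemma mxderive_unique m n (F : R -> 'M[R[i]]_(m, n)) L L' :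
  mxderive F L -> mxderive F L' -> L = L'.
Proof.
by move=> h h'; apply/matrixP => i j; apply: cderive_unique (h i j) (h' i j).
Qed.

Lemma mxderive_cst m n (A : 'M[R[i]]_(m, n)) : mxderive (fun=> A) 0.
Proof. by move=> i j; rewrite mxE; exact: cderive_cst. Qed.

Lemma mxderiveM m n p (F : R -> 'M[R[i]]_(m, n)) (G : R -> 'M[R[i]]_(n, p)) L L' :
  mxderive F L -> mxderive G L' ->
  mxderive (fun t => F t *m G t) (F 0 *m L' + L *m G 0).
Proof.
move=> h h' i j; rewrite !mxE -big_split /=.
under eq_fun do rewrite mxE.
by apply: cderive_sum => k; exact: cderiveM.
Qed.

Lemma mxderiveMr m n p (F : R -> 'M[R[i]]_(m, n)) (A : 'M[R[i]]_(n, p)) L :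
  mxderive F L -> mxderive (fun t => F t *m A) (L *m A).
Proof.
by move=> h; have := mxderiveM h (mxderive_cst A); rewrite mulmx0 add0r.
Qed.

Lemma mxderiveMl m n p (G : R -> 'M[R[i]]_(n, p)) (A : 'M[R[i]]_(m, n)) L :
  mxderive G L -> mxderive (fun t => A *m G t) (A *m L).
Proof.
by move=> h; have := mxderiveM (mxderive_cst A) h; rewrite mul0mx addr0.
Qed.

Lemma mxderive_comp m n (F : R -> 'M[R[i]]_(m, n)) L (x : R -> R) (x' : R) :
  mxderive F L -> x 0 = 0 -> is_derive (0 : R) 1 x x' ->
  mxderive (fun t => F (x t)) (x'%:C *: L).
Proof. by move=> h x0 dx i j; rewrite mxE; exact: (cderive_comp (h i j)). Qed.

Lemma mxderive_sum m n (I : Type) (r : seq I)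
    (F : I -> R -> 'M[R[i]]_(m, n)) (L : I -> 'M[R[i]]_(m, n)) :
  (forall i, mxderive (F i) (L i)) ->
  mxderive (fun t => \sum_(i <- r) F i t) (\sum_(i <- r) L i).
Proof.
move=> h i j; rewrite summxE.
under eq_fun do rewrite summxE.
by apply: cderive_sum => k; exact: h.
Qed.

Lemma near_eq_mxderive m n (F G : R -> 'M[R[i]]_(m, n)) L :
  (\forall t \near (0 : R), F t = G t) -> mxderive F L -> mxderive G L.
Proof.
move=> FG h i j; have [a b] := h i j.
by split; [apply: near_eq_is_derive a | apply: near_eq_is_derive b];
  apply: filterS FG => t ->.
Qed.

Lemma mxderiveZ m n (f : R -> R[i]) (A : 'M[R[i]]_(m, n)) l :
  cderive f l -> mxderive (fun t => f t *: A) (l *: A).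
Proof.
move=> h i j; rewrite mxE.
under eq_fun do rewrite mxE.
by have := cderiveM h (cderive_cst (A i j)); rewrite mulr0 add0r.
Qed.

Lemma mxderive_diag_expi d (P : 'M[R[i]]_d) (k : 'I_d -> R) :
  mxderive (fun t => invmx P *m diag_mx (\row_j expi (k j * t)) *m P)
           (invmx P *m diag_mx (\row_j ((k j)%:C * 'i%C)) *m P).
Proof.
apply/mxderiveMr/mxderiveMl => a b; rewrite !mxE.
under eq_fun do rewrite !mxE.
case: eqVneq => _; last exact: cderive_cst.
exact: cderive_expi.
Qed.

End MatrixDerivative.

(** * Plane rotations *)

Section PlaneRotations.
Variables (R : realType) (N : nat).
Implicit Types (p q r : 'I_N) (s t : R).

(** Left multiplication mixes only the rows p and q. Together with [mulmx_ext], this turns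
    identities between products of plane rotations into case splits on the row index. *)
Lemma plane_rot_mull m p q t (X : 'M[R]_(N, m)) i j : p != q ->
  (plane_rot p q t *m X) i j =
    if i == p then cos t * X p j - sin t * X q j
    else if i == q then sin t * X p j + cos t * X q j
    else X i j.
Proof.
move=> pq; rewrite mxE (bigD1 p) //= (bigD1 q) /=; last by rewrite eq_sym.
rewrite !mxE !eqxx ?(eq_sym q p) ?(negbTE pq) /= ?orbF ?andbF ?andbT /= ?orbT.
have [->|ip] := eqVneq i p.
  rewrite (negbTE pq) /= big1 ?addr0 ?mulNr // => k /andP[kp kq].
  by rewrite !mxE eqxx (negbTE kp) (negbTE kq) /= (negbTE pq) /= eq_sym (negbTE kp) mul0r.
have [->|iq] := eqVneq i q.
  rewrite /= big1 ?addr0 // => k /andP[kp kq].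
  rewrite !mxE eqxx (negbTE kp) (negbTE kq) eq_sym (negbTE pq) /=.
  by rewrite eq_sym (negbTE kq) mul0r.
rewrite /= !mul0r !add0r (bigD1 i) ?ip //= big1 ?addr0.
  by rewrite !mxE (negbTE ip) (negbTE iq) /= eqxx mul1r.
move=> k /andP[_ ki]; rewrite !mxE (negbTE ip) (negbTE iq) /= eq_sym (negbTE ki).
by rewrite mul0r.
Qed.


Lemma mulmx_ext (A B : 'M[R]_N) :
  (forall X : 'M[R]_N, A *m X = B *m X) -> A = B.
Proof. by move=> /(_ 1%:M); rewrite !mulmx1. Qed.

Lemma plane_rotD p q s t : p != q ->
  plane_rot p q (s + t) = plane_rot p q s *m plane_rot p q t.
Proof.
move=> pq; apply: mulmx_ext => X; rewrite -mulmxA; apply/matrixP => i j.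
rewrite !plane_rot_mull // !eqxx ?(eq_sym q p) (negbTE pq) cosD sinD.
by case: eqP => _; [ring | case: eqP => _ //; ring].
Qed.

Lemma plane_rot0 p q : p != q -> plane_rot p q (0 : R) = 1%:M.
Proof.
move=> pq; apply: mulmx_ext => X; rewrite mul1mx; apply/matrixP => i j.
rewrite plane_rot_mull // cos0 sin0.
case: eqP => [->|_]; first by ring.
by case: eqP => [->|_] //; ring.
Qed.

Lemma plane_rot_2pi p q : p != q -> plane_rot p q (2 * pi : R) = 1%:M.
Proof.
move=> pq; rewrite -(plane_rot0 pq); apply/matrixP => i j.
by rewrite !mxE mulr_natl cos2pi sin2pi cos0 sin0.
Qed.

Lemma plane_rotC p q t : p != q -> plane_rot q p t = plane_rot p q (- t).
Proof.
move=> pq; apply/matrixP => i j; rewrite !mxE cosN sinN opprK.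
case: (eqVneq i p) => [->|ip]; case: (eqVneq j p) => [->|jp];
  rewrite ?eqxx ?(negbTE pq) ?andbF ?orbF //=.
Qed.

Lemma trmx_plane_rot p q t : p != q -> (plane_rot p q t)^T = plane_rot p q (- t).
Proof.
move=> pq; apply/matrixP => i j; rewrite !mxE cosN sinN opprK (eq_sym i j).
case: (eqVneq i p) => [->|ip]; case: (eqVneq j p) => [->|jp];
  rewrite ?eqxx ?(negbTE pq) ?andbF ?orbF //= ?andbT //.
by rewrite andbC.
Qed.

Lemma plane_rotN_mul p q t : p != q -> plane_rot p q (- t) *m plane_rot p q t = 1%:M.
Proof. by move=> pq; rewrite -plane_rotD // addNr plane_rot0. Qed.

Lemma plane_rot_SO p q t : p != q -> SO (plane_rot p q t).
Proof.
move=> pq; have orth (u : R) : (plane_rot p q u)^T *m plane_rot p q u = 1%:M.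
  by rewrite trmx_plane_rot // plane_rotN_mul.
split=> //.
(* The rotation is the square of A, the rotation by t/2, and det(A)^2 = det(A^T A) = 1. *)
have -> : t = t / 2 + t / 2 by lra.
rewrite plane_rotD // det_mulmx -[X in X * _]det_tr -det_mulmx orth.
exact: det1.
Qed.

Lemma plane_rot_comm p q r k s t : p != q -> r != k ->
  p != r -> p != k -> q != r -> q != k ->
  plane_rot p q s *m plane_rot r k t = plane_rot r k t *m plane_rot p q s.
Proof.
move=> pq rk pr pk qr qk.
apply: mulmx_ext => X; rewrite -!mulmxA; apply/matrixP => i j.
rewrite !plane_rot_mull // ?(eq_sym r p) ?(eq_sym r q) ?(eq_sym k p) ?(eq_sym k q).
rewrite (negbTE pr) (negbTE pk) (negbTE qr) (negbTE qk).
case: (eqVneq i p) => [->|ip]; first by rewrite (negbTE pr) (negbTE pk).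
by case: (eqVneq i q) => [->|iq] //; rewrite (negbTE qr) (negbTE qk).
Qed.

Lemma mx_continuous (T : topologicalType) m n (F : T -> 'M[R]_(m, n)) :
  (forall i j, continuous (fun y => F y i j)) -> continuous F.
Proof.
move=> cF x A [B BA sub]; rewrite /nbhs /=.
have : \forall y \near x, forall i j, B i j (F y i j).
  apply: filter_forall => i; apply: filter_forall => j; exact: cF (BA i j).
by apply: filterS => y; exact: sub.
Qed.

Lemma plane_rot_continuous p q : continuous (@plane_rot R N p q).
Proof.
apply: mx_continuous => i j.
have h : (fun t => plane_rot p q t i j) = (fun t =>
    if (i == p) && (j == p) || (i == q) && (j == q) then cos t
    else if (i == p) && (j == q) then - sin t
    else if (i == q) && (j == p) then sin t
    else (i == j)%:R).
  by apply/funext => t; rewrite mxE.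
rewrite h {h}.
case: (_ || _); first exact: continuous_cos.
case: ((i == p) && (j == q)); first by move=> x; apply: cvgN; exact: continuous_sin.
by case: (_ && _); [exact: continuous_sin | move=> x; exact: cvg_cst].
Qed.

End PlaneRotations.

(** * Conjugating one plane rotation by another *)

Lemma atan_polar (R : realType) (a b k : R) : 0 < a -> 0 < k ->
  k ^+ 2 = a ^+ 2 + b ^+ 2 ->
  k * cos (atan (b / a)) = a /\ k * sin (atan (b / a)) = b.
Proof.
move=> a0 k0 e.
have cc : k * cos (atan (b / a)) = a.
  have a1 : 0 < 1 + (b / a) ^+ 2 by have := sqr_ge0 (b / a); lra.
  rewrite cos_atan; have -> : 1 + (b / a) ^+ 2 = (k / a) ^+ 2.
    by rewrite [RHS]expr_div_n e; field; rewrite gt_eqF.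
  rewrite sqrtr_sqr gtr0_norm ?divr_gt0 //; field.
  by rewrite !gt_eqF.
split=> //.
have c0 : cos (atan (b / a)) != 0.
  by apply/eqP => c0; move: cc; rewrite c0 mulr0 => a00; rewrite -a00 ltxx in a0.
have -> : sin (atan (b / a)) = (b / a) * cos (atan (b / a)).
  by rewrite -{2}(atanK (b / a)) /tan divfK.
by rewrite mulrCA cc divfK // gt_eqF.
Qed.

Section Conjugation.
Variables (R : realType) (N : nat) (p q r : 'I_N).
Hypotheses (pq : p != q) (qr : q != r) (pr : p != r).
Variable t : R.
Let c := cos t.
Let S := sin t.

(** The angles x, y, z are read off the conjugate as one reads off Euler angles: its entry (p, r)
    must be -sin y, the rest of column r gives tan x, the rest of row p gives tan z. *)
Definition conj_x (s : R) : R := atan (c * tan s).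
Definition conj_y (s : R) : R := - asin (sin s * S).
Definition conj_z (s : R) : R :=
  atan (- ((1 - cos s) * (c * S)) / (c ^+ 2 + cos s * S ^+ 2)).

(** The condition on s makes cos y cos x and cos y cos z positive, so the arctangents give the
    angles themselves and not the angles shifted by pi. *)
Lemma conj_plane_rot s : 0 < cos s ->
  plane_rot p q t *m plane_rot q r s *m plane_rot p q (- t) =
  plane_rot q r (conj_x s) *m plane_rot p r (conj_y s) *m plane_rot p q (conj_z s).
Proof.
move=> g0; pose g := cos s; pose o := sin s; rewrite -/g in g0.
have c2 : c ^+ 2 = 1 - S ^+ 2 by have := cos2Dsin2 t; rewrite -/c -/S; lra.
have o2 : o ^+ 2 = 1 - g ^+ 2 by have := cos2Dsin2 s; rewrite -/g -/o; lra.
have g1 : g <= 1 by exact: cos_le1.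
have S2 := sqr_ge0 S; have C2 := sqr_ge0 c.
have oS : (o * S) ^+ 2 < 1.
  rewrite exprMn o2; have : 0 < g ^+ 2 by rewrite exprn_gt0.
  by move: S2 C2; rewrite c2; nra.
have hpp : 0 < c ^+ 2 + g * S ^+ 2 by rewrite c2; nra.
have /andP[oS1 oS2] : -1 < o * S < 1.
  by rewrite -ltr_norml -(@expr_lt1 _ 2) // real_normK ?num_real.
set x := conj_x s; set y := conj_y s; set z := conj_z s.
have sy : sin y = - (o * S).
  by rewrite /y /conj_y -/o sinN asinK // in_itv /= !ltW.
have cy2 : cos y ^+ 2 = 1 - o ^+ 2 * S ^+ 2.
  by have := cos2Dsin2 y; rewrite sy sqrrN exprMn; lra.
have cy : 0 < cos y.
  rewrite /y /conj_y -/o cosN cos_asin ?sqrtr_gt0 ?subr_gt0 //.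
  by rewrite !ltW.
have [cx sx] : cos y * cos x = g /\ cos y * sin x = c * o.
  have -> : x = atan (c * o / g) by rewrite /x /conj_x /tan -/g -/o mulrA.
  apply: atan_polar => //; rewrite cy2 exprMn c2 o2; ring.
have [cz sz] : cos y * cos z = c ^+ 2 + g * S ^+ 2 /\
               cos y * sin z = - ((1 - g) * (c * S)).
  apply: atan_polar => //; rewrite cy2 sqrrN !exprMn c2 o2 -/g; ring.
(* The entries in rows q, r and columns p, q are checked after multiplication by cos^2 y, which
   turns the sines and cosines of x and z into the known entries of row p and column r. *)
have cyn : cos y ^+ 2 != 0 by rewrite expf_neq0 // gt_eqF.
have Eqp : cos x * sin z - sin x * sin y * cos z = (1 - g) * (c * S).
  apply: (mulfI cyn); transitivity ((cos y * cos x) * (cos y * sin z)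
     - (cos y * sin x) * sin y * (cos y * cos z)); first by ring.
  rewrite cx sz sx sy cz cy2.
  transitivity (- g * (1 - g) * c * S + o ^+ 2 * (c * S) * (c ^+ 2 + g * S ^+ 2)).
    by ring.
  by rewrite o2 c2; ring.
have Eqq : cos x * cos z + sin x * sin y * sin z = S ^+ 2 + g * c ^+ 2.
  apply: (mulfI cyn); transitivity ((cos y * cos x) * (cos y * cos z)
     + (cos y * sin x) * sin y * (cos y * sin z)); first by ring.
  rewrite cx sz sx sy cz cy2.
  transitivity (g * (c ^+ 2 + g * S ^+ 2) + o ^+ 2 * c ^+ 2 * S ^+ 2 * (1 - g)).
    by ring.
  by rewrite o2 c2; ring.
have Erp : sin x * sin z + cos x * sin y * cos z = - (o * S).
  apply: (mulfI cyn); transitivity ((cos y * sin x) * (cos y * sin z)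
     + (cos y * cos x) * sin y * (cos y * cos z)); first by ring.
  rewrite cx sz sx sy cz cy2.
  transitivity (- (o * S) * ((1 - g) * c ^+ 2 + g * (c ^+ 2 + g * S ^+ 2))).
    by ring.
  by rewrite o2 c2; ring.
have Erq : sin x * cos z - cos x * sin y * sin z = o * c.
  apply: (mulfI cyn); transitivity ((cos y * sin x) * (cos y * cos z)
     - (cos y * cos x) * sin y * (cos y * sin z)); first by ring.
  rewrite cx sz sx sy cz cy2.
  transitivity ((o * c) * ((c ^+ 2 + g * S ^+ 2) - g * (1 - g) * S ^+ 2)).
    by ring.
  by rewrite o2 c2; ring.
apply: mulmx_ext => X; rewrite -!mulmxA; apply/matrixP => i j.
rewrite !plane_rot_mull // !eqxx ?(eq_sym q p) ?(eq_sym r p) ?(eq_sym r q).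
rewrite ?(negbTE pq) ?(negbTE qr) ?(negbTE pr) cosN sinN -/c -/S -/g -/o.
clearbody x y z.
case: (eqVneq i p) => [->|ip].
  rewrite ?(negbTE pq) ?(negbTE pr).
  transitivity ((c ^+ 2 + g * S ^+ 2) * X p j + (1 - g) * (c * S) * X q j + o * S * X r j).
    by ring.
  have -> : (1 - g) * (c * S) = - (cos y * sin z) by rewrite sz opprK.
  have -> : o * S = - sin y by rewrite sy opprK.
  by rewrite -cz; ring.
case: (eqVneq i q) => [_|iq].
  transitivity ((1 - g) * (c * S) * X p j + (S ^+ 2 + g * c ^+ 2) * X q j - c * o * X r j).
    by ring.
  by rewrite -Eqp -Eqq -sx; ring.
case: (eqVneq i r) => [_|ir] //.
transitivity (- (o * S) * X p j + o * c * X q j + g * X r j); first by ring.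
by rewrite -Erp -Erq -cx; ring.
Qed.

Lemma conj_x0 : conj_x 0 = 0.
Proof. by rewrite /conj_x /tan sin0 mul0r mulr0 atan0. Qed.

Lemma conj_y0 : conj_y 0 = 0.
Proof. by rewrite /conj_y sin0 mul0r -[X in asin X](sin0 R) sinK ?oppr0 // in_itv /=; have := @pi_gt0 R; move=> h; apply/andP; split; lra. Qed.

Lemma conj_z0 : conj_z 0 = 0.
Proof. by rewrite /conj_z cos0 subrr mul0r oppr0 mul0r atan0. Qed.

Lemma is_derive_conj_x : is_derive (0 : R) 1 conj_x c.
Proof.
have c0 : cos (0 : R) != 0 by rewrite cos0 oner_neq0.
have h1 := is_derive_tan c0.
have h2 : is_derive (0 : R) 1 (fun s => c * tan s) c.
  have -> : (fun s => c * tan s) = c *: (@tan R) by apply/funext.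
  by apply: is_derive_eq; rewrite cos0 expr1n invr1 /GRing.scale /= mulr1.
rewrite -[X in is_derive _ _ _ X]mul1r.
apply: (@is_derive1_comp _ atan (fun s => c * tan s)).
apply: (is_derive_eq (is_derive1_atan _)).
by rewrite /tan sin0 mul0r mulr0 expr0n addr0 invr1.
Qed.

Lemma is_derive_conj_y : is_derive (0 : R) 1 conj_y (- S).
Proof.
have h2 : is_derive (0 : R) 1 (fun s => sin s * S) S.
  have -> : (fun s => sin s * S) = S *: (@sin R).
    by apply/funext => s; rewrite mulrC.
  by apply: is_derive_eq; rewrite cos0 /GRing.scale /= mulr1.
have h1 : is_derive (0 : R) 1 (asin \o (fun s => sin s * S)) (1 * S).
  apply: is_derive1_comp; rewrite sin0 mul0r.
  have i1 : -1 < (0 : R) < 1 by apply/andP; split; lra.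
  apply: (is_derive_eq (is_derive1_asin i1)).
  by rewrite expr0n subr0 sqrtr1 invr1.
rewrite mul1r in h1.
have -> : conj_y = - (asin \o (fun s => sin s * S)) by apply/funext.
exact: is_deriveN.
Qed.

Lemma is_derive_conj_z : is_derive (0 : R) 1 conj_z 0.
Proof.
pose u (s : R) := - ((1 - cos s) * (c * S)).
pose v (s : R) := c ^+ 2 + cos s * S ^+ 2.
have du : is_derive (0 : R) 1 u 0.
  have -> : u = - ((c * S) *: (cst 1 - @cos R)).
    by apply/funext => s; rewrite /u; rewrite mulrC.
  by apply: is_derive_eq; rewrite sin0 oppr0 subr0 scaler0 oppr0.
have dv : is_derive (0 : R) 1 v 0.
  have -> : v = cst (c ^+ 2) + S ^+ 2 *: (@cos R).
    by apply/funext => s; rewrite /v [in LHS]mulrC.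
  rewrite -[X in is_derive _ _ _ X](_ : 0 + S ^+ 2 *: - sin 0 = 0).
    by apply: is_deriveD.
  by rewrite sin0 oppr0 scaler0 addr0.
have v0 : v 0 != 0.
  by rewrite /v cos0 mul1r cos2Dsin2 oner_neq0.
have dvi := is_deriveV v0 dv.
have h : is_derive (0 : R) 1 (u * (fun s => (v s)^-1)) 0.
  by apply: is_derive_eq; rewrite !scaler0 addr0.
have -> : conj_z = atan \o (u * (fun s => (v s)^-1)) by apply/funext.
rewrite -[X in is_derive _ _ _ X](mulr0 ((1 + ((u * (fun s => (v s)^-1)) 0) ^+ 2)^-1)).
exact: is_derive1_comp.
Qed.

End Conjugation.

(** * Generation of SO(N) by plane rotations *)

Section Generation.
Variable R : realType.

Lemma SO_mul N (g h : 'M[R]_N) : SO g -> SO h -> SO (g *m h).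
Proof.
move=> [g1 g2] [h1 h2]; split; last by rewrite det_mulmx g2 h2 mul1r.
by rewrite trmx_mul mulmxA -(mulmxA h^T) g1 mulmx1.
Qed.

Lemma SO1 N : SO (1%:M : 'M[R]_N).
Proof. by split; [rewrite trmx1 mulmx1 | rewrite det1]. Qed.

Lemma SO_tr N (g : 'M[R]_N) : SO g -> SO g^T.
Proof.
move=> [g1 g2]; split; last by rewrite det_tr.
by rewrite trmxK; exact: mulmx1C.
Qed.

Lemma rotate_to_axis (a b : R) :
  exists t, sin t * a + cos t * b = 0 /\ 0 <= cos t * a - sin t * b.
Proof.
have [t ht] : exists t, sin t * a + cos t * b = 0.
  have [->|a0] := eqVneq a 0.
    by exists (pi / 2); rewrite cos_pihalf mul0r mulr0 addr0.
  exists (atan (- b / a)).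
  have c0 : cos (atan (- b / a)) != 0 by rewrite gt_eqF // cos_atan invr_gt0 sqrtr_gt0;
    have := sqr_ge0 (- b / a); lra.
  have -> : sin (atan (- b / a)) = (- b / a) * cos (atan (- b / a)).
    by rewrite -{2}(atanK (- b / a)) /tan divfK.
  by field.
have [h|h] := leP 0 (cos t * a - sin t * b); first by exists t.
exists (t + pi); rewrite cosDpi sinDpi; split; lra.
Qed.

(** Givens elimination: the columns are made standard from left to right, and each rotation is
    undone by the opposite one. A rotation can make a pivot nonnegative, hence equal to 1, in every
    column but the last; there the determinant decides the sign. *)
Lemma SO_plane_rot_ind N (P : 'M[R]_N -> Prop) :
  P 1%:M ->
  (forall p q t g, p != q -> SO g -> P g -> P (plane_rot p q t *m g)) ->
  forall g, SO g -> P g.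
Proof.
case: N P => [|n] P P1 PM.
  by move=> g _; have -> : g = 1%:M by apply/matrixP => -[].
pose std k (g : 'M[R]_n.+1) := forall i j : 'I_n.+1, (j < k)%N -> g i j = (i == j)%:R.
(* Standard columns force standard rows: g i j is the scalar product of column j with the standard
   column i. *)
have stdr k (g : 'M[R]_n.+1) : SO g -> std k g -> forall i j : 'I_n.+1,
    (i < k)%N -> i != j -> g i j = 0.
  move=> [g1 _] sg i j ik ij; have := congr1 (fun A : 'M[R]_n.+1 => A i j) g1.
  rewrite !mxE (negbTE ij) (bigD1 i) //= mxE sg // eqxx mul1r big1 ?addr0 //.
  by move=> l li; rewrite mxE sg // (negbTE li) mul0r.
have back p q t g : p != q -> SO g -> P (plane_rot p q t *m g) -> P g.
  move=> pq gS h; have := PM p q (- t) _ pq (SO_mul (plane_rot_SO t pq) gS) h.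
  by rewrite mulmxA plane_rotN_mul // mul1mx.
suff claimA r k : (k + r = n)%N -> forall g, SO g -> std k g -> P g.
  by move=> g gS; apply: (claimA n 0).
elim: r k => [|r IH] k.
  rewrite addn0 => -> g gS sg.
  have gd (i j : 'I_n.+1) : i != j -> g i j = 0.
    move=> ij; have [jn|jn] := ltnP j n; first by rewrite sg // (negbTE ij).
    apply: (stdr n) => //; rewrite ltn_neqAle -ltnS ltn_ord andbT.
    apply: contra ij => /eqP ei; apply/eqP/val_inj => /=.
    by apply/eqP; rewrite eqn_leq ei jn -ltnS ltn_ord.
  have gn : g ord_max ord_max = 1.
    have [_ <-] := gS; rewrite det_trig.
      rewrite big_ord_recr /= big1 ?mul1r // => i _.
      by rewrite sg ?eqxx //= ltn_ord.
    by apply/is_trig_mxP => i j ij; apply: gd; rewrite neq_ltn ij.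
  suff -> : g = 1%:M by [].
  apply/matrixP => i j; rewrite mxE; have [<-|ij] := eqVneq i j; last exact: gd.
  have [ik|ik] := ltnP i n; first by rewrite sg // eqxx.
  suff -> : i = ord_max by [].
  by apply/val_inj/eqP; rewrite /= eqn_leq ik -ltnS ltn_ord.
move=> kr; have kn : (k < n)%N by rewrite -kr -addSnnS ltnS leq_addr.
have IHk : forall g, SO g -> std k.+1 g -> P g by apply: IH; rewrite addSnnS.
have kn1 : (k < n.+1)%N by rewrite ltnW.
pose K := Ordinal kn1.
(* Here m is the next row to be cleared in column k. The sign of the pivot is known only once a
   rotation has been applied, whence the exception m = k + 1; since k < n, at least one rotation
   takes place. *)
suff claimB s m : (m + s = n.+1)%N -> (k < m)%N -> forall g, SO g -> std k g ->
    (forall i : 'I_n.+1, (k < i < m)%N -> g i K = 0) ->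
    (m == k.+1) || (0 <= g K K) -> P g.
  move=> g gS sg; apply: (claimB (n - k)%N k.+1) => //.
  - by rewrite addSn subnKC // ltnW.
  - by move=> i /andP[ki]; rewrite ltnS leqNgt ki.
  - by rewrite eqxx.
elim: s m => [|s IHs] m.
  rewrite addn0 => -> _ g gS sg gz; rewrite eqSS gtn_eqF //= => g0.
  apply: IHk => // i j; rewrite ltnS leq_eqVlt => /orP[/eqP jk|]; last exact: sg.
  have -> : j = K by apply: val_inj.
  have zi l : l != K -> g l K = 0.
    move=> lK; case: (ltngtP l k) => lk.
    - exact: (stdr k).
    - by apply: gz; rewrite lk ltn_ord.
    - by move: lK; rewrite (_ : l = K) ?eqxx //; apply: val_inj.
  have [->|iK] := eqVneq i K; last exact: zi.
  have [g1 _] := gS; have := congr1 (fun A : 'M[R]_n.+1 => A K K) g1.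
  rewrite !mxE eqxx (bigD1 K) //= mxE big1 => [|l lK]; last by rewrite (zi l) ?mulr0.
  rewrite addr0 -expr2 => /eqP; rewrite -[X in _ == X](expr1n _ 2) eqrXn2 //.
  by move=> /eqP.
rewrite addnS => [[ms]] km g gS sg gz _.
have mn : (m < n.+1)%N by rewrite -ms ltnS leq_addr.
pose M := Ordinal mn.
have KM : K != M by rewrite -val_eqE /= neq_ltn km.
have [t [t1 t2]] := rotate_to_axis (g K K) (g M K).
apply: (back K M t) => //; apply: (IHs m.+1).
- by rewrite addSn ms.
- by rewrite ltnS ltnW.
- exact: SO_mul (plane_rot_SO t KM) gS.
- move=> i j jk; rewrite plane_rot_mull // !sg //.
  have Kj : (K == j) = false by rewrite -val_eqE /= gtn_eqF.
  have Mj : (M == j) = false by rewrite -val_eqE /= gtn_eqF // (ltn_trans jk).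
  rewrite Kj Mj !mulr0 subr0 addr0.
  case: (eqVneq i K) => [->|_]; first by rewrite Kj.
  by case: (eqVneq i M) => [->|//]; rewrite Mj.
- move=> i /andP[ki im]; rewrite plane_rot_mull //.
  have -> : (i == K) = false by rewrite -val_eqE /= gtn_eqF.
  case: (eqVneq i M) => [_|iM] //; apply: gz; rewrite ki /= ltn_neqAle.
  by rewrite -ltnS im andbT; exact: iM.
- by rewrite plane_rot_mull // eqxx t2 orbT.
Qed.

End Generation.

(** * The differential of a representation *)

Section Representation.
Variables (R : realType) (N d : nat) (rho : 'M[R]_N -> 'M[R[i]]_d).
Hypothesis hrho : is_representation rho.
Implicit Types (p q r k l : 'I_N).

Let rho1 : rho 1%:M = 1%:M. Proof. by case: hrho. Qed.
Let rhoM g h : SO g -> SO h -> rho (g *m h) = rho g *m rho h.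
Proof. by case: hrho => _ h1 _; exact: h1. Qed.

Local Notation T p q t := (rho (plane_rot p q t)).

Lemma rep_plane_rot_ccont p q a b : p != q -> ccont (fun t => T p q t a b).
Proof.
move=> pq; have [_ _ /(_ a b) [/subspace_continuousP cr /subspace_continuousP ci]] := hrho.
have Rw x : (plane_rot p q t @[t --> x] --> within (@SO R N) (nbhs (plane_rot p q x)))%classic.
  move=> A /= h.
  have : \forall t \near x, SO (plane_rot p q t) -> A (plane_rot p q t).
    exact: plane_rot_continuous h.
  by move=> h'; apply: filterS h' => t; apply; exact: plane_rot_SO.
split=> x.
  have h := cr _ (plane_rot_SO x pq).
  exact: (cvg_comp (plane_rot p q) (fun g => complex.Re (rho g a b)) (Rw x) h).
have h := ci _ (plane_rot_SO x pq).
exact: (cvg_comp (plane_rot p q) (fun g => complex.Im (rho g a b)) (Rw x) h).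
Qed.

Lemma rep_plane_rotD p q s t : p != q -> T p q (s + t) = T p q s *m T p q t.
Proof. by move=> pq; rewrite plane_rotD // rhoM //; exact: plane_rot_SO. Qed.

Lemma rep_plane_rot0 p q : p != q -> T p q 0 = 1%:M.
Proof. by move=> pq; rewrite plane_rot0. Qed.

Lemma rep_plane_rot_mulN p q t : p != q -> T p q t *m T p q (- t) = 1%:M.
Proof. by move=> pq; rewrite -rep_plane_rotD // subrr rep_plane_rot0. Qed.

Lemma rep_plane_rots_diag (I : Type) (P Q : I -> 'I_N) :
  (forall i, P i != Q i) ->
  (forall i j s t, T (P i) (Q i) s *m T (P j) (Q j) t =
                   T (P j) (Q j) t *m T (P i) (Q i) s) ->
  exists2 U : 'M[R[i]]_d, U \in unitmx & exists k : I -> 'I_d -> int,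
    forall i t, T (P i) (Q i) t =
      invmx U *m diag_mx (\row_j expi ((k i j)%:~R * t)) *m U.
Proof.
move=> PQ cPQ; apply: circle_rep_diag => //.
- by move=> i s t; rewrite rep_plane_rotD.
- by move=> i; rewrite rep_plane_rot0.
- by move=> i; rewrite plane_rot_2pi.
- by move=> i a b; exact: rep_plane_rot_ccont.
Qed.

(** The value 0 for p = q makes the family antisymmetric in all its indices, so that later sums may
    run over all pairs. *)
Definition rep_gen p q : 'M[R[i]]_d :=
  if p == q then 0 else xget 0 [set L | mxderive (fun t => T p q t) L]%classic.

Lemma rep_gen_refl p : rep_gen p p = 0.
Proof. by rewrite /rep_gen eqxx. Qed.

(** Existence of the derivative comes from diagonalization: in a suitable basis the curve consists
    of exponentials. *)
Lemma rep_gen_derive p q : p != q -> mxderive (fun t => T p q t) (rep_gen p q).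
Proof.
move=> pq; have [|U Uu [k kP]] := @rep_plane_rots_diag unit (fun=> p) (fun=> q) (fun=> pq).
  by move=> _ _ s t; rewrite -!rep_plane_rotD // addrC.
rewrite /rep_gen (negbTE pq); case: xgetP => [L _ //|].
move=> /(_ (invmx U *m diag_mx (\row_j ((k tt j)%:~R%:C * 'i%C)) *m U)) []; rewrite /=.
have -> : (fun t => T p q t) =
    (fun t => invmx U *m diag_mx (\row_j expi ((k tt j)%:~R * t)) *m U).
  by apply/funext => t; exact: (kP tt).
exact: mxderive_diag_expi.
Qed.

Lemma rep_gen_unique p q L : p != q -> mxderive (fun t => T p q t) L -> rep_gen p q = L.
Proof. by move=> pq; apply: mxderive_unique; exact: rep_gen_derive. Qed.

Lemma rep_genC p q : rep_gen q p = - rep_gen p q.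
Proof.
have [->|pq] := eqVneq p q; first by rewrite rep_gen_refl oppr0.
apply: rep_gen_unique; first by rewrite eq_sym.
have -> : (fun t => T q p t) = (fun t => T p q (- t)).
  by apply/funext => t; rewrite plane_rotC.
have dN : is_derive (0 : R) 1 (fun t : R => - t) (-1).
  have -> : (fun t : R => - t) = - (@id R) by apply/funext.
  exact: is_deriveN.
have := mxderive_comp (rep_gen_derive pq) (oppr0 _) dN.
by rewrite rmorphN1 scaleN1r.
Qed.

Lemma rep_gen_comm p q (X : 'M[R[i]]_d) : p != q ->
  (forall t, X *m T p q t = T p q t *m X) -> X *m rep_gen p q = rep_gen p q *m X.
Proof.
move=> pq cX; apply: (mxderive_unique (mxderiveMl X (rep_gen_derive pq))).
have -> : (fun t => X *m T p q t) = (fun t => T p q t *m X) by apply/funext.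
exact: mxderiveMr (rep_gen_derive pq).
Qed.

(* Conjugating the rotation in the plane (q, r) by one in (p, q) gives a curve
   through 1 whose coordinates of the second kind are conj_x, conj_y, conj_z;
   their derivatives at 0 are cos t, - sin t, 0. *)
Lemma rep_gen_conj p q r t : p != q -> q != r -> p != r ->
  T p q t *m rep_gen q r = ((cos t)%:C *: rep_gen q r - (sin t)%:C *: rep_gen p r) *m T p q t.
Proof.
move=> pq qr pr.
suff h : T p q t *m rep_gen q r *m T p q (- t) =
         (cos t)%:C *: rep_gen q r - (sin t)%:C *: rep_gen p r.
  have := rep_plane_rot_mulN (- t) pq; rewrite opprK => e.
  by rewrite -h -mulmxA e mulmx1.
apply: (@mxderive_unique _ _ _ (fun s => T p q t *m T q r s *m T p q (- t))).
  by apply/mxderiveMr/mxderiveMl; exact: rep_gen_derive.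
have nr : \forall s \near (0 : R), T p q t *m T q r s *m T p q (- t) =
    T q r (conj_x t s) *m T p r (conj_y t s) *m T p q (conj_z t s).
  have : \forall s \near (0 : R), 0 < cos s.
    have c0 : 0 < cos (0 : R) by rewrite cos0.
    exact: (cvgr_gt _ (@continuous_cos R 0) _ c0).
  apply: filterS => s c0.
  by rewrite -!rhoM ?conj_plane_rot //; do ?[apply: SO_mul | apply: plane_rot_SO].
have dx := mxderive_comp (rep_gen_derive qr) (conj_x0 t) (is_derive_conj_x t).
have dy := mxderive_comp (rep_gen_derive pr) (conj_y0 t) (is_derive_conj_y t).
have dz := mxderive_comp (rep_gen_derive pq) (conj_z0 t) (is_derive_conj_z t).
have := mxderiveM (mxderiveM dx dy) dz.
rewrite conj_x0 conj_y0 conj_z0 !rep_plane_rot0 // !mulmx1 mul1mx.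
rewrite rmorph0 scale0r add0r addrC rmorphN scaleNr mul1mx addrC.
by apply: near_eq_mxderive; apply: filterS nr => s ->.
Qed.

End Representation.

(** * The adjoint action and the Casimir element *)

Section AdjointAction.
Variables (R : realType) (N d : nat) (rho : 'M[R]_N -> 'M[R[i]]_d).
Hypothesis hrho : is_representation rho.
Implicit Types (p q r k l : 'I_N) (u v c e : 'cV[R[i]]_N).

Let rho1 : rho 1%:M = 1%:M. Proof. by case: hrho. Qed.
Let rhoM g h : SO g -> SO h -> rho (g *m h) = rho g *m rho h.
Proof. by case: hrho => _ h1 _; exact: h1. Qed.

Local Notation T p q t := (rho (plane_rot p q t)).
Local Notation M p q := (rep_gen rho p q).
Local Notation toC := (map_mx (real_complex R)).

(* The differential of rho at the antisymmetric matrix v u^T - u v^T. *)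
Definition rep_lie u v : 'M[R[i]]_d :=
  \sum_(x : 'I_N * 'I_N) (u x.1 0 * v x.2 0) *: rep_gen rho x.1 x.2.

Lemma rep_lieDl u u' v : rep_lie (u + u') v = rep_lie u v + rep_lie u' v.
Proof.
rewrite /rep_lie -big_split; apply: eq_bigr => x _ /=.
by rewrite mxE mulrDl scalerDl.
Qed.

Lemma rep_lieZl a u v : rep_lie (a *: u) v = a *: rep_lie u v.
Proof.
rewrite /rep_lie scaler_sumr; apply: eq_bigr => x _ /=.
by rewrite mxE -mulrA scalerA.
Qed.

Lemma rep_lieC u v : rep_lie v u = - rep_lie u v.
Proof.
have swI : injective (fun x : 'I_N * 'I_N => (x.2, x.1)).
  by move=> [a b] [a' b'] /= [-> ->].
rewrite /rep_lie -sumrN (reindex_inj swI) /=.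
by apply: eq_bigr => x _ /=; rewrite (rep_genC hrho) scalerN mulrC.
Qed.

Lemma rep_lieDr u v v' : rep_lie u (v + v') = rep_lie u v + rep_lie u v'.
Proof. by rewrite rep_lieC rep_lieDl opprD -!rep_lieC. Qed.

Lemma rep_lieZr a u v : rep_lie u (a *: v) = a *: rep_lie u v.
Proof. by rewrite rep_lieC rep_lieZl -scalerN -rep_lieC. Qed.

Lemma rep_lie0l v : rep_lie 0 v = 0.
Proof. by rewrite -(scale0r 0) rep_lieZl scale0r. Qed.

Lemma rep_lie0r v : rep_lie v 0 = 0.
Proof. by rewrite rep_lieC rep_lie0l oppr0. Qed.

Lemma rep_lie_suml (I : Type) (s : seq I) (F : I -> 'cV[R[i]]_N) v :
  rep_lie (\sum_(i <- s) F i) v = \sum_(i <- s) rep_lie (F i) v.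
Proof. exact: (big_morph (rep_lie^~ v) (fun a b => rep_lieDl a b v) (rep_lie0l v)). Qed.

Lemma rep_lie_sumr (I : Type) (s : seq I) (F : I -> 'cV[R[i]]_N) v :
  rep_lie v (\sum_(i <- s) F i) = \sum_(i <- s) rep_lie v (F i).
Proof. exact: (big_morph (rep_lie v) (rep_lieDr v) (rep_lie0r v)). Qed.

Lemma rep_lie_delta k l : rep_lie (delta_mx k 0) (delta_mx l 0) = rep_gen rho k l.
Proof.
rewrite /rep_lie (bigD1 (k, l)) //= !mxE !eqxx mulr1 scale1r big1 ?addr0 //.
move=> [a b] /=; rewrite xpair_eqE !mxE !eqxx !andbT => /negbTE ab.
by rewrite -natrM mulnb ab scale0r.
Qed.

Lemma cV_delta u : u = \sum_k u k 0 *: delta_mx k 0.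
Proof.
apply/colP => i; rewrite summxE (bigD1 i) //= !mxE !eqxx mulr1 big1 ?addr0 //.
by move=> j /negbTE ji; rewrite !mxE eq_sym ji mulr0.
Qed.

Lemma rep_lie_mul (A : 'M[R[i]]_N) u v :
  rep_lie (A *m u) (A *m v) =
  \sum_(x : 'I_N * 'I_N) (u x.1 0 * v x.2 0) *: rep_lie (A *m delta_mx x.1 0) (A *m delta_mx x.2 0).
Proof.
rewrite {1}[u]cV_delta {1}[v]cV_delta !mulmx_sumr rep_lie_suml.
rewrite -(pair_bigA _ (fun a b => (u a 0 * v b 0) *: rep_lie (A *m delta_mx a 0) (A *m delta_mx b 0))) /=.
apply: eq_bigr => a _; rewrite rep_lie_sumr; apply: eq_bigr => b _.
by rewrite -!scalemxAr rep_lieZl rep_lieZr scalerA.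
Qed.

(** Equivariance of the differential, rho(g) drho(X) = drho(g X g^-1) rho(g), for the X coded by [u]
    and [v]: as g is orthogonal, conjugating X amounts to moving both vectors by g. The vectors are
    complex so that root vectors are covered. *)
Definition Ad_compatible (g : 'M[R]_N) :=
  forall u v, rho g *m rep_lie u v = rep_lie (toC g *m u) (toC g *m v) *m rho g.

Lemma Ad_compatible_basis g :
  (forall k l, rho g *m rep_gen rho k l =
     rep_lie (toC g *m delta_mx k 0) (toC g *m delta_mx l 0) *m rho g) ->
  Ad_compatible g.
Proof.
move=> h u v; rewrite rep_lie_mul mulmx_suml {1}/rep_lie mulmx_sumr.
by apply: eq_bigr => x _; rewrite -scalemxAr -scalemxAl h.
Qed.

Lemma toC_plane_rot_delta p q t k : p != q ->
  toC (plane_rot p q t) *m delta_mx k 0 =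
    if k == p then (cos t)%:C *: delta_mx p 0 + (sin t)%:C *: delta_mx q 0
    else if k == q then (cos t)%:C *: delta_mx q 0 - (sin t)%:C *: delta_mx p 0
    else delta_mx k 0 :> 'cV[R[i]]_N.
Proof.
move=> pq; rewrite -colE; apply/colP => i; rewrite !mxE.
have [->|kp] := eqVneq k p.
  rewrite (negbTE pq) !mxE ?andbT ?andbF ?orbF.
  have [->|ip] := eqVneq i p; first by rewrite (negbTE pq) /= mulr1 mulr0 addr0.
  by case: (eqVneq i q) => _ /=; rewrite ?mulr1 ?mulr0 ?addr0 ?add0r ?rmorph0.
rewrite andbF orFb.
have [->|kq] := eqVneq k q.
  rewrite !mxE ?andbT ?andbF ?orbF.
  have [->|iq] := eqVneq i q; first by rewrite eq_sym (negbTE pq) /= mulr1 mulr0 subr0.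
  by case: (eqVneq i p) => _ /=; rewrite ?mulr1 ?mulr0 ?subr0 ?sub0r ?rmorph0 ?rmorphN.
by rewrite !andbF !mxE andbT rmorph_nat.
Qed.

Lemma Ad_plane_rot p q t : p != q -> Ad_compatible (plane_rot p q t).
Proof.
move=> pq; apply: Ad_compatible_basis.
pose G k l := rep_lie (toC (plane_rot p q t) *m delta_mx k 0)
                      (toC (plane_rot p q t) *m delta_mx l 0).
have lieE := (rep_lieDl, rep_lieDr, rep_lieZl, rep_lieZr, rep_lie_delta).
have lieN u v : rep_lie (- u) v = - rep_lie u v.
  by rewrite -scaleN1r rep_lieZl scaleN1r.
have lieNr u v : rep_lie u (- v) = - rep_lie u v.
  by rewrite -scaleN1r rep_lieZr scaleN1r.
have Gswap k l : G k l = - G l k by rewrite /G rep_lieC.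
have com x y : x != p -> x != q -> y != p -> y != q -> x != y ->
    T p q t *m rep_gen rho x y = rep_gen rho x y *m T p q t.
  move=> xp xq yp yq xy; apply: (rep_gen_comm hrho xy) => s.
  have St := plane_rot_SO t pq; have Ss := plane_rot_SO s xy.
  rewrite -(rhoM St Ss) -(rhoM Ss St) plane_rot_comm // eq_sym //.
have compq : T p q t *m rep_gen rho p q = rep_gen rho p q *m T p q t.
  apply: (rep_gen_comm hrho pq) => s.
  by rewrite -(rep_plane_rotD hrho s t pq) -(rep_plane_rotD hrho t s pq) addrC.
(* Exchanging p and q reverses the angle, so this is [rep_gen_conj] at -t. *)
have conjp l : l != p -> l != q -> T p q t *m rep_gen rho p l =
    ((cos t)%:C *: rep_gen rho p l + (sin t)%:C *: rep_gen rho q l) *m T p q t.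
  move=> lp lq; rewrite -[t]opprK -(plane_rotC (- t) pq).
  rewrite (rep_gen_conj hrho) // 1?eq_sym // 1?eq_sym //.
  by rewrite opprK cosN sinN rmorphN scaleNr opprK.
have conjq l : l != p -> l != q -> T p q t *m rep_gen rho q l =
    ((cos t)%:C *: rep_gen rho q l - (sin t)%:C *: rep_gen rho p l) *m T p q t.
  by move=> lp lq; rewrite (rep_gen_conj hrho) // 1?eq_sym //.
have Gp l : T p q t *m rep_gen rho p l = G p l *m T p q t.
  rewrite /G !toC_plane_rot_delta // eqxx.
  have [->|lp] := eqVneq l p.
    rewrite rep_gen_refl mulmx0 !lieE !(rep_gen_refl) (rep_genC hrho p q).
    rewrite ?scalerDr ?(scaler0, scalerN, oppr0, add0r, addr0) !scalerA mulrC.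
    by rewrite ?(subrr, addNr) mul0mx.
  have [->|lq] := eqVneq l q.
    rewrite compq !(lieE, lieNr) !(rep_gen_refl) (rep_genC hrho p q).
    rewrite ?scalerDr ?(scaler0, scalerN, oppr0, add0r, addr0, opprK) !scalerA -scalerDl.
    by rewrite -!rmorphM -rmorphD -!expr2 cos2Dsin2 rmorph1 scale1r.
  by rewrite conjp // !lieE.
have Gq l : T p q t *m rep_gen rho q l = G q l *m T p q t.
  have [->|lp] := eqVneq l p.
    by rewrite Gswap (rep_genC hrho p q) mulmxN Gp mulNmx.
  rewrite /G !toC_plane_rot_delta // eqxx eq_sym (negbTE pq) (negbTE lp).
  have [->|lq] := eqVneq l q.
    rewrite rep_gen_refl mulmx0 !(lieE, lieN, lieNr) !(rep_gen_refl) (rep_genC hrho p q).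
    rewrite ?scalerDr ?(scaler0, scalerN, oppr0, add0r, addr0, opprK) !scalerA mulrC.
    by rewrite ?(subrr, addNr) mul0mx.
  by rewrite conjq // !(lieE, lieN).
move=> k l; rewrite -/(G k l).
have [->|kp] := eqVneq k p; first exact: Gp.
have [->|kq] := eqVneq k q; first exact: Gq.
have [->|lp] := eqVneq l p.
  by rewrite Gswap (rep_genC hrho p k) mulmxN Gp mulNmx.
have [->|lq] := eqVneq l q.
  by rewrite Gswap (rep_genC hrho q k) mulmxN Gq mulNmx.
rewrite /G !toC_plane_rot_delta // (negbTE kp) (negbTE kq) (negbTE lp) (negbTE lq).
rewrite rep_lie_delta; have [->|kl] := eqVneq k l; last exact: com.
by rewrite rep_gen_refl mulmx0 mul0mx.
Qed.

Lemma Ad_SO g : SO g -> Ad_compatible g.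
Proof.
suff : SO g -> SO g /\ Ad_compatible g by move=> h /h[].
move=> gS; apply: (SO_plane_rot_ind (P := fun g => SO g /\ Ad_compatible g) _ _ gS).
  split; first exact: SO1.
  by move=> u v; rewrite rho1 mul1mx mulmx1 map_mx1 !mul1mx.
move=> {gS} p q t {}g pq gS [_ Ag]; have RS := plane_rot_SO t pq.
split; first exact: SO_mul.
move=> u v; rewrite rhoM // -mulmxA Ag mulmxA Ad_plane_rot //.
by rewrite map_mxM !mulmxA.
Qed.

End AdjointAction.

Section Casimir.
Variables (R : realType) (N d : nat) (rho : 'M[R]_N -> 'M[R[i]]_d).
Hypothesis hrho : is_representation rho.
Implicit Types (p q r k l : 'I_N) (u v c e : 'cV[R[i]]_N).

Local Notation toC := (map_mx (real_complex R)).
Local Notation L := (rep_lie rho).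

(** Bilinear and not Hermitian: it is the complexification of the form preserved by SO(N), for which
    the weight vectors of nonzero weight are isotropic. *)
Definition dotC u v : R[i] := \sum_k u k 0 * v k 0.

Lemma toC_plane_rot_derive p q : p != q ->
  mxderive (fun t => toC (plane_rot p q t)) (delta_mx q p - delta_mx p q : 'M[R[i]]_N).
Proof.
move=> pq i j; rewrite !mxE.
have -> : (fun t => toC (plane_rot p q t) i j) = (fun t =>
    (if (i == p) && (j == p) || (i == q) && (j == q) then cos t
    else if (i == p) && (j == q) then - sin t
    else if (i == q) && (j == p) then sin t
    else (i == j)%:R)%:C).
  by apply/funext => t; rewrite !mxE.
have dc : is_derive (0 : R) 1 (@cos R) 0.
  by apply: (is_derive_eq (is_derive_cos _)); rewrite sin0 oppr0.
have ds : is_derive (0 : R) 1 (@sin R) 1.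
  by apply: (is_derive_eq (is_derive_sin _)); rewrite cos0.
have dns : is_derive (0 : R) 1 (fun t : R => - sin t) (-1).
  have -> : (fun t : R => - sin t) = - (@sin R) by apply/funext.
  exact: is_deriveN.
have h : is_derive (0 : R) 1 (fun t : R =>
    if (i == p) && (j == p) || (i == q) && (j == q) then cos t
    else if (i == p) && (j == q) then - sin t
    else if (i == q) && (j == p) then sin t
    else (i == j)%:R) (((i == q) && (j == p))%:R - ((i == p) && (j == q))%:R).
  case: (eqVneq i p) => [->|ip]; case: (eqVneq j p) => [->|jp];
    rewrite ?eqxx ?(negbTE pq) ?andbF ?andFb /= ?orbF ?subr0 ?andbT //.
  - by case: (j == q) => /=; [rewrite sub0r | rewrite subr0; exact: is_derive_cst].
  - by case: (i == q) => //=; exact: is_derive_cst.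
  - case: (_ && _) => //; exact: is_derive_cst.
have := cderive_real h; rewrite rmorphB !rmorph_nat //.
Qed.

(** Obtained by differentiating [Ad_plane_rot] at t = 0 and comparing the derivatives of its two
    sides. *)
Lemma rep_gen_bracket p q c e : p != q ->
  rep_gen rho p q *m L c e - L c e *m rep_gen rho p q =
  L ((delta_mx q p - delta_mx p q) *m c) e + L c ((delta_mx q p - delta_mx p q) *m e).
Proof.
move=> pq; set G := delta_mx q p - delta_mx p q.
have dT := rep_gen_derive hrho pq.
have dG := toC_plane_rot_derive pq; rewrite -/G in dG.
have T0 : rho (plane_rot p q 0) = 1%:M by rewrite (rep_plane_rot0 hrho).
have G0 : toC (plane_rot p q 0) = 1%:M by rewrite plane_rot0 // map_mx1.
have dL : mxderive (fun t => L (toC (plane_rot p q t) *m c) (toC (plane_rot p q t) *m e))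
    (L (G *m c) e + L c (G *m e)).
  have -> : L (G *m c) e + L c (G *m e) = \sum_(x : 'I_N * 'I_N)
     (c x.1 0 * (G *m e) x.2 0 + (G *m c) x.1 0 * e x.2 0) *: rep_gen rho x.1 x.2.
    rewrite addrC /rep_lie -big_split; apply: eq_bigr => x _ /=.
    by rewrite scalerDl.
  apply: mxderive_sum => x; apply: mxderiveZ.
  have := cderiveM (mxderiveMr c dG x.1 0) (mxderiveMr e dG x.2 0).
  by rewrite G0 !mul1mx.
have := mxderiveM dL dT; rewrite T0 G0 !mul1mx mulmx1 => h1.
have := mxderiveMr (L c e) dT.
have -> : (fun t => rho (plane_rot p q t) *m L c e) =
  (fun t => L (toC (plane_rot p q t) *m c) (toC (plane_rot p q t) *m e) *m rho (plane_rot p q t)).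
  by apply/funext => t; rewrite (Ad_plane_rot hrho).
by move=> /mxderive_unique /(_ h1) ->; rewrite addrC addKr.
Qed.

Lemma rep_lie_bracket u v c e :
  L u v *m L c e - L c e *m L u v =
  L (dotC u c *: v - dotC v c *: u) e + L c (dotC u e *: v - dotC v e *: u).
Proof.
(* The map x |-> (u.x) v - (v.x) u is the matrix v u^T - u v^T, expanded here over elementary
   antisymmetric matrices. Bilinearity then reduces the bracket to the case of a single
   generator. *)
have w x : dotC u x *: v - dotC v x *: u = \sum_(y : 'I_N * 'I_N)
    (u y.1 0 * v y.2 0) *: ((delta_mx y.2 y.1 - delta_mx y.1 y.2) *m x).
  apply/colP => i; rewrite summxE.
  rewrite -(pair_bigA _ (fun a b =>
    ((u a 0 * v b 0) *: ((delta_mx b a - delta_mx a b) *m x)) i 0)) /=.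
  have E a b : ((u a 0 * v b 0) *: ((delta_mx b a - delta_mx a b) *m x)) i 0 =
      (u a 0 * x a 0) * (v b 0 * (i == b)%:R) - (u a 0 * (i == a)%:R) * (v b 0 * x b 0).
    have D s t : (delta_mx s t *m x) i 0 = (i == s)%:R * x t 0.
      rewrite mxE (bigD1 t) //= mxE eqxx andbT big1 ?addr0 // => y /negbTE yt.
      by rewrite mxE yt andbF mul0r.
    by rewrite mulmxBl [LHS]mxE [X in _ * X]mxE [X in _ * (_ + X)]mxE !D; ring.
  have sumd (y : 'cV[R[i]]_N) : \sum_b (y b 0 * (i == b)%:R) = y i 0.
    rewrite (bigD1 i) //= eqxx mulr1 big1 ?addr0 // => b /negbTE bi.
    by rewrite eq_sym bi mulr0.
  under eq_bigr do under eq_bigr do rewrite E.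
  under eq_bigr do rewrite sumrB -!mulr_sumr sumd.
  rewrite sumrB -!mulr_suml sumd !mxE /dotC; ring.
rewrite !w rep_lie_suml rep_lie_sumr // -big_split /=.
rewrite {1 4}/rep_lie mulmx_suml mulmx_sumr -sumrB; apply: eq_bigr => -[a b] _ /=.
rewrite -scalemxAl -scalemxAr -scalerBr rep_lieZl rep_lieZr // -scalerDr.
congr (_ *: _); have [->|ab] := eqVneq a b.
  by rewrite rep_gen_refl mul0mx mulmx0 !subrr !mul0mx rep_lie0l (rep_lie0r hrho) addr0.
exact: rep_gen_bracket.
Qed.

(** The sum runs over ordered pairs, so each plane is counted twice; this is the origin of the
    factor 2 removed in [casimir_character]. *)
Definition casimir : 'M[R[i]]_d :=
  \sum_(x : 'I_N * 'I_N) rep_gen rho x.1 x.2 *m rep_gen rho x.1 x.2.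

(* The Casimir element is independent of the choice of dual frames. *)
Lemma casimir_frame (J : finType) (u v : J -> 'cV[R[i]]_N) :
  (forall a b : 'I_N, \sum_j u j a 0 * v j b 0 = (a == b)%:R) ->
  \sum_(j : J * J) L (u j.1) (u j.2) *m L (v j.1) (v j.2) = casimir.
Proof.
move=> uv; rewrite /casimir.
transitivity (\sum_(j : J * J) \sum_(x : 'I_N * 'I_N) \sum_(y : 'I_N * 'I_N)
    ((u j.1 x.1 0 * v j.1 y.1 0) * (u j.2 x.2 0 * v j.2 y.2 0)) *:
      (rep_gen rho x.1 x.2 *m rep_gen rho y.1 y.2)).
  apply: eq_bigr => j _; rewrite {1}/rep_lie mulmx_suml; apply: eq_bigr => x _.
  rewrite {1}/rep_lie mulmx_sumr; apply: eq_bigr => y _.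
  by rewrite -scalemxAl -scalemxAr scalerA; congr (_ *: _); ring.
rewrite exchange_big /=; apply: eq_bigr => x _.
rewrite exchange_big /= (bigD1 x) //= [X in _ + X]big1 ?addr0.
  rewrite -scaler_suml.
  rewrite -(pair_bigA _ (fun a b => (u a x.1 0 * v a x.1 0) * (u b x.2 0 * v b x.2 0))) /=.
  under eq_bigr do rewrite -mulr_sumr uv eqxx mulr1.
  by rewrite uv eqxx scale1r.
move=> y yx; rewrite -scaler_suml.
rewrite -(pair_bigA _ (fun a b => (u a x.1 0 * v a y.1 0) * (u b x.2 0 * v b y.2 0))) /=.
under eq_bigr do rewrite -mulr_sumr uv.
rewrite -mulr_suml uv -natrM mulnb -xpair_eqE -!surjective_pairing eq_sym (negbTE yx).
by rewrite scale0r.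
Qed.

Lemma casimir_comm g : SO g -> rho g *m casimir = casimir *m rho g.
Proof.
move=> gS; have [gg _] := SO_tr gS; rewrite trmxK in gg.
(* The columns of the orthogonal matrix g form another self-dual frame; moving rho(g) across turns
   the standard expression of the Casimir element into the one in this frame. *)
rewrite -[in RHS](@casimir_frame _ (fun k => toC g *m delta_mx k 0)
    (fun k => toC g *m delta_mx k 0)); last first.
  move=> a c; have := congr1 (fun A : 'M[R]_N => (A a c)%:C) gg.
  rewrite mxE [in X in _ = X]mxE rmorph_nat => <-.
  rewrite rmorph_sum; apply: eq_bigr => k _.
  by rewrite -!colE !mxE rmorphM.
rewrite mulmx_suml mulmx_sumr; apply: eq_bigr => x _.
have E : rho g *m rep_gen rho x.1 x.2 =
    L (toC g *m delta_mx x.1 0) (toC g *m delta_mx x.2 0) *m rho g.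
  by rewrite -(rep_lie_delta rho) (Ad_SO hrho gS).
by rewrite mulmxA E -mulmxA E mulmxA.
Qed.

(** Schur's lemma for the transposed matrices, since invariant subspaces are coded as row spaces: an
    eigenspace of the transposed Casimir element is stable and nonzero, hence everything. *)
Lemma casimir_scalar : is_irreducible rho -> exists z, casimir = z%:M.
Proof.
move=> [d0 irr].
have [c ec] : exists z, eigenvalue casimir^T z.
  have sp : size (char_poly casimir^T) != 1 by rewrite size_char_poly eqSS -lt0n.
  have [c rc] := closed_rootP _ sp; exists c; by rewrite eigenvalue_root_char.
exists c; have [g gS||] := irr (eigenspace casimir^T c).
- apply: comm_mx_stable_eigenspace; rewrite /comm_mx -!trmx_mul.
  by rewrite casimir_comm.
- by move/eqP; rewrite mxrank_eq0; move: ec; rewrite /eigenvalue /= => /negbTE ->.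
- move=> rk; apply: trmx_inj; rewrite tr_scalar_mx.
  have : (1%:M <= eigenspace casimir^T c)%MS by rewrite sub1mx row_full_unit -row_free_unit /row_free rk.
  by move/eigenspaceP; rewrite mul1mx scalemx1.
Qed.

End Casimir.

(** * The character on the maximal torus *)

Section ConjDiag.
Variables (F : fieldType) (d : nat) (U : 'M[F]_d).
Hypothesis Uu : U \in unitmx.
Implicit Types x y : 'rV[F]_d.

Definition conj_diag x : 'M[F]_d := invmx U *m diag_mx x *m U.

Lemma conj_diagM x y : conj_diag x *m conj_diag y = conj_diag (\row_j (x 0 j * y 0 j)).
Proof. by rewrite /conj_diag !mulmxA mulmxK // -[_ *m _ *m diag_mx y]mulmxA mulmx_diag. Qed.

Lemma trace_conj_diag x : \tr (conj_diag x) = \sum_j x 0 j.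
Proof. by rewrite /conj_diag -mulmxA mxtrace_mulC mulmxK // mxtrace_diag. Qed.

Lemma conj_diag1 : conj_diag (const_mx 1) = 1%:M.
Proof. by rewrite /conj_diag diag_const_mx mulmx1 mulVmx. Qed.

Lemma conj_diag_eigen x j :
  conj_diag x *m (invmx U *m delta_mx j 0) = x 0 j *: (invmx U *m delta_mx j 0 : 'cV_d).
Proof.
rewrite /conj_diag !mulmxA mulmxK // -mulmxA scalemxAr; congr (_ *m _).
apply/colP => i; rewrite mul_diag_mx !mxE andbT.
by case: eqVneq => [->|_]; rewrite ?mulr0.
Qed.

End ConjDiag.

Section TorusWeights.
Variables (R : realType) (n d : nat) (rho : 'M[R]_((2 * n).+1) -> 'M[R[i]]_d).
Hypothesis hrho : is_representation rho.

Local Notation N := ((2 * n).+1).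

Definition ev_idx (k : 'I_n) : 'I_N := inord (2 * k).
Definition od_idx (k : 'I_n) : 'I_N := inord (2 * k).+1.

Lemma val_ev_idx (k : 'I_n) : ev_idx k = (2 * k)%N :> nat.
Proof. by rewrite inordK //; have := ltn_ord k; lia. Qed.

Lemma val_od_idx (k : 'I_n) : od_idx k = (2 * k).+1 :> nat.
Proof. by rewrite inordK //; have := ltn_ord k; lia. Qed.

Lemma ev_od_neq k l : ev_idx k != od_idx l.
Proof. by rewrite -val_eqE /= val_ev_idx val_od_idx; apply/eqP; lia. Qed.

Lemma ev_idx_eq k l : (ev_idx k == ev_idx l) = (k == l).
Proof. by rewrite -!val_eqE /= !val_ev_idx; apply/eqP/eqP; lia. Qed.

Lemma od_idx_eq k l : (od_idx k == od_idx l) = (k == l).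
Proof. by rewrite -!val_eqE /= !val_od_idx; apply/eqP/eqP; lia. Qed.

Lemma ev_last_neq k : ev_idx k != ord_max.
Proof. by rewrite -val_eqE /= val_ev_idx; apply/eqP; have := ltn_ord k; lia. Qed.

Lemma od_last_neq k : od_idx k != ord_max.
Proof. by rewrite -val_eqE /= val_od_idx; apply/eqP; have := ltn_ord k; lia. Qed.

Lemma big_idx_split (V : nmodType) (F : 'I_N -> V) :
  \sum_i F i = \sum_k (F (ev_idx k) + F (od_idx k)) + F ord_max.
Proof.
rewrite big_ord_recr /=; congr (_ + F _).
transitivity (\sum_(0 <= i < 2 * n) F (inord i)).
  rewrite big_mkord; apply: eq_bigr => i _; congr F; apply: val_inj => /=.
  by rewrite inordK //; have := ltn_ord i; lia.
have h (G : nat -> V) m : \sum_(0 <= i < 2 * m) G i =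
    \sum_(0 <= k < m) (G (2 * k)%N + G (2 * k).+1).
  elim: m => [|m IH]; first by rewrite muln0 !big_nil.
  by rewrite mulnS !addSn add0n !big_nat_recr //= IH addrA.
by rewrite h big_mkord.
Qed.

Let rho1 : rho 1%:M = 1%:M. Proof. by case: hrho. Qed.
Let rhoM g h : SO g -> SO h -> rho (g *m h) = rho g *m rho h.
Proof. by case: hrho => _ h1 _; exact: h1. Qed.

Local Notation Rk k t := (plane_rot (ev_idx k) (od_idx k) t).

Lemma plane_rots_comm k l s t :
  Rk k s *m Rk l t = Rk l t *m Rk k s :> 'M[R]_N.
Proof.
have [<-|kl] := eqVneq k l.
  by rewrite -!plane_rotD ?ev_od_neq // addrC.
by rewrite plane_rot_comm ?ev_od_neq ?ev_idx_eq ?od_idx_eq // eq_sym ev_od_neq.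
Qed.

(* [w j k] is the k-th coordinate of the j-th weight in the basis of weight
   vectors given by the columns of [invmx U]. *)
Definition weight_basis (U : 'M[R[i]]_d) (w : 'I_d -> 'I_n -> int) :=
  U \in unitmx /\ forall k t, rho (Rk k t) =
     invmx U *m diag_mx (\row_j expi ((w j k)%:~R * t)) *m U.

Lemma weight_basis_exists : exists U w, weight_basis U w.
Proof.
have [|k l s t|U Uu [w wP]] := @rep_plane_rots_diag _ _ _ _ hrho _ ev_idx od_idx.
- by move=> k; exact: ev_od_neq.
- have Sk := plane_rot_SO s (ev_od_neq k k); have Sl := plane_rot_SO t (ev_od_neq l l).
  by rewrite -(rhoM Sk Sl) -(rhoM Sl Sk) plane_rots_comm.
- by exists U, (fun j k => w k j); split.
Qed.

Variables (U : 'M[R[i]]_d) (w : 'I_d -> 'I_n -> int).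
Hypothesis hw : weight_basis U w.
Let Uu : U \in unitmx := hw.1.

Lemma SO_prod_plane_rot (r : seq 'I_n) (s : 'I_n -> 'I_n) (x : 'I_n -> R) :
  SO (\prod_(k <- r) Rk (s k) (x k) : 'M[R]_N).
Proof.
elim: r => [|k r IH]; first by rewrite big_nil; exact: SO1.
by rewrite big_cons; apply: SO_mul IH; exact: plane_rot_SO (ev_od_neq _ _).
Qed.

(** The reindexing [s] is there for the Weyl group, whose elements permute the factors of the
    torus. *)
Lemma rep_prod_plane_rot (r : seq 'I_n) (s : 'I_n -> 'I_n) (x : 'I_n -> R) :
  rho (\prod_(k <- r) Rk (s k) (x k)) =
    conj_diag U (\row_j expi (\sum_(k <- r) (w j (s k))%:~R * x k)).
Proof.
elim: r => [|k r IH].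
  rewrite big_nil rho1 -(conj_diag1 Uu); congr conj_diag.
  by apply/rowP => j; rewrite !mxE big_nil expi0.
have Sk := plane_rot_SO (x k) (ev_od_neq (s k) (s k)).
have Sr := SO_prod_plane_rot r s x.
rewrite big_cons (rhoM Sk Sr) IH (hw.2 (s k) (x k)) -/(conj_diag U _) (conj_diagM Uu).
by congr conj_diag; apply/rowP => j; rewrite !mxE big_cons expiD.
Qed.

Lemma torus_SO (phi : 'I_n -> R) : SO (torus phi).
Proof. exact: (SO_prod_plane_rot (index_enum _) id phi). Qed.

Lemma rep_torus (phi : 'I_n -> R) :
  rho (torus phi) = conj_diag U (\row_j expi (\sum_k (w j k)%:~R * phi k)).
Proof. exact: (rep_prod_plane_rot (index_enum _) id phi). Qed.

Lemma torus_weight j : is_weight rho (\row_k w j k).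
Proof.
exists (invmx U *m delta_mx j 0).
  apply/eqP => /(congr1 (mulmx U)); rewrite mulmxA mulmxV // mul1mx mulmx0.
  by move/matrixP/(_ j 0); rewrite !mxE !eqxx /=; apply/eqP; exact: oner_neq0.
move=> phi; rewrite rep_torus (conj_diag_eigen Uu); congr (_ *: _).
by rewrite mxE; congr expi; apply: eq_bigr => k _; rewrite mxE.
Qed.

Lemma trace_torus (phi : 'I_n -> R) :
  \tr (rho (torus phi)) = \sum_j expi (\sum_k (w j k)%:~R * phi k).
Proof. by rewrite rep_torus (trace_conj_diag Uu); apply: eq_bigr => j _; rewrite mxE. Qed.

Lemma rep_gen_torus k :
  rep_gen rho (ev_idx k) (od_idx k) = conj_diag U (\row_j ((w j k)%:~R%:C * 'i%C)).
Proof.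
apply: (rep_gen_unique hrho (ev_od_neq k k)).
have -> : (fun t => rho (Rk k t)) =
   (fun t => invmx U *m diag_mx (\row_j expi ((w j k)%:~R * t)) *m U).
  by apply/funext => t; exact: hw.2.
exact: mxderive_diag_expi.
Qed.

Lemma trace_gen_torus k (phi : 'I_n -> R) :
  \tr (rep_gen rho (ev_idx k) (od_idx k) *m rho (torus phi)) =
  'i%C * \sum_j (w j k)%:~R%:C * expi (\sum_k (w j k)%:~R * phi k).
Proof.
rewrite rep_torus rep_gen_torus (conj_diagM Uu) (trace_conj_diag Uu) mulr_sumr.
by apply: eq_bigr => j _; rewrite !mxE; ring.
Qed.

Lemma trace_gen2_torus k (phi : 'I_n -> R) :
  \tr (rep_gen rho (ev_idx k) (od_idx k) *m rep_gen rho (ev_idx k) (od_idx k)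
        *m rho (torus phi)) =
  - \sum_j (w j k)%:~R%:C ^+ 2 * expi (\sum_k (w j k)%:~R * phi k).
Proof.
rewrite rep_torus rep_gen_torus !(conj_diagM Uu) (trace_conj_diag Uu) -sumrN.
apply: eq_bigr => j _; rewrite !mxE.
have e : 'i%C * 'i%C = -1 :> R[i] by rewrite -expr2 sqr_i.
by rewrite mulrACA e; ring.
Qed.

End TorusWeights.

(** * Root vectors and the Casimir equation for the character *)

Lemma big_option (V : nmodType) (T : finType) (F : option T -> V) :
  \sum_a F a = F None + \sum_x F (Some x).
Proof.
rewrite (bigD1 None) //=; congr (_ + _).
rewrite (reindex_omap (fun x => Some x) id) => [|[x|] //] /=.
by apply: eq_bigl => x; rewrite eqxx.
Qed.

Section NullFrame.
Variables (R : realType) (n : nat).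
Local Notation N := ((2 * n).+1).
Local Notation J := (option ('I_n * bool)).
Implicit Type a b : J.

Definition sgb (s : bool) : R := if s then 1 else -1.

(* The vectors e_(2k) -+ i e_(2k+1) and e_(2n) are the weight vectors of the
   defining representation, of weights +- e_k and 0. *)
Definition null_vec a : 'cV[R[i]]_N :=
  if a is Some (k, s) then
    delta_mx (ev_idx k) 0 - ((sgb s)%:C * 'i%C) *: delta_mx (od_idx k) 0
  else delta_mx ord_max 0.

Definition null_opp a : J := if a is Some (k, s) then Some (k, ~~ s) else None.

(** Normalizes the dual frame: an isotropic vector [null_vec a] pairs to 2 with its opposite, and
    the vector fixed by the torus pairs to 1 with itself. *)
Definition null_sc a : R[i] := if a is Some _ then 2^-1 else 1.

Definition null_wt a : 'rV[R]_n :=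
  if a is Some (k, s) then sgb s *: delta_mx 0 k else 0.

Definition dot (x y : 'rV[R]_n) : R := \sum_k x 0 k * y 0 k.

Lemma dotDl x y z : dot (x + y) z = dot x z + dot y z.
Proof. by rewrite -big_split; apply: eq_bigr => k _; rewrite mxE mulrDl. Qed.

Lemma dotZl c x y : dot (c *: x) y = c * dot x y.
Proof. by rewrite mulr_sumr; apply: eq_bigr => k _; rewrite mxE mulrA. Qed.

Lemma dot_sym x y : dot x y = dot y x.
Proof. by apply: eq_bigr => k _; rewrite mulrC. Qed.

Lemma dotDr x y z : dot z (x + y) = dot z x + dot z y.
Proof. by rewrite !(dot_sym z) dotDl. Qed.

Lemma dotZr c x y : dot y (c *: x) = c * dot y x.
Proof. by rewrite !(dot_sym y) dotZl. Qed.

Lemma dot0l y : dot 0 y = 0.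
Proof. by rewrite -(scale0r 0) dotZl mul0r. Qed.

Lemma dotNl x y : dot (- x) y = - dot x y.
Proof. by rewrite -scaleN1r dotZl mulN1r. Qed.

Lemma dotBl x y z : dot (x - y) z = dot x z - dot y z.
Proof. by rewrite dotDl dotNl. Qed.

Lemma dot_delta k x : dot (delta_mx 0 k) x = x 0 k.
Proof.
rewrite /dot (bigD1 k) //= mxE !eqxx mul1r big1 ?addr0 // => l /negbTE lk.
by rewrite mxE lk andbF mul0r.
Qed.

Lemma sgb_sq s : sgb s * sgb s = 1.
Proof. by case: s; rewrite /sgb ?mulrNN mulr1. Qed.

Lemma sgbN s : sgb (~~ s) = - sgb s.
Proof. by case: s; rewrite /sgb ?opprK. Qed.

Lemma null_vecE k s x : null_vec (Some (k, s)) x 0 =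
  (x == ev_idx k)%:R - (sgb s)%:C * 'i%C * (x == od_idx k)%:R.
Proof. by rewrite /null_vec mxE !mxE !andbT. Qed.

Lemma null_oppK a : null_opp (null_opp a) = a.
Proof. by case: a => [[k s]|] //=; rewrite negbK. Qed.

Lemma null_sc_neq0 a : null_sc a != 0.
Proof. by case: a => [_|] /=; rewrite ?invr_eq0 ?oner_neq0 ?pnatr_eq0. Qed.

Lemma dotC_null a b :
  dotC (null_vec a) (null_vec b) = if b == null_opp a then (null_sc a)^-1 else 0.
Proof.
have D (x : 'I_N) (v : 'cV[R[i]]_N) : dotC (delta_mx x 0) v = v x 0.
  rewrite /dotC (bigD1 x) //= mxE !eqxx mul1r big1 ?addr0 // => y /negbTE yx.
  by rewrite mxE yx mul0r.
have DB (x y : 'I_N) (z : R[i]) (v : 'cV[R[i]]_N) :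
    dotC (delta_mx x 0 - z *: delta_mx y 0) v = v x 0 - z * v y 0.
  rewrite -!D /dotC mulr_sumr -sumrB; apply: eq_bigr => l _.
  by rewrite !mxE mulrBl -mulrA.
have oe k l : (od_idx k == ev_idx l) = false by rewrite eq_sym (negbTE (ev_od_neq _ _)).
have me k : (ord_max == ev_idx k) = false by rewrite eq_sym (negbTE (ev_last_neq _)).
have mo k : (ord_max == od_idx k) = false by rewrite eq_sym (negbTE (od_last_neq _)).
case: a => [[k s]|] /=; rewrite ?DB ?D; case: b => [[l s']|] /=; rewrite !mxE ?eqxx ?andbT.
- rewrite ev_idx_eq od_idx_eq oe (negbTE (ev_od_neq _ _)).
  rewrite (_ : (Some (l, s') == Some (k, ~~ s)) = (l == k) && (s' == ~~ s)) //.
  rewrite (eq_sym l k); case: (k == l) => /=; last by ring.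
  have i2 : 'i%C * 'i%C = -1 :> R[i] by rewrite -expr2 sqr_i.
  rewrite mulr0 subr0 sub0r mulr1 mulrN mulrACA -rmorphM i2 mulrN1 opprK invrK.
  by case: s s' => [] [] /=; rewrite /sgb ?rmorphN ?rmorph1; ring.
- by rewrite (negbTE (ev_last_neq _)) (negbTE (od_last_neq _)) mulr0 subr0.
- by rewrite me mo mulr0 subr0.
- by rewrite invr1.
Qed.

Lemma null_frame (x y : 'I_N) :
  \sum_a null_vec a x 0 * (null_sc a *: null_vec (null_opp a)) y 0 = (x == y)%:R.
Proof.
have -> : (x == y)%:R = \sum_z (x == z)%:R * (y == z)%:R :> R[i].
  rewrite (bigD1 x) //= eqxx mul1r (eq_sym y) big1 ?addr0 // => z /negbTE zx.
  by rewrite (eq_sym x) zx mul0r.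
rewrite big_option big_idx_split addrC; congr (_ + _).
  pose G k s := null_vec (Some (k, s)) x 0 *
    (null_sc (Some (k, s)) *: null_vec (null_opp (Some (k, s)))) y 0.
  transitivity (\sum_(p : 'I_n * bool) G p.1 p.2); first by apply: eq_bigr => -[].
  have GE k s : G k s = ((x == ev_idx k)%:R - (sgb s)%:C * 'i%C * (x == od_idx k)%:R) *
      (2^-1 * ((y == ev_idx k)%:R - (sgb (~~ s))%:C * 'i%C * (y == od_idx k)%:R)).
    by rewrite -!null_vecE /G [X in _ * X = _]mxE.
  rewrite -(pair_bigA _ G); clearbody G.
  apply: eq_bigr => k _; rewrite big_bool !GE /sgb /= rmorphN rmorph1 !mul1r !mulN1r.
  have i2 : 'i%C * 'i%C = -1 :> R[i] by rewrite -expr2 sqr_i.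
  set A := (x == _)%:R; set B := (x == _)%:R; set A' := (y == _)%:R; set B' := (y == _)%:R.
  transitivity (A * A' - 'i%C * 'i%C * (B * B')); first by field.
  by rewrite i2 mulN1r opprK.
by rewrite /= scale1r !mxE !andbT.
Qed.

Lemma toC_torus_null (phi : 'rV[R]_n) a :
  map_mx (real_complex R) (torus (phi 0)) *m null_vec a =
    expi (dot (null_wt a) phi) *: null_vec a.
Proof.
pose rk k := plane_rot (ev_idx k) (od_idx k) (phi 0 k).
have one k : map_mx (real_complex R) (rk k) *m null_vec a =
    expi (null_wt a 0 k * phi 0 k) *: null_vec a.
  have P l := @toC_plane_rot_delta R N (ev_idx k) (od_idx k) (phi 0 k) l (ev_od_neq k k).
  have oe l : (od_idx l == ev_idx k) = false by rewrite eq_sym (negbTE (ev_od_neq _ _)).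
  have me : (ord_max == ev_idx k) = false by rewrite eq_sym (negbTE (ev_last_neq _)).
  have mo : (ord_max == od_idx k) = false by rewrite eq_sym (negbTE (od_last_neq _)).
  case: a => [[l s]|] /=; last first.
    by rewrite P me mo mxE mul0r expi0 scale1r.
  rewrite mulmxBr -scalemxAr !P ev_idx_eq od_idx_eq oe (negbTE (ev_od_neq _ _)) !mxE eqxx /=.
  rewrite (eq_sym k); have [->|lk] := eqVneq l k; last first.
    by rewrite mulr0 mul0r expi0 scale1r.
  rewrite mulr1; set c := cos _; set S := sin _.
  have -> : expi (sgb s * phi 0 k) = c%:C + (sgb s)%:C * 'i%C * S%:C.
    by apply: complex_eq; rewrite ?ReD ?ImD ?Re_mul ?Im_mul /=;
      case: s; rewrite /sgb ?mul1r ?mulN1r ?cosN ?sinN -/c -/S; ring.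
  have i2 : 'i%C * 'i%C = -1 :> R[i] by rewrite -expr2 sqr_i.
  have s2 : (sgb s)%:C * (sgb s)%:C = 1 :> R[i] by rewrite -rmorphM sgb_sq rmorph1.
  move: (delta_mx _ _ : 'cV[R[i]]_N) => A; move: (delta_mx _ _ : 'cV[R[i]]_N) => B.
  apply/colP => i; rewrite !mxE; set z := (sgb s)%:C in s2 *.
  transitivity ((c%:C + z * 'i%C * S%:C) * A i 0 -
     (z * 'i%C * c%:C + z * z * ('i%C * 'i%C) * S%:C) * B i 0); last by ring.
  by rewrite s2 i2; ring.
rewrite /torus /dot expi_sum -[index_enum _]/(index_enum _).
elim: (index_enum _) => [|k s IH].
  by rewrite !big_nil map_mx1 mul1mx scale1r.
rewrite !big_cons map_mxM -mulmxA IH -scalemxAr.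
rewrite -[plane_rot _ _ _]/(rk k) one scalerA mulrC //.
Qed.

End NullFrame.

Section CasimirEquation.
Variables (R : realType) (n : nat).

Definition pos_pairs : seq ('I_n * 'I_n) := [seq x : 'I_n * 'I_n <- enum {: 'I_n * 'I_n} | (x.1 < x.2)%N].

Definition pos_roots : seq 'rV[R]_n :=
  [seq delta_mx 0 k | k <- enum 'I_n] ++
  ([seq delta_mx 0 x.1 - delta_mx 0 x.2 | x <- pos_pairs] ++
   [seq delta_mx 0 x.1 + delta_mx 0 x.2 | x <- pos_pairs]).

Definition regular (phi : 'rV[R]_n) :=
  forall al, al \in pos_roots -> expi (dot al phi) != 1.

Lemma sum_offdiag_sym (V : zmodType) (F : 'I_n -> 'I_n -> V) :
  (forall k l, F k l = F l k) ->
  \sum_k \sum_(l | l != k) F k l = (\sum_(x <- pos_pairs) F x.1 x.2) *+ 2.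
Proof.
move=> Fs; rewrite /pos_pairs big_filter big_enum_cond /= mulr2n.
rewrite -{1}(pair_big_dep predT (fun k l : 'I_n => (k < l)%N) F) /=.
rewrite -(pair_big_dep predT (fun k l : 'I_n => (k < l)%N) F) /=.
rewrite [X in _ = X + _](exchange_big_dep predT) //= -big_split /=.
apply: eq_bigr => k _; rewrite (bigID (fun l : 'I_n => (l < k)%N)) /=.
congr (_ + _).
  rewrite [RHS](eq_bigr (F k)) => [|l _]; last exact: Fs.
  by apply: eq_bigl => l; rewrite -val_eqE /= neq_ltn; case: ltngtP.
by apply: eq_bigl => l; rewrite -val_eqE /= neq_ltn; case: ltngtP.
Qed.

Variables (d : nat) (rho : 'M[R]_((2 * n).+1) -> 'M[R[i]]_d).
Hypothesis hrho : is_representation rho.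
Variables (U : 'M[R[i]]_d) (w : 'I_d -> 'I_n -> int).
Hypothesis hw : weight_basis rho U w.
Variable phi : 'rV[R]_n.

Local Notation L := (rep_lie rho).
Local Notation f := (@null_vec R n).
Local Notation wt := (@null_wt R n).
Local Notation op := (@null_opp n).
Local Notation kap := (@null_sc R n).
Local Notation rt := (rho (torus (phi 0))).

Definition weight_vec j : 'rV[R]_n := \row_k (w j k)%:~R.
Local Notation e j := (expi (dot (weight_vec j) phi)).

Let eE j : expi (\sum_k (w j k)%:~R * phi 0 k) = e j.
Proof. by congr expi; apply: eq_bigr => k _; rewrite mxE. Qed.

Lemma torus_lie_null a b :
  rt *m L (f a) (f b) = expi (dot (wt a + wt b) phi) *: (L (f a) (f b) *m rt).
Proof.
rewrite (Ad_SO hrho (torus_SO (phi 0))) !toC_torus_null rep_lieZl rep_lieZr // scalerA.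
by rewrite -scalemxAl dotDl expiD.
Qed.

(** This is -i times the derivative of the character at [phi] in the direction [al]. *)
Definition wsum (al : 'rV[R]_n) : R[i] := \sum_j (dot al (weight_vec j))%:C * e j.

Lemma wsumD x y : wsum (x + y) = wsum x + wsum y.
Proof.
rewrite -big_split; apply: eq_bigr => j _ /=.
by rewrite dotDl rmorphD mulrDl.
Qed.

Lemma wsumN x : wsum (- x) = - wsum x.
Proof.
by rewrite -sumrN; apply: eq_bigr => j _; rewrite dotNl rmorphN mulNr.
Qed.

Let i2 : 'i%C * 'i%C = -1 :> R[i]. Proof. by rewrite -expr2 sqr_i. Qed.

Lemma lie_null_opp k s : L (f (Some (k, s))) (f (op (Some (k, s)))) =
  (2 * (sgb R s)%:C * 'i%C) *: rep_gen rho (ev_idx k) (od_idx k).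
Proof.
have lieNl u v : L (- u) v = - L u v by rewrite -scaleN1r rep_lieZl // scaleN1r.
rewrite /= sgbN rmorphN mulNr scaleNr opprK.
rewrite !(rep_lieDl, rep_lieDr hrho, lieNl, rep_lieZl, rep_lieZr hrho) !rep_lie_delta.
rewrite !rep_gen_refl (rep_genC hrho (ev_idx k) (od_idx k)).
rewrite !(scaler0, scalerN, add0r, addr0, oppr0, opprK, subr0) -scalerDl.
by congr (_ *: _); ring.
Qed.

Lemma trace_lie_opp a : \tr (L (f a) (f (op a)) *m rt) = - (kap a)^-1 * wsum (wt a).
Proof.
case: a => [[k s]|].
  rewrite lie_null_opp -scalemxAl mxtraceZ (trace_gen_torus hrho hw) /= invrK.
  rewrite mulrA -[X in X * _]mulrA i2 mulrN1 mulNr -mulrA -mulNr; congr (_ * _).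
  rewrite /wsum mulr_sumr; apply: eq_bigr => j _.
  rewrite dotZl dot_delta mxE rmorphM -mulrA; congr (_ * (_ * _)).
  by congr expi; apply: eq_bigr => l _; rewrite mxE.
have -> : L (f None) (f (op None)) = 0.
  by rewrite /= rep_lie_delta rep_gen_refl.
rewrite mul0mx mxtrace0 /wsum big1 ?mulr0 // => j _.
by rewrite dot0l rmorph0 mul0r.
Qed.

Definition pair_trace a b :=
  \tr (L (f a) (f b) *m (L (kap a *: f (op a)) (kap b *: f (op b)))  *m rt).

Lemma pair_traceE a b : pair_trace a b =
  kap a * kap b * \tr (L (f a) (f b) *m L (f (op a)) (f (op b)) *m rt).
Proof.
rewrite /pair_trace rep_lieZl rep_lieZr // scalerA.
by rewrite -scalemxAr -scalemxAl mxtraceZ.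
Qed.

(** With X = L(f a, f b), Y its opposite root vector and t the torus element, t X = E X t, so
    cyclicity of the trace gives tr(XYt) = E tr(YXt). Hence (1 - 1/E) tr(XYt) = tr([X, Y] t), and
    [X, Y] lies in the Cartan subalgebra, where the trace is a derivative of the character. *)
Lemma pair_trace_generic a b : b != a -> b != op a ->
  expi (dot (wt a + wt b) phi) != 1 ->
  pair_trace a b = - (wsum (wt a + wt b) / (1 - (expi (dot (wt a + wt b) phi))^-1)).
Proof.
move=> ba bo; set E := expi _ => E1.
have E0 : E != 0 by exact: expi_neq0.
have E2 : 1 - E^-1 != 0 by rewrite subr_eq0 eq_sym invr_eq1.
set X := \tr (L (f a) (f b) *m L (f (op a)) (f (op b)) *m rt).
have h1 : X = E * \tr (L (f (op a)) (f (op b)) *m L (f a) (f b) *m rt).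
  rewrite /X -[in LHS]mulmxA [LHS]mxtrace_mulC -[in LHS]mulmxA.
  by rewrite torus_lie_null -/E -scalemxAr mxtraceZ mulmxA.
have h2 : X - \tr (L (f (op a)) (f (op b)) *m L (f a) (f b) *m rt) =
    - (kap a)^-1 * (kap b)^-1 * wsum (wt a + wt b).
  rewrite /X -raddfB /= -mulmxBl (rep_lie_bracket hrho) !dotC_null.
  have inj x y : (op x == op y) = (x == y).
    by apply/eqP/eqP => [/(congr1 op)|->//]; rewrite !null_oppK.
  rewrite !inj !eqxx (eq_sym a b) (negbTE ba).
  rewrite !scale0r subr0 sub0r.
  rewrite rep_lieZl -scaleNr rep_lieZr // mulmxDl raddfD /= -!scalemxAl !mxtraceZ.
  rewrite trace_lie_opp (rep_lieC hrho (f a)) mulNmx raddfN /= trace_lie_opp wsumD; ring.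
rewrite pair_traceE -/X.
have k0 := null_sc_neq0 R a; have k0' := null_sc_neq0 R b.
have : X * (1 - E^-1) = - (kap a)^-1 * (kap b)^-1 * wsum (wt a + wt b).
  by rewrite -h2 mulrBr mulr1 {2}h1 mulrAC divff // mul1r.
move=> h3; apply: (mulIf E2); rewrite mulNr divfK //.
transitivity (kap a * kap b * (X * (1 - E^-1))); first by rewrite mulrA.
by rewrite h3; field; rewrite k0 k0'.
Qed.

Lemma pair_trace_diag a : pair_trace a a = 0.
Proof.
rewrite pair_traceE; have -> : L (f a) (f a) = 0; last by rewrite !mul0mx mxtrace0 mulr0.
have := rep_lieC hrho (f a) (f a); move/eqP.
by rewrite -addr_eq0 -mulr2n -scaler_nat scaler_eq0 pnatr_eq0 => /eqP.
Qed.

Lemma pair_trace_opp k s : pair_trace (Some (k, s)) (Some (k, ~~ s)) =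
  - \sum_j (w j k)%:~R%:C ^+ 2 * e j.
Proof.
rewrite pair_traceE.
have -> : L (f (op (Some (k, s)))) (f (op (Some (k, ~~ s)))) =
          - L (f (Some (k, s))) (f (op (Some (k, s)))).
  by rewrite -(rep_lieC hrho) /= negbK.
rewrite -[Some (k, ~~ s)]/(op (Some (k, s))) lie_null_opp.
rewrite mulmxN mulNmx raddfN /= -scalemxAr -!scalemxAl scalerA mxtraceZ.
rewrite (trace_gen2_torus hrho hw).
under [in LHS]eq_bigr do rewrite eE.
have s2 : (sgb R s)%:C * (sgb R s)%:C = 1 :> R[i] by rewrite -rmorphM sgb_sq rmorph1.
rewrite !mulrN opprK.
transitivity (((sgb R s)%:C * (sgb R s)%:C) * ('i%C * 'i%C) * \sum_j (w j k)%:~R%:C ^+ 2 * e j).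
  by field.
by rewrite s2 i2; ring.
Qed.

End CasimirEquation.

Section CasimirCharacter.
Variables (R : realType) (n : nat).

Lemma big_pos_roots (T : Type) (idx : T) (op : Monoid.com_law idx)
    (F : 'rV[R]_n -> T) :
  \big[op/idx]_(al <- pos_roots R n) F al =
  op (\big[op/idx]_k F (delta_mx 0 k))
     (\big[op/idx]_(x <- pos_pairs n)
        op (F (delta_mx 0 x.1 - delta_mx 0 x.2)) (F (delta_mx 0 x.1 + delta_mx 0 x.2))).
Proof.
by rewrite /pos_roots !big_cat !big_map big_split /=; congr (op _ _); rewrite ?big_enum.
Qed.

Lemma mem_pos_pairs (k l : 'I_n) : ((k, l) \in pos_pairs n) = (k < l)%N.
Proof. by rewrite /pos_pairs mem_filter mem_enum andbT. Qed.

Lemma mem_pos_roots_short (k : 'I_n) : delta_mx 0 k \in pos_roots R n.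
Proof. by rewrite /pos_roots mem_cat map_f // mem_enum. Qed.

Lemma mem_pos_roots_sub (k l : 'I_n) : (k < l)%N ->
  delta_mx 0 k - delta_mx 0 l \in pos_roots R n.
Proof.
move=> kl; rewrite /pos_roots !mem_cat.
by rewrite (map_f (fun x => delta_mx 0 x.1 - delta_mx 0 x.2) (x := (k, l))) ?orbT ?mem_pos_pairs.
Qed.

Lemma mem_pos_roots_add (k l : 'I_n) : (k < l)%N ->
  delta_mx 0 k + delta_mx 0 l \in pos_roots R n.
Proof.
move=> kl; rewrite /pos_roots !mem_cat.
by rewrite (map_f (fun x => delta_mx 0 x.1 + delta_mx 0 x.2) (x := (k, l))) ?orbT ?mem_pos_pairs.
Qed.

(** The bookkeeping of the Casimir sum: every root, positive or negative, is [null_wt a + null_wt b]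
    for exactly two ordered pairs (a, b), and the pairs (a, opposite of a) of weight 0 meet each
    index k twice. The contributions of [al] and [- al] are merged into [h al]. *)
Lemma sum_null_pairs (C : comPzRingType) (P : option ('I_n * bool) -> option ('I_n * bool) -> C)
    (g h : 'rV[R]_n -> C) (W : 'I_n -> C) :
  (forall a, P a a = 0) ->
  (forall k s, P (Some (k, s)) (Some (k, ~~ s)) = - W k) ->
  (forall a b, b != a -> b != null_opp a ->
     P a b = - g (null_wt R a + null_wt R b)) ->
  (forall al, al \in pos_roots R n -> g al + g (- al) = h al) ->
  (forall al, h (- al) = h al) ->
  \sum_a \sum_b P a b = - (\sum_k W k + \sum_(al <- pos_roots R n) h al) *+ 2.
Proof.
move=> Pd Po Pg gh hN.
have sum_pair (F : 'I_n * bool -> C) :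
    \sum_x F x = \sum_k (F (k, true) + F (k, false)).
  transitivity (\sum_x F (x.1, x.2)); first by apply: eq_bigr => -[].
  rewrite -(pair_bigA _ (fun k s => F (k, s))) /=.
  by apply: eq_bigr => k _; rewrite big_bool.
have wtE k s : null_wt R (Some (k, s)) = if s then delta_mx 0 k else - delta_mx 0 k.
  by case: s; rewrite /= /sgb ?scale1r ?scaleN1r.
have gk k : g (delta_mx 0 k) + g (- delta_mx 0 k) = h (delta_mx 0 k).
  by apply: gh; exact: mem_pos_roots_short.
have short k s : P None (Some (k, s)) = - g (if s then delta_mx 0 k else - delta_mx 0 k)
    /\ P (Some (k, s)) None = - g (if s then delta_mx 0 k else - delta_mx 0 k).
  by split; rewrite Pg // wtE ?add0r ?addr0.
have sum1 : \sum_b P None b = - \sum_k h (delta_mx 0 k).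
  rewrite big_option Pd add0r sum_pair -sumrN.
  apply: eq_bigr => k _.
  by rewrite (short k true).1 (short k false).1 -opprD gk.
have sum2 : \sum_x P (Some x) None = - \sum_k h (delta_mx 0 k).
  rewrite sum_pair -sumrN; apply: eq_bigr => k _.
  by rewrite (short k true).2 (short k false).2 -opprD gk.
pose Q k l := \sum_s \sum_t P (Some (k, s)) (Some (l, t)).
have sum3 : \sum_x \sum_y P (Some x) (Some y) = \sum_k \sum_l Q k l.
  rewrite sum_pair; apply: eq_bigr => k _.
  rewrite !sum_pair -big_split /=; apply: eq_bigr => l _.
  by rewrite /Q !big_bool.
have Qdiag k : Q k k = - W k *+ 2.
  rewrite /Q !big_bool /= !Pd add0r addr0.
  by rewrite (Po k true) (Po k false) mulr2n.
have hs k l : h (delta_mx 0 k - delta_mx 0 l) + h (delta_mx 0 k + delta_mx 0 l) =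
              h (delta_mx 0 l - delta_mx 0 k) + h (delta_mx 0 l + delta_mx 0 k).
  by rewrite -(hN (delta_mx 0 k - _)) opprB (addrC (delta_mx 0 k)).
have gh' k l : k != l -> g (delta_mx 0 k - delta_mx 0 l) + g (delta_mx 0 l - delta_mx 0 k) =
     h (delta_mx 0 k - delta_mx 0 l) /\
     g (delta_mx 0 k + delta_mx 0 l) + g (- (delta_mx 0 k + delta_mx 0 l)) =
     h (delta_mx 0 k + delta_mx 0 l).
  rewrite neq_ltn => /orP[] kl.
    by rewrite -(gh _ (mem_pos_roots_sub kl)) -(gh _ (mem_pos_roots_add kl)) opprB.
  rewrite -(hN (delta_mx 0 k - _)) opprB (addrC (delta_mx 0 k) (delta_mx 0 l)).
  rewrite -(gh _ (mem_pos_roots_sub kl)) -(gh _ (mem_pos_roots_add kl)) opprB.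
  by split; rewrite // addrC.
have Qoff k l : l != k ->
    Q k l = - (h (delta_mx 0 k - delta_mx 0 l) + h (delta_mx 0 k + delta_mx 0 l)).
  move=> lk.
  have PP s t : P (Some (k, s)) (Some (l, t)) =
      - g ((if s then delta_mx 0 k else - delta_mx 0 k) +
           (if t then delta_mx 0 l else - delta_mx 0 l)).
    by rewrite Pg ?wtE //; apply: contra lk => /eqP[->].
  rewrite eq_sym in lk; have [<- <-] := gh' _ _ lk.
  rewrite /Q !big_bool /= !PP (opprD (delta_mx 0 k)) (addrC (- delta_mx 0 k) (delta_mx 0 l)) /=; ring.
rewrite big_option sum1.
have -> : \sum_x \sum_b P (Some x) b =
   \sum_x P (Some x) None + \sum_x \sum_y P (Some x) (Some y).
  by rewrite -big_split /=; apply: eq_bigr => x _; rewrite big_option.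
have sum4 : \sum_k \sum_l Q k l = - (\sum_k W k) *+ 2
   - (\sum_(x <- pos_pairs n) (h (delta_mx 0 x.1 - delta_mx 0 x.2) + h (delta_mx 0 x.1 + delta_mx 0 x.2))) *+ 2.
  under eq_bigr => k _ do rewrite (bigD1 k) //= Qdiag.
  rewrite big_split /=; congr (_ + _).
    by rewrite sumrMnl sumrN.
  under eq_bigr => k _ do under eq_bigr => l lk do rewrite (Qoff k l lk).
  rewrite -(sum_offdiag_sym hs) -sumrN; apply: eq_bigr => k _.
  by rewrite sumrN.
rewrite sum2 sum3 sum4 big_pos_roots /=; ring.
Qed.

Variables (d : nat) (rho : 'M[R]_((2 * n).+1) -> 'M[R[i]]_d).
Hypothesis hrho : is_representation rho.
Variables (U : 'M[R[i]]_d) (w : 'I_d -> 'I_n -> int).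
Hypothesis hw : weight_basis rho U w.

Local Notation wt := (@null_wt R n).

(** The radial part of the Laplace operator of the group: the coefficient (E + 1)/(E - 1) with E =
    exp(i x) is -i cot(x/2), and [wsum] is a first derivative. *)
Lemma casimir_character : is_irreducible rho -> exists z : R[i],
  forall phi, regular phi ->
    z * \sum_j expi (dot (weight_vec R w j) phi) =
    \sum_j (dot (weight_vec R w j) (weight_vec R w j))%:C * expi (dot (weight_vec R w j) phi) +
    \sum_(al <- pos_roots R n)
      (expi (dot al phi) + 1) / (expi (dot al phi) - 1) * wsum w phi al.
Proof.
move=> /(casimir_scalar hrho) [c cE]; exists (- c / 2) => phi reg.
set chi := \sum_j _.
have trc : c * chi = \sum_a \sum_b pair_trace rho phi a b.
  have frame := casimir_frame rho (@null_frame R n).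
  have -> : c * chi = \tr (casimir rho *m rho (torus (phi 0))).
    rewrite cE mul_scalar_mx mxtraceZ (trace_torus hrho hw); congr (_ * _).
    by apply: eq_bigr => j _; congr expi; apply: eq_bigr => k _; rewrite mxE.
  rewrite -frame mulmx_suml raddf_sum /=.
  by rewrite -(pair_bigA _ (fun a b => pair_trace rho phi a b)).
pose g al := wsum w phi al / (1 - (expi (dot al phi))^-1).
pose h al := (expi (dot al phi) + 1) / (expi (dot al phi) - 1) * wsum w phi al.
have gh al : expi (dot al phi) != 1 -> g al + g (- al) = h al.
  move=> E1; rewrite /g /h wsumN dotNl expiN invrK.
  have E0 := expi_neq0 (dot al phi); set E := expi _ in E0 E1 *.
  have E2 : E - 1 != 0 by rewrite subr_eq0.
  have E3 : 1 - E != 0 by rewrite subr_eq0 eq_sym.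
  have -> : (1 - E^-1)^-1 = E / (E - 1).
    by field; rewrite E0 E2.
  by field; rewrite ?E2 ?E3.
have hN al : h (- al) = h al.
  rewrite /h wsumN dotNl expiN.
  have E0 := expi_neq0 (dot al phi); set E := expi _ in E0 *.
  (* On the wall E = 1 both sides are 0, the inverse of 0 being 0. *)
  have [->|E1] := eqVneq E 1; first by rewrite invr1 subrr invr0 !mulr0 !mul0r.
  have E2 : E - 1 != 0 by rewrite subr_eq0.
  have E3 : 1 - E != 0 by rewrite subr_eq0 eq_sym.
  by field; rewrite E2 E0 mulN1r.
have E_N al : expi (dot al phi) != 1 -> expi (dot (- al) phi) != 1.
  by rewrite dotNl expiN invr_eq1.
have reg1 k s : expi (dot (wt (Some (k, s))) phi) != 1.
  have r1 := reg _ (mem_pos_roots_short k).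
  by case: s => /=; rewrite /sgb ?scale1r // scaleN1r; exact: E_N.
have reg2 k l s t : k != l -> expi (dot (wt (Some (k, s)) + wt (Some (l, t))) phi) != 1.
  wlog kl : k l s t / (k < l)%N => [H kl|_].
    have : (k < l)%N || (l < k)%N by rewrite -neq_ltn.
    move=> /orP[] h1; first exact: H.
    by rewrite addrC; apply: H => //; rewrite eq_sym.
  have r1 := reg _ (mem_pos_roots_add kl); have r2 := reg _ (mem_pos_roots_sub kl).
  case: s t => [] [] /=; rewrite /sgb ?scale1r ?scaleN1r //.
    by rewrite addrC -opprB; exact: E_N.
  by rewrite -opprD; exact: E_N.
have reg0 a b : b != a -> b != null_opp a -> expi (dot (wt a + wt b) phi) != 1.
  case: a b => [[k s]|] [[l t]|] //; rewrite ?addr0 ?add0r // => ba bo.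
  apply: reg2; apply/eqP => kl; move: ba bo; rewrite kl /=.
  by case: s t => [] []; rewrite eqxx.
have := @sum_null_pairs R[i] (pair_trace rho phi) g h
  (fun k => \sum_j (w j k)%:~R%:C ^+ 2 * expi (dot (weight_vec R w j) phi))
  (pair_trace_diag hrho phi) (pair_trace_opp hrho hw phi).
rewrite -trc => /(_ _ _ hN) cc.
have -> : \sum_j (dot (weight_vec R w j) (weight_vec R w j))%:C *
      expi (dot (weight_vec R w j) phi) =
    \sum_k \sum_j (w j k)%:~R%:C ^+ 2 * expi (dot (weight_vec R w j) phi).
  rewrite exchange_big /=; apply: eq_bigr => j _.
  rewrite -mulr_suml; congr (_ * _); rewrite /dot rmorph_sum.
  by apply: eq_bigr => k _; rewrite !mxE rmorphM expr2.
transitivity (- (c * chi) / 2); first by ring.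
rewrite cc; first by rewrite mulNrn opprK -[X in X / _]mulr_natr mulfK // pnatr_eq0.
- by move=> a b ba bo; rewrite (pair_trace_generic hrho hw) // reg0.
- by move=> al /reg; exact: gh.
Qed.

End CasimirCharacter.

(** * Invariance of the character under the Weyl group *)

Section WeylSymmetry.
Variables (R : realType) (n d : nat) (rho : 'M[R]_((2 * n).+1) -> 'M[R[i]]_d).
Hypothesis hrho : is_representation rho.
Variables (U : 'M[R[i]]_d) (w : 'I_d -> 'I_n -> int).
Hypothesis hw : weight_basis rho U w.
Local Notation N := ((2 * n).+1).
Local Notation Rk k t := (plane_rot (ev_idx k) (od_idx k) t).

Let rho1 : rho 1%:M = 1%:M. Proof. by case: hrho. Qed.
Let rhoM g h : SO g -> SO h -> rho (g *m h) = rho g *m rho h.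
Proof. by case: hrho => _ h1 _; exact: h1. Qed.

(** Conjugation by an element normalizing the torus preserves the trace and acts on the angles;
    expanding both traces over weights gives the symmetry without following individual weight
    spaces. *)
Lemma trace_torus_normalizer (g : 'M[R]_N) (s : 'I_n -> 'I_n) (ep : 'I_n -> R)
    (phi : 'I_n -> R) :
  SO g -> (forall k t, g *m Rk k t = Rk (s k) (ep k * t) *m g) ->
  \sum_j expi (\sum_k (w j k)%:~R * phi k) =
  \sum_j expi (\sum_k (w j (s k))%:~R * (ep k * phi k)).
Proof.
move=> gS gR; rewrite -(trace_torus hrho hw).
pose pr (r : seq 'I_n) : 'M[R]_N := \prod_(k <- r) Rk (s k) (ep k * phi k).
have prS r : SO (pr r) by exact: SO_prod_plane_rot.
have prE r := rep_prod_plane_rot hrho hw r s (fun k => ep k * phi k).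
have gpr r : g *m (\prod_(k <- r) Rk k (phi k)) = pr r *m g.
  elim: r => [|k r IH]; first by rewrite /pr !big_nil mulmx1 mul1mx.
  rewrite /pr !big_cons; set A := \prod_(k <- r) _; set B := \prod_(k <- r) _.
  change (g *m (Rk k (phi k) *m A) = Rk (s k) (ep k * phi k) *m B *m g).
  by rewrite mulmxA gR -mulmxA [g *m A]IH mulmxA.
have gi : rho g^T *m rho g = 1%:M.
  by rewrite -(rhoM (SO_tr gS) gS) gS.1.
transitivity (\tr (rho (pr (index_enum _)))).
  rewrite -[rho (torus phi)]mul1mx -gi -mulmxA -(rhoM gS (torus_SO phi)).
  have -> : g *m torus phi = pr (index_enum _) *m g by exact: gpr.
  by rewrite (rhoM (prS _) gS) mxtrace_mulC -mulmxA (mulmx1C gi) mulmx1.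
rewrite /pr prE (trace_conj_diag hw.1).
by apply: eq_bigr => j _; rewrite mxE.
Qed.

Lemma perm_mx_plane_rot (s : {perm 'I_N}) (p q : 'I_N) (t : R) :
  perm_mx s *m plane_rot p q t = plane_rot (s^-1%g p) (s^-1%g q) t *m perm_mx s.
Proof.
rewrite -row_permE -[s in RHS]invgK -col_permE; apply/matrixP => i j.
rewrite !mxE.
have e (x y : 'I_N) : (s x == y) = (x == s^-1%g y).
  by apply/eqP/eqP => [<-|->]; rewrite ?permK ?permKV.
by rewrite ?invgK !e !(inj_eq (@perm_inj _ (s^-1)%g)).
Qed.

Lemma trace_torus_swap (k l : 'I_n) (phi : 'rV[R]_n) :
  \sum_j expi (dot (weight_vec R w j) (xcol k l phi)) =
  \sum_j expi (dot (weight_vec R w j) phi).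
Proof.
have [->|kl] := eqVneq k l.
  apply: eq_bigr => j _; congr (expi (dot _ _)).
  by apply/rowP => i; rewrite !mxE tperm1 perm1.
(* Exchanging two coordinate planes takes two transpositions, so the permutation matrix has
   determinant 1. *)
pose s : {perm 'I_N} := (tperm (ev_idx k) (ev_idx l) * tperm (od_idx k) (od_idx l))%g.
have sev i : s (ev_idx i) = ev_idx (tperm k l i).
  rewrite permM; case: (tpermP k l i) => [->|->|ik il].
  - by rewrite tpermL tpermD // eq_sym ev_od_neq.
  - by rewrite tpermR tpermD // eq_sym ev_od_neq.
  rewrite !tpermD // ?(ev_idx_eq) 1?eq_sym ?ev_od_neq //; exact/eqP.
have sod i : s (od_idx i) = od_idx (tperm k l i).
  have eo x y : (ev_idx x == od_idx y) = false by rewrite (negbTE (ev_od_neq _ _)).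
  rewrite permM (tpermD (x := ev_idx k)) ?eo //.
  case: (tpermP k l i) => [->|->|ik il].
  - by rewrite tpermL.
  - by rewrite tpermR.
  by rewrite tpermD // od_idx_eq eq_sym; apply/eqP.
have sVev i : s^-1%g (ev_idx i) = ev_idx (tperm k l i).
  by apply: (canLR (permK s)); rewrite sev tpermK.
have sVod i : s^-1%g (od_idx i) = od_idx (tperm k l i).
  by apply: (canLR (permK s)); rewrite sod tpermK.
have sS : SO (perm_mx s : 'M[R]_N).
  split; first by rewrite tr_perm_mx -perm_mxM mulVg perm_mx1.
  by rewrite det_perm /s odd_permM !odd_tperm ev_idx_eq od_idx_eq kl.
have h := trace_torus_normalizer (s := tperm k l) (ep := fun=> 1) (phi 0) sS.
have {}h := h (fun i t => _).
transitivity (\sum_j expi (\sum_i (w j (tperm k l i))%:~R * (1 * phi 0 i))).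
  apply: eq_bigr => j _; congr expi; rewrite /dot (reindex_inj (@perm_inj _ (tperm k l))) /=.
  by apply: eq_bigr => i _; rewrite !mxE tpermK mul1r.
rewrite -h.
  by apply: eq_bigr => j _; congr expi; apply: eq_bigr => i _; rewrite mxE.
by move=> i t; rewrite perm_mx_plane_rot sVev sVod mul1r.
Qed.

Definition flip (k : 'I_n) (x : 'rV[R]_n) : 'rV[R]_n :=
  \row_i ((if i == k then -1 else 1) * x 0 i).

Lemma trace_torus_flip (k : 'I_n) (phi : 'rV[R]_n) :
  \sum_j expi (dot (weight_vec R w j) (flip k phi)) =
  \sum_j expi (dot (weight_vec R w j) phi).
Proof.
have om := od_last_neq k.
(* The half-turn in the plane of od_idx k and the last coordinate negates both: it reverses the k-th
   angle alone, and the extra odd coordinate absorbs the second sign. *)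
have gS := plane_rot_SO (pi : R) om.
have eo x y : (ev_idx x == od_idx y) = false by rewrite (negbTE (ev_od_neq _ _)).
have oe x y : (od_idx x == ev_idx y) = false by rewrite eq_sym (negbTE (ev_od_neq _ _)).
have gR i (t : R) : plane_rot (od_idx k) ord_max pi *m Rk i t =
    Rk i ((if i == k then -1 else 1) * t) *m plane_rot (od_idx k) ord_max pi.
  have [->|ik] := eqVneq i k; last first.
    rewrite mul1r plane_rot_comm // ?ev_od_neq ?oe ?od_idx_eq 1?eq_sym //.
    - by rewrite ev_last_neq.
    - by rewrite od_last_neq.
  apply: mulmx_ext => X; rewrite -!mulmxA; apply/matrixP => a b.
  have em : (ord_max == ev_idx k) = false by rewrite eq_sym (negbTE (ev_last_neq _)).
  have emo : (ord_max == od_idx k) = false by rewrite eq_sym (negbTE om).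
  rewrite !plane_rot_mull ?ev_od_neq // !eqxx oe eo em emo ?(negbTE (ev_last_neq _)).
  rewrite ?(negbTE om) !mulN1r cosN sinN cospi sinpi.
  case: (eqVneq a (od_idx k)) => [->|ao].
    by rewrite oe; ring.
  case: (eqVneq a ord_max) => [->|am].
    by rewrite em; ring.
  by case: (eqVneq a (ev_idx k)) => // _; ring.
have := trace_torus_normalizer (s := id) (phi 0) gS gR => h.
transitivity (\sum_j expi (\sum_i (w j i)%:~R * ((if i == k then -1 else 1) * phi 0 i))).
  by apply: eq_bigr => j _; congr expi; apply: eq_bigr => i _; rewrite !mxE.
by rewrite -h; apply: eq_bigr => j _; congr expi; apply: eq_bigr => i _; rewrite mxE.
Qed.

End WeylSymmetry.

(** * Exponential sums *)

Section OneVariable.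
Variable R : realType.
Local Notation nc := (@Normc.normc R).

Lemma ncM (x y : R[i]) : nc (x * y) = nc x * nc y.
Proof. exact: Normc.normcM. Qed.

Lemma ncD (x y : R[i]) : nc (x + y) <= nc x + nc y.
Proof. exact: le_normcD. Qed.

Lemma ncN (x : R[i]) : nc (- x) = nc x.
Proof. exact: normcN. Qed.

Lemma nc_ge0 (x : R[i]) : 0 <= nc x.
Proof. by case: x => a b; exact: sqrtr_ge0. Qed.

Lemma nc_expi (x : R) : nc (expi x) = 1.
Proof. by rewrite /Normc.normc /= cos2Dsin2 sqrtr1. Qed.

Lemma sin_lower_bound : exists2 e : R, 0 < e & forall x, `|x| < e -> `|x| / 2 <= `|sin x|.
Proof.
have [ds vs] := @is_derive_sin R 0.
have half : (2^-1 : R) < 'D_1 sin 0 by rewrite vs cos0 invf_lt1 // ltr1n.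
have := cvgr_gt _ ds _ half.
case=> e e0 he; exists e => // x xe.
have [->|x0] := eqVneq x 0; first by rewrite normr0 mul0r.
have /= := he x; rewrite /ball /= sub0r normrN => /(_ xe x0).
rewrite sin0 subr0 addr0 /GRing.scale /= mulr1 => h.
have h2 : 2^-1 <= `|x^-1 * sin x| by apply: le_trans (ltW h) (ler_norm _).
by rewrite normrM normfV ler_pdivlMl ?normr_gt0 // in h2.
Qed.

Lemma nc_expi_sub (x y : R) : nc (expi x - expi y) >= `|sin (x - y)|.
Proof.
have -> : expi x - expi y = expi y * (expi (x - y) - 1).
  by rewrite mulrBr mulr1 -expiD [y + _]addrC subrK.
rewrite ncM nc_expi mul1r; move: (x - y) => z.
rewrite /Normc.normc /= -sqrtr_sqr ler_wsqrtr // oppr0 addr0 lerDr; exact: sqr_ge0.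
Qed.

(* Each step applies u_j |-> u_(j+1) - z_g u_j, which kills the g-th
   exponential and at most doubles the sup norm. *)
Lemma exp_sum_difference (gs : seq R) (f0 t : R) (c : R -> R[i]) (M : R) :
  (forall j, (j <= size gs)%N ->
     nc (\sum_(f <- f0 :: gs) c f * expi (f * t) ^+ j.+1) <= M) ->
  nc (c f0) * \prod_(g <- gs) nc (expi (f0 * t) - expi (g * t)) <= 2 ^+ size gs * M.
Proof.
elim: gs c M => [|g gs IH] c M h.
  have := h 0%N isT; rewrite big_seq1 big_nil ncM expr1 nc_expi.
  by rewrite expr0 mul1r.
rewrite big_cons.
pose c' f := c f * (expi (f * t) - expi (g * t)).
have -> : nc (c f0) * (nc (expi (f0 * t) - expi (g * t)) *
    \prod_(j <- gs) nc (expi (f0 * t) - expi (j * t))) =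
  nc (c' f0) * \prod_(j <- gs) nc (expi (f0 * t) - expi (j * t)).
  by rewrite /c' ncM mulrA.
rewrite /= exprS.
have -> : 2 * 2 ^+ size gs * M = 2 ^+ size gs * (2 * M) by ring.
apply: IH => j jg.
have -> : \sum_(f <- f0 :: gs) c' f * expi (f * t) ^+ j.+1 =
   \sum_(f <- f0 :: g :: gs) c f * expi (f * t) ^+ j.+2 -
   expi (g * t) * \sum_(f <- f0 :: g :: gs) c f * expi (f * t) ^+ j.+1.
  rewrite mulr_sumr -sumrB !big_cons /c'.
  have -> : c g * expi (g * t) ^+ j.+2 - expi (g * t) * (c g * expi (g * t) ^+ j.+1) = 0.
    by rewrite !exprS; ring.
  rewrite add0r; congr (_ + _); first by rewrite !exprS; ring.
  by apply: eq_bigr => f _; rewrite !exprS; ring.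
apply: le_trans (ncD _ _) _; rewrite ncN ncM nc_expi mul1r.
have h1 := h j.+1 jg; have h2 := h j (leqW jg).
lra.
Qed.

(** Sampling at t, 2t, 3t, ... and eliminating the other frequencies isolates c f0 times a product
    of differences bounded below by a constant times t^(size fs - 1). The hypothesis bounds the
    samples by e times the same power of t; dividing, |c f0| is at most a constant times e. *)
Lemma exp_sum_small_eq0 (fs : seq R) (c : R -> R[i]) :
  uniq fs ->
  (forall e, 0 < e -> exists2 r, 0 < r & forall t, 0 < t < r ->
     nc (\sum_(f <- fs) c f * expi (f * t)) <= e * t ^+ (size fs).-1) ->
  forall f0, f0 \in fs -> c f0 = 0.
Proof.
move=> ufs small f0 ffs.
have pfs : perm_eq fs (f0 :: rem f0 fs) by exact: perm_to_rem.
set gs := rem f0 fs in pfs.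
have sz : (size fs).-1 = size gs by rewrite (perm_size pfs).
have gf g : g \in gs -> g != f0.
  by move=> gg; have := ufs; rewrite (perm_uniq pfs) /= => /andP[f0g _]; apply: contraNneq f0g => <-.
have [e1 e10 sinb] := sin_lower_bound.
pose K : R := \prod_(g <- gs) (`|f0 - g| / 2).
have K0 : 0 < K.
  rewrite /K big_seq; apply: prodr_gt0 => g gg; rewrite divr_gt0 // normr_gt0 subr_eq0 eq_sym.
  exact: gf.
pose K' : R := 2 ^+ size gs * (size gs).+1%:R ^+ size gs.
have K'0 : 0 < K' by rewrite mulr_gt0 ?exprn_gt0 // ltr0n.
have main e : 0 < e -> nc (c f0) * K <= e * K'.
  move=> e0; have [r r0 hr] := small e e0.
  pose B : R := 1 + \sum_(g <- gs) `|f0 - g|.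
  have B0 : 0 < B by rewrite ltr_pwDl // sumr_ge0.
  have gB g : g \in gs -> `|f0 - g| < B.
    move=> gg; rewrite /B (big_rem g) //= addrCA ltrDl ltr_pwDl // sumr_ge0 //.
  (* The first bound keeps all sample points below r; the second keeps the angles (f0 - g) t in the
     range where |sin x| >= |x|/2. *)
  pose t := Num.min (r / (size gs).+2%:R) (e1 / B).
  have t0 : 0 < t by rewrite lt_min !divr_gt0 ?ltr0n.
  have tr : t * (size gs).+1%:R < r.
    have : t <= r / (size gs).+2%:R by rewrite ge_min lexx.
    rewrite ler_pdivlMr ?ltr0n // => h; apply: lt_le_trans h.
    by rewrite ltr_pM2l // ltr_nat.
  have te : t * B <= e1.
    have : t <= e1 / B by rewrite ge_min lexx orbT.
    by rewrite ler_pdivlMr.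
  pose M := e * ((size gs).+1%:R * t) ^+ size gs.
  have hM j : (j <= size gs)%N ->
      nc (\sum_(f <- f0 :: gs) c f * expi (f * t) ^+ j.+1) <= M.
    move=> jg.
    have jt : 0 < t * j.+1%:R < r.
      rewrite mulr_gt0 ?ltr0n //=; apply: le_lt_trans tr.
      by rewrite ler_pM2l // ler_nat ltnS.
    have := hr _ jt; rewrite (perm_big _ pfs) /= sz.
    have -> : \sum_(f <- f0 :: gs) c f * expi (f * (t * j.+1%:R)) =
       \sum_(f <- f0 :: gs) c f * expi (f * t) ^+ j.+1.
      by apply: eq_bigr => f _; rewrite mulrA mulr_natr expiMn.
    move=> h; apply: le_trans h _; rewrite /M ler_pM2l //.
    rewrite lerXn2r ?nnegrE ?mulr_ge0 ?ler0n ?(ltW t0) //.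
    by rewrite mulrC ler_pM2r // ler_nat ltnS.
  have h := exp_sum_difference hM.
  have lowb : \prod_(g <- gs) (`|f0 - g| / 2 * t) <=
       \prod_(g <- gs) nc (expi (f0 * t) - expi (g * t)).
    rewrite big_seq [X in _ <= X]big_seq; apply: ler_prod => g gg.
    rewrite mulr_ge0 ?divr_ge0 ?(ltW t0) //=.
    apply: le_trans (nc_expi_sub _ _); rewrite -mulrBl.
    have nt : `|(f0 - g) * t| = `|f0 - g| * t by rewrite normrM (gtr0_norm t0).
    rewrite mulrAC -nt; apply: sinb; rewrite nt; apply: lt_le_trans te.
    by rewrite mulrC ltr_pM2l // gB.
  have eqK : \prod_(g <- gs) (`|f0 - g| / 2 * t) = K * t ^+ size gs.
    by rewrite big_split /= big_const_seq count_predT iter_mulr_1.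
  rewrite eqK in lowb.
  have : nc (c f0) * (K * t ^+ size gs) <= 2 ^+ size gs * M.
    by apply: le_trans h; rewrite ler_wpM2l ?nc_ge0.
  have -> : 2 ^+ size gs * M = e * K' * t ^+ size gs.
    by rewrite /M /K' exprMn; ring.
  by rewrite mulrA ler_pM2r // exprn_gt0.
have : nc (c f0) = 0.
  apply/eqP; rewrite eq_le nc_ge0 andbT leNgt; apply/negP => n0.
  have := main (nc (c f0) * K / K' / 2).
  have p : 0 < nc (c f0) * K by rewrite mulr_gt0.
  rewrite !divr_gt0 // => /(_ isT).
  have -> : nc (c f0) * K / K' / 2 * K' = nc (c f0) * K / 2.
    by field; rewrite gt_eqF.
  lra.
by move/Normc.eq0_normc.
Qed.

End OneVariable.

Lemma sum_group (C : pzRingType) (T : eqType) (A : eqType) (s : seq A) (k : A -> T)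
    (x : A -> C) (F : T -> C) :
  \sum_(p <- s) x p * F (k p) =
  \sum_(f <- undup (map k s)) (\sum_(p <- s | k p == f) x p) * F f.
Proof.
under [RHS]eq_bigr do rewrite big_distrl big_mkcond /=.
rewrite exchange_big /= big_seq [RHS]big_seq; apply: eq_bigr => p ps.
rewrite (bigD1_seq (k p)) /= ?undup_uniq ?mem_undup ?map_f // eqxx.
by rewrite big1 ?addr0 // => f /negbTE fp; rewrite eq_sym fp.
Qed.

(** * Exponential sums in several variables *)

Section ExponentialSums.
Variables (R : realType) (n : nat).
Implicit Types (s t : seq (R[i] * 'rV[R]_n)) (nu phi psi : 'rV[R]_n).

(* A formal exponential sum is a list of (coefficient, exponent) pairs. *)
Definition ev s phi : R[i] := \sum_(p <- s) p.1 * expi (dot p.2 phi).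
Definition coef s nu : R[i] := \sum_(p <- s | p.2 == nu) p.1.
Definition esmul s t : seq (R[i] * 'rV[R]_n) :=
  [seq (p.1 * q.1, p.2 + q.2) | p <- s, q <- t].

Lemma big_esmul (V : nmodType) s t (F : R[i] * 'rV[R]_n -> V) :
  \sum_(x <- esmul s t) F x = \sum_(p <- s) \sum_(q <- t) F (p.1 * q.1, p.2 + q.2).
Proof. by rewrite /esmul big_allpairs_dep. Qed.

Lemma ev_mul s t phi : ev (esmul s t) phi = ev s phi * ev t phi.
Proof.
rewrite /ev big_esmul mulr_suml; apply: eq_bigr => p _.
rewrite mulr_sumr; apply: eq_bigr => q _ /=.
by rewrite dotDl expiD mulrACA.
Qed.

Lemma sum_coef s (F : 'rV[R]_n -> R[i]) :
  \sum_(p <- s) p.1 * F p.2 = \sum_(nu <- undup (map snd s)) coef s nu * F nu.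
Proof. exact: (sum_group s snd fst F). Qed.

Lemma coef_out s nu : nu \notin map snd s -> coef s nu = 0.
Proof.
move=> h; rewrite /coef big_seq_cond big1 // => p /andP[ps /eqP pn].
by move: h; rewrite -pn map_f.
Qed.

Lemma sum_coef_eq0 s (F : 'rV[R]_n -> R[i]) :
  (forall nu, coef s nu = 0) -> \sum_(p <- s) p.1 * F p.2 = 0.
Proof. by move=> h; rewrite sum_coef big1 // => nu _; rewrite h mul0r. Qed.

(** On the moment curve (1, x, x^2, ...) each functional [dot v] is a nonzero polynomial in x, so
    all but finitely many x will do. *)
Lemma generic_vector (vs : seq 'rV[R]_n) :
  (forall v, v \in vs -> v != 0) -> exists psi, forall v, v \in vs -> dot v psi != 0.
Proof.
move=> v0; pose pv (v : 'rV[R]_n) : {poly R} := \sum_(k < n) (v 0 k) *: 'X^k.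
have pvE (v : 'rV[R]_n) (k : nat) : (pv v)`_k = if insub k is Some j then v 0 j else 0.
  rewrite /pv coef_sum; case: insubP => [j jn jk|kn].
    rewrite (bigD1 j) //= coefZ coefXn jk eqxx mulr1 big1 ?addr0 // => l lj.
    by rewrite coefZ coefXn -jk val_eqE eq_sym (negbTE lj) mulr0.
  rewrite big1 // => l _; rewrite coefZ coefXn; case: eqP => [kl|]; rewrite ?mulr0 //.
  by rewrite kl ltn_ord in kn.
have pv0 (v : 'rV[R]_n) : v != 0 -> pv v != 0.
  apply: contraNneq => p0; apply/eqP/rowP => k; rewrite mxE.
  by have := pvE v k; rewrite p0 coef0 valK.
pose P := \prod_(v <- vs) pv v.
have P0 : P != 0 by rewrite prodf_seq_neq0; apply/allP => v vv /=; rewrite pv0 ?v0.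
have [x Px] : exists x, P.[x] != 0.
  apply: contrapT => nx.
  pose rs : seq R := [seq i%:R | i <- iota 0 (size P)].
  have urs : uniq rs by rewrite map_inj_uniq ?iota_uniq // => i j /eqP; rewrite eqr_nat => /eqP.
  have ars : all (root P) rs.
    apply/allP => y _; apply/rootP/eqP; apply: contrapT => /negP h; apply: nx; by exists y.
  by have := max_poly_roots P0 ars urs; rewrite size_map size_iota ltnn.
exists (\row_k x ^+ k) => v vv; move: Px; rewrite /P horner_prod prodf_seq_neq0.
move=> /allP /(_ v vv) /=; rewrite /pv horner_sum.
under eq_bigr do rewrite hornerZ hornerXn.
by congr (_ != _); apply: eq_bigr => k _; rewrite mxE.
Qed.

(** Vanishing away from the walls is enough: a generic line through 0 avoids them for small t > 0
    and separates [nu] from the other exponents, which reduces the claim to one variable. *)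
Lemma ev_independent (rts : seq 'rV[R]_n) s :
  (forall al, al \in rts -> al != 0) ->
  (forall phi, (forall al, al \in rts -> expi (dot al phi) != 1) -> ev s phi = 0) ->
  forall nu, coef s nu = 0.
Proof.
move=> r0 ev0 nu; have [nus|] := boolP (nu \in map snd s); last exact: coef_out.
pose diffs := [seq x - nu | x <- map snd s & x != nu].
have [psi psiP] : exists psi, forall v, v \in rts ++ diffs -> dot v psi != 0.
  apply: generic_vector => v; rewrite mem_cat => /orP[/r0//|/mapP[x]].
  by rewrite mem_filter => /andP[xn _] ->; rewrite subr_eq0.
pose c f : R[i] := \sum_(p <- s | dot p.2 psi == f) p.1.
have -> : coef s nu = c (dot nu psi).
  rewrite /coef /c [LHS]big_seq_cond [RHS]big_seq_cond; apply: eq_bigl => p.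
  case ps: (p \in s) => //=; apply/eqP/eqP => [->//|e].
  apply/eqP; apply: contrapT => /negP pn.
  have : p.2 - nu \in rts ++ diffs.
    rewrite mem_cat; apply/orP; right; apply/mapP; exists p.2 => //.
    by rewrite mem_filter pn (map_f snd).
  by move/psiP; rewrite dotBl e subrr eqxx.
apply: (@exp_sum_small_eq0 R (undup [seq dot p.2 psi | p <- s])); first exact: undup_uniq.
  move=> e e0; pose B : R := 1 + \sum_(al <- rts) `|dot al psi|.
  have B0 : 0 < B by rewrite ltr_pwDl // sumr_ge0.
  have p0 := @pi_gt0 R.
  exists (2 * pi / B) => [|t /andP[t0 tB]]; first by rewrite divr_gt0 // mulr_gt0.
  have -> : \sum_(f <- undup [seq dot p.2 psi | p <- s]) c f * expi (f * t) = ev s (t *: psi).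
    rewrite /ev (eq_bigr (fun p => p.1 * (fun f => expi (f * t)) (dot p.2 psi))).
      by rewrite (sum_group s (fun p => dot p.2 psi) fst (fun f => expi (f * t))).
    by move=> p _; rewrite dotZr [t * _]mulrC.
  rewrite ev0 ?Normc.normc0; first by rewrite mulr_ge0 ?exprn_ge0 // ltW.
  move=> al alr; apply: expi_neq1; rewrite dotZr normrM (gtr0_norm t0).
  have al0 : dot al psi != 0 by apply: psiP; rewrite mem_cat alr.
  rewrite mulr_gt0 ?normr_gt0 //=.
  rewrite ltr_pdivlMr // in tB; apply: le_lt_trans tB; rewrite ler_pM2l //.
  by rewrite /B (big_rem al) //= addrCA lerDl addr_ge0 // sumr_ge0.
by rewrite mem_undup; have /mapP[p ps ->] := nus; apply/mapP; exists p.
Qed.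

Lemma coef_ev_eq (rts : seq 'rV[R]_n) s t :
  (forall al, al \in rts -> al != 0) ->
  (forall phi, (forall al, al \in rts -> expi (dot al phi) != 1) -> ev s phi = ev t phi) ->
  coef s =1 coef t.
Proof.
move=> r0 st nu; pose u := s ++ [seq (- p.1, p.2) | p <- t].
have uc : coef u nu = coef s nu - coef t nu.
  by rewrite /coef /u big_cat big_map /= sumrN.
apply/eqP; rewrite -subr_eq0 -uc; apply/eqP.
apply: (ev_independent r0) => phi reg.
rewrite /ev /u big_cat big_map /=.
under [X in _ + X]eq_bigr do rewrite mulNr.
by rewrite sumrN; apply/eqP; rewrite subr_eq0; apply/eqP; exact: st.
Qed.

End ExponentialSums.

(** * The Weyl denominator *)

Section WeylDenominator.
Variables (R : realType) (n : nat).
Implicit Types (s t : seq (R[i] * 'rV[R]_n)) (nu phi v al x y : 'rV[R]_n).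

(* The derivative along v and minus the Laplacian of [ev s], up to a factor i in
   the first. *)
Definition evg v s phi : R[i] :=
  \sum_(p <- s) p.1 * (dot p.2 v)%:C * expi (dot p.2 phi).
Definition evl s phi : R[i] :=
  \sum_(p <- s) p.1 * (dot p.2 p.2)%:C * expi (dot p.2 phi).

Lemma evg_mul v s t phi :
  evg v (esmul s t) phi = evg v s phi * ev t phi + ev s phi * evg v t phi.
Proof.
rewrite /evg /ev big_esmul !mulr_suml -big_split /=; apply: eq_bigr => p _.
rewrite !mulr_sumr -big_split; apply: eq_bigr => q _ /=.
by rewrite !dotDl expiD rmorphD; ring.
Qed.

Lemma evl_mul s t phi :
  evl (esmul s t) phi = evl s phi * ev t phi + ev s phi * evl t phi +
    2 * \sum_(q <- t) q.1 * expi (dot q.2 phi) * evg q.2 s phi.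
Proof.
rewrite mulr_sumr; under [X in _ + X]eq_bigr do rewrite mulr_sumr mulr_sumr.
rewrite [X in _ + X]exchange_big /=.
rewrite /evl /ev big_esmul !mulr_suml -!big_split /=; apply: eq_bigr => p _.
rewrite !mulr_sumr -!big_split; apply: eq_bigr => q _ /=.
by rewrite !dotDl !dotDr expiD !rmorphD (dot_sym q.2 p.2); ring.
Qed.

Definition root_factor al : seq (R[i] * 'rV[R]_n) :=
  [:: (1, 2^-1 *: al); (-1, - (2^-1 *: al))].
Definition denominator (rts : seq 'rV[R]_n) : seq (R[i] * 'rV[R]_n) :=
  foldr (fun al s => esmul (root_factor al) s) [:: (1, 0)] rts.

Lemma ev_root_factor al phi :
  ev (root_factor al) phi = expi (dot al phi / 2) - expi (- (dot al phi / 2)).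
Proof.
by rewrite /ev !big_cons big_nil /= dotNl dotZl mul1r mulN1r addr0 mulrC.
Qed.

Lemma ev_denominator rts phi :
  ev (denominator rts) phi =
  \prod_(al <- rts) (expi (dot al phi / 2) - expi (- (dot al phi / 2))).
Proof.
elim: rts => [|al rts IH].
  by rewrite big_nil /ev big_seq1 /= dot0l expi0 mulr1.
by rewrite big_cons /= ev_mul ev_root_factor IH.
Qed.

Lemma root_factor_neq0 al phi : expi (dot al phi) != 1 ->
  expi (dot al phi / 2) - expi (- (dot al phi / 2)) != 0.
Proof.
apply: contraNneq => /eqP; rewrite subr_eq0 => /eqP e.
have -> : dot al phi = dot al phi / 2 + dot al phi / 2 by lra.
by rewrite expiD {1}e -expiD addNr expi0.
Qed.

Lemma ev_denominator_neq0 rts phi :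
  (forall al, al \in rts -> expi (dot al phi) != 1) -> ev (denominator rts) phi != 0.
Proof.
move=> h; rewrite ev_denominator prodf_seq_neq0; apply/allP => al alr /=.
exact/root_factor_neq0/h.
Qed.

(** The logarithmic derivative of the denominator. Its terms are half the first-order coefficients
    of the Casimir equation, which is why multiplying the character by the denominator removes the
    first-order part. *)
Lemma evg_denominator v rts phi :
  (forall al, al \in rts -> expi (dot al phi) != 1) ->
  evg v (denominator rts) phi = ev (denominator rts) phi *
   \sum_(al <- rts) (dot al v)%:C / 2 * ((expi (dot al phi) + 1) / (expi (dot al phi) - 1)).
Proof.
elim: rts => [|al rts IH] h.
  by rewrite big_nil /evg big_seq1 /= dot0l rmorph0 mulr0 mul0r mulr0.
rewrite big_cons /= evg_mul ev_mul IH; last by move=> b br; apply: h; rewrite inE br orbT.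
have h1 := h al (mem_head _ _).
set S := \sum_(j <- rts) _; set A := ev (denominator rts) phi.
suff -> : evg v (root_factor al) phi = ev (root_factor al) phi *
    ((dot al v)%:C / 2 * ((expi (dot al phi) + 1) / (expi (dot al phi) - 1))) by ring.
rewrite ev_root_factor /evg !big_cons big_nil /= addr0 !dotNl !dotZl rmorphN rmorphM.
rewrite [2^-1 * dot al phi]mulrC.
have E2 : expi (dot al phi) = expi (dot al phi / 2) * expi (dot al phi / 2).
  by rewrite -expiD; congr expi; lra.
rewrite E2 in h1 *; rewrite expiN; have e0 := expi_neq0 (dot al phi / 2).
set e := expi _ in e0 h1 *.
have h2 : e * e - 1 != 0 by rewrite subr_eq0.
rewrite !fmorphV !rmorph_nat.
by field; rewrite e0 h2.
Qed.

(** The partial sums of a vector are its coefficients on the simple roots of B_n, so [lev] is the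
    usual order on weights with real nonnegative coefficients allowed. *)
Definition psum x (i : 'I_n) : R := \sum_(j < n | (j <= i)%N) x 0 j.
Definition lev x y := forall i, psum x i <= psum y i.

Lemma psumD x y i : psum (x + y) i = psum x i + psum y i.
Proof. by rewrite -big_split; apply: eq_bigr => j _; rewrite mxE. Qed.

Lemma psumN x i : psum (- x) i = - psum x i.
Proof. by rewrite -sumrN; apply: eq_bigr => j _; rewrite mxE. Qed.

Lemma psumZ c x i : psum (c *: x) i = c * psum x i.
Proof. by rewrite mulr_sumr; apply: eq_bigr => j _; rewrite mxE. Qed.

Lemma psum_delta k i : psum (delta_mx 0 k) i = (k <= i)%N%:R.
Proof.
rewrite /psum big_mkcond (bigD1 k) //= mxE !eqxx big1 ?addr0.
  by case: (k <= i)%N.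
by move=> j /negbTE jk; rewrite mxE jk andbF; case: ifP.
Qed.

Lemma psum_inj x y : psum x =1 psum y -> x = y.
Proof.
move=> h; apply/rowP => k.
have [j] := ubnP (k : nat); elim: j k => // j IH k; rewrite ltnS => kj.
have := h k; rewrite /psum !(bigD1 (P := fun l : 'I_n => (l <= k)%N) k) //=.
have -> : \sum_(l < n | (l <= k)%N && (l != k)) x 0 l =
          \sum_(l < n | (l <= k)%N && (l != k)) y 0 l.
  apply: eq_bigr => l /andP[lk nlk]; apply: IH; apply: leq_trans kj.
  by rewrite ltn_neqAle nlk.
by move/addIr.
Qed.

Lemma lev_anti x y : lev x y -> lev y x -> x = y.
Proof. by move=> h h'; apply: psum_inj => i; apply/eqP; rewrite eq_le h h'. Qed.

Lemma levD x y x' y' : lev x y -> lev x' y' -> lev (x + x') (y + y').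
Proof. by move=> h h' i; rewrite !psumD lerD. Qed.

Lemma lev_refl x : lev x x. Proof. by move=> i. Qed.

Lemma lev_esmul s t x y : (forall p, p \in s -> lev p.2 x) ->
  (forall q, q \in t -> lev q.2 y) -> forall p, p \in esmul s t -> lev p.2 (x + y).
Proof.
by move=> hs ht p /allpairsP [[u v] /= [us vt ->]]; apply: levD; [exact: hs | exact: ht].
Qed.

(** Since the order is antisymmetric and compatible with addition, x + y arises only from the two
    top exponents. *)
Lemma coef_esmul_top s t x y : (forall p, p \in s -> lev p.2 x) ->
  (forall q, q \in t -> lev q.2 y) -> coef (esmul s t) (x + y) = coef s x * coef t y.
Proof.
move=> hs ht; rewrite /coef big_mkcond big_esmul /= mulr_suml [RHS]big_mkcond /=.
rewrite big_seq [RHS]big_seq; apply: eq_bigr => p ps.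
have [px|px] := eqVneq p.2 x.
  rewrite mulr_sumr [RHS]big_mkcond /=; apply: eq_bigr => q _.
  by rewrite px (inj_eq (addrI x)).
rewrite big_seq big1 // => q qt; case: eqP => // e.
case/eqP: px; apply: lev_anti; first exact: hs.
move=> i; have := ht q qt i; have := congr1 (psum^~ i) e; rewrite !psumD; lra.
Qed.

Definition half_sum (rts : seq 'rV[R]_n) : 'rV[R]_n := \sum_(al <- rts) 2^-1 *: al.

Lemma denominator_lev rts : (forall al, al \in rts -> lev 0 al) ->
  forall p, p \in denominator rts -> lev p.2 (half_sum rts).
Proof.
rewrite /half_sum; elim: rts => [|al rts IH] h p.
  by rewrite big_nil inE => /eqP -> /=; exact: lev_refl.
rewrite big_cons; apply: lev_esmul => q; last first.
  by apply: IH => b br; apply: h; rewrite inE br orbT.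
have al0 := h al (mem_head _ _).
rewrite !inE => /orP[] /eqP -> //= i.
have := al0 i; rewrite psumN !psumZ /psum.
under eq_bigr do rewrite mxE.
rewrite big1 //; lra.
Qed.

Lemma coef_denominator_top rts : (forall al, al \in rts -> lev 0 al) ->
  (forall al, al \in rts -> al != 0) ->
  coef (denominator rts) (half_sum rts) = 1.
Proof.
rewrite /half_sum; elim: rts => [|al rts IH] h h0.
  by rewrite big_nil /coef big_cons big_nil eqxx addr0.
have h' b : b \in rts -> lev 0 b by move=> br; apply: h; rewrite inE br orbT.
rewrite big_cons coef_esmul_top; last exact: denominator_lev.
  rewrite IH //; last by move=> b br; apply: h0; rewrite inE br orbT.
  rewrite /coef !big_cons big_nil /= eqxx mulr1.
  case: eqP => [e|_]; last by rewrite addr0.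
  have al0 := h0 al (mem_head _ _); case/eqP: al0; apply/rowP => k.
  by have := congr1 (fun x : 'rV[R]_n => x 0 k) e; rewrite !mxE; lra.
move=> p pf; have := @denominator_lev [:: al].
rewrite /half_sum big_seq1 => /(_ _ p); apply.
  by move=> b; rewrite inE => /eqP ->; apply: h; rewrite mem_head.
move: pf; rewrite !inE /= => /orP[] /eqP -> /=; rewrite !mulr1 !addr0 eqxx ?orbT //.
Qed.

End WeylDenominator.

(** * The denominator as a determinant and its symmetries *)

Section WeylDeterminant.
Variables (R : realType) (n : nat).
Implicit Types (phi : 'rV[R]_n).

Lemma pos_rootsP (al : 'rV[R]_n) : al \in pos_roots R n ->
  (exists k, al = delta_mx 0 k) \/ (exists k l : 'I_n, (k < l)%N /\
     (al = delta_mx 0 k - delta_mx 0 l \/ al = delta_mx 0 k + delta_mx 0 l)).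
Proof.
rewrite /pos_roots !mem_cat => /or3P[/mapP[k _ ->]|/mapP[[k l]]|/mapP[[k l]]].
- by left; exists k.
- by rewrite mem_pos_pairs => kl ->; right; exists k, l; split; [|left].
- by rewrite mem_pos_pairs => kl ->; right; exists k, l; split; [|right].
Qed.

Lemma pos_roots_neq0 (al : 'rV[R]_n) : al \in pos_roots R n -> al != 0.
Proof.
move=> /pos_rootsP[[k ->]|[k [l [kl h]]]]; apply/eqP.
  by move/rowP/(_ k); rewrite !mxE !eqxx /=; apply/eqP; exact: oner_neq0.
have kl' : (k == l) = false by rewrite -val_eqE /= ltn_eqF.
move=> al0; have : al 0 k = 1 by case: h => ->; rewrite !mxE !eqxx kl' /= ?subr0 ?addr0.
by rewrite al0 mxE => /esym /eqP; rewrite oner_eq0.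
Qed.

Lemma pos_roots_lev (al : 'rV[R]_n) : al \in pos_roots R n -> lev 0 al.
Proof.
have p0 i : psum (0 : 'rV[R]_n) i = 0 by rewrite -(scale0r 0) psumZ mul0r.
move=> /pos_rootsP[[k ->]|[k [l [kl [->|->]]]]] i; rewrite p0 ?psumD ?psumN !psum_delta.
- exact: ler0n.
- rewrite subr_ge0 ler_nat; case: (leqP l i) => // li.
  by rewrite (leq_trans (ltnW kl) li).
- by rewrite addr_ge0.
Qed.

Definition weyl_vector : 'rV[R]_n := \row_k ((n - k)%:R - 2^-1).

Lemma half_sum_pos_roots : half_sum (pos_roots R n) = weyl_vector.
Proof.
apply/rowP => k; rewrite /half_sum big_pos_roots /= !mxE !summxE.
rewrite (eq_bigr (fun l => (l == k)%:R / 2)); last first.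
  by move=> l _; rewrite !mxE /= eq_sym mulrC.
rewrite (bigD1 k) //= eqxx [X in _ + X + _]big1 ?addr0; last first.
  by move=> l /negbTE ->; rewrite mul0r.
rewrite (eq_bigr (fun x => (x.1 == k)%:R)); last first.
  by move=> x _; rewrite !mxE /= !(eq_sym k); lra.
rewrite /pos_pairs big_filter big_enum_cond /=.
rewrite -(pair_big_dep predT (fun k l : 'I_n => (k < l)%N) (fun x y => (x == k)%:R)) /=.
rewrite (bigD1 k) //= [X in _ + (_ + X)]big1 ?addr0; last first.
  by move=> l /negbTE ->; rewrite big1.
rewrite eqxx sumr_const.
have -> : #|[pred l : 'I_n | (k < l)%N]| = (n - k.+1)%N.
  rewrite -sum1_card -(big_mkord (fun l => (k < l)%N) (fun=> 1%N)).
  rewrite (big_cat_nat (n := k.+1)) //= big_nat_cond big1 ?add0n; last first.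
    by move=> l /andP[/andP[_ lk]]; rewrite ltnNge -ltnS lk.
  rewrite big_nat_cond (eq_bigl (fun l => (k.+1 <= l < n)%N)).
    by rewrite -big_nat sum_nat_const_nat muln1.
  by move=> l; case: (k < l)%N; rewrite ?andbF ?andbT.
rewrite natrB // natrB; last by rewrite ltnW.
rewrite -[X in _ - X]natr1; lra.
Qed.

Definition antisym_mx phi : 'M[R[i]]_n :=
  \matrix_(i, k) (expi ((i%:R + 2^-1) * phi 0 k) - expi (- ((i%:R + 2^-1) * phi 0 k))).

(** Chebyshev polynomials of the fourth kind in the variable 2 cos x, that is sin((i + 1/2) x) /
    sin(x/2). Two consecutive ones are carried along because the recurrence has order two. *)
Fixpoint qpair (i : nat) : {poly R[i]} * {poly R[i]} :=
  if i is j.+1 then let p := qpair j in (p.2, 'X * p.2 - p.1) else (1, 'X + 1).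
Definition qpoly i := (qpair i).1.

Lemma qpolySS i : qpoly i.+2 = 'X * qpoly i.+1 - qpoly i.
Proof. by []. Qed.

Lemma qpoly_monic i : size (qpoly i) = i.+1 /\ qpoly i \is monic.
Proof.
suff : (size (qpoly i) = i.+1 /\ qpoly i \is monic) /\
       (size (qpoly i.+1) = i.+2 /\ qpoly i.+1 \is monic) by case.
elim: i => [|i [IH1 [s2 m2]]].
  rewrite /qpoly /=; split; split; rewrite ?size_poly1 ?monic1 //.
    by rewrite size_addl ?size_polyX ?size_poly1.
  by rewrite -[1]opprK -polyCN monicXsubC.
split=> //; rewrite qpolySS.
have s3 : size ('X * qpoly i.+1) = i.+3 by rewrite mulrC size_mulX ?s2 // -size_poly_eq0 s2.
have lt : (size (- qpoly i) < size ('X * qpoly i.+1)%R)%N by rewrite size_opp IH1.1 s3.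
split; first by rewrite size_addl // s3.
by rewrite monicE lead_coefDl // lead_coefM lead_coefX mul1r -monicE.
Qed.

Lemma qpoly_eval i (x : R) :
  (expi (x / 2) - expi (- (x / 2))) * (qpoly i).[expi x + expi (- x)] =
  expi ((i%:R + 2^-1) * x) - expi (- ((i%:R + 2^-1) * x)).
Proof.
set u := expi (x / 2) - _; set z := expi x + _.
suff : u * (qpoly i).[z] = expi ((i%:R + 2^-1) * x) - expi (- ((i%:R + 2^-1) * x)) /\
  u * (qpoly i.+1).[z] = expi ((i.+1%:R + 2^-1) * x) - expi (- ((i.+1%:R + 2^-1) * x)) by case.
elim: i => [|i [IH1 IH2]].
  rewrite /qpoly /= !hornerE; split; first by rewrite mulrC.
  have -> : (1 + 2^-1) * x = x / 2 + x by lra.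
  rewrite /u /z opprD !expiD.
  have e1 : expi x = expi (x / 2) * expi (x / 2) by rewrite -expiD; congr expi; lra.
  rewrite !expiN e1; have e0 := expi_neq0 (x / 2); field; exact: e0.
split=> //; rewrite qpolySS !hornerE mulrBr mulrCA IH1 IH2.
have -> : (i.+2%:R + 2^-1) * x = (i.+1%:R + 2^-1) * x + x.
    have e : i.+2%:R = i.+1%:R + 1 :> R by rewrite natr1.
    by rewrite e; ring.
have -> : (i%:R + 2^-1) * x = (i.+1%:R + 2^-1) * x - x.
    have e : i.+1%:R = i%:R + 1 :> R by rewrite natr1.
    by rewrite e; ring.
move: ((i.+1%:R + 2^-1) * x) => y.
by rewrite /z !opprD opprK !expiD !expiN invrK; ring.
Qed.

(** Dividing column k by 2i sin(phi_k / 2) leaves values at 2 cos phi_k of monic polynomials of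
    degrees 0, ..., n-1: a unitriangular matrix times a Vandermonde matrix. *)
Lemma det_antisym phi : \det (antisym_mx phi) =
  \prod_k (expi (phi 0 k / 2) - expi (- (phi 0 k / 2))) *
  \prod_(x <- pos_pairs n) ((expi (phi 0 x.2) + expi (- phi 0 x.2)) -
                            (expi (phi 0 x.1) + expi (- phi 0 x.1))).
Proof.
pose z := \row_k (expi (phi 0 k) + expi (- phi 0 k)).
pose u := \row_k (expi (phi 0 k / 2) - expi (- (phi 0 k / 2))).
pose C : 'M[R[i]]_n := \matrix_(i, j) (qpoly i)`_j.
have -> : antisym_mx phi = C *m Vandermonde n z *m diag_mx u.
  apply/matrixP => i k; rewrite mul_mx_diag !mxE -qpoly_eval mulrC; congr (_ * _).
  rewrite (@horner_coef_wide _ n); last by rewrite (qpoly_monic i).1.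
  by apply: eq_bigr => j _; rewrite !mxE.
rewrite !det_mulmx det_diag det_Vandermonde det_trig; last first.
  apply/is_trig_mxP => i j ij; rewrite mxE nth_default // (qpoly_monic i).1 //.
rewrite big1 ?mul1r; last first.
  move=> i _; rewrite mxE; have [s1 m1] := qpoly_monic i.
  by have := monicP m1; rewrite lead_coefE s1.
rewrite mulrC; congr (_ * _); first by apply: eq_bigr => k _; rewrite mxE.
rewrite /pos_pairs big_filter big_enum_cond /= pair_big_dep /=.
by apply: eq_bigr => x _; rewrite !mxE.
Qed.

(** The factors of e_k - e_l and e_k + e_l multiply to 2 cos phi_k - 2 cos phi_l, the opposite of a
    Vandermonde factor, whence one sign for each pair. *)
Lemma ev_denominator_det phi : ev (denominator (pos_roots R n)) phi =
  (-1) ^+ size (pos_pairs n) * \det (antisym_mx phi).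
Proof.
rewrite ev_denominator big_pos_roots /= det_antisym mulrCA; congr (_ * _).
  by apply: eq_bigr => k _; rewrite dot_delta.
have -> : (-1) ^+ size (pos_pairs n) = \prod_(x <- pos_pairs n) (-1 : R[i]).
  by rewrite big_const_seq count_predT iter_mulr_1.
rewrite -big_split /=; apply: eq_bigr => x _.
rewrite dotBl dotDl !dot_delta mulN1r opprB.
move: (phi 0 x.1) (phi 0 x.2) => a b.
have half (y : R) : expi y = expi (y / 2) * expi (y / 2) by rewrite -expiD; congr expi; lra.
rewrite (half a) (half b) (half (- a)) (half (- b)) !mulNr !mulrDl mulNr !opprD opprK !expiD !expiN.
have a0 := expi_neq0 (a / 2); have b0 := expi_neq0 (b / 2).
by field; rewrite a0 b0.
Qed.

End WeylDeterminant.

Section DenominatorSymmetry.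
Variables (R : realType) (n : nat).
Implicit Types (s t : seq (R[i] * 'rV[R]_n)) (phi nu x y : 'rV[R]_n).

Lemma eq_coef_sum s t (F : 'rV[R]_n -> R[i]) : coef s =1 coef t ->
  \sum_(p <- s) p.1 * F p.2 = \sum_(p <- t) p.1 * F p.2.
Proof.
move=> st; pose u := s ++ [seq (- p.1, p.2) | p <- t].
have E : \sum_(p <- u) p.1 * F p.2 = \sum_(p <- s) p.1 * F p.2 - \sum_(p <- t) p.1 * F p.2.
  rewrite big_cat big_map -sumrN; congr (_ + _).
  by apply: eq_bigr => p _; rewrite mulNr.
apply/eqP; rewrite -subr_eq0 -E; apply/eqP/sum_coef_eq0 => nu.
have h : coef u nu = coef s nu - coef t nu by rewrite /coef big_cat big_map sumrN.
by rewrite h st subrr.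
Qed.

(** The term of s in the determinant takes the entries (i, s i), so phi_k comes with the row s^-1 k;
    [f] chooses one of the two exponentials in each entry. *)
Definition det_exponent (s : {perm 'I_n}) (f : {ffun 'I_n -> bool}) : 'rV[R]_n :=
  \row_k (sgb R (f ((s^-1)%g k)) * (((s^-1)%g k)%:R + 2^-1)).

Definition det_terms : seq (R[i] * 'rV[R]_n) :=
  [seq ((-1) ^+ g * \prod_i (sgb R (f i))%:C, det_exponent g f)
    | g : {perm 'I_n} <- enum {: {perm 'I_n}}, f : {ffun 'I_n -> bool} <- enum {: {ffun 'I_n -> bool}}].

Lemma ev_det_terms phi : ev det_terms phi = \det (antisym_mx phi).
Proof.
rewrite /ev /det_terms big_allpairs_dep /= big_enum /=.
apply: eq_bigr => s _; rewrite big_enum /=.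
have E i : antisym_mx phi i (s i) = \sum_(b : bool)
    (sgb R b)%:C * expi (sgb R b * ((i%:R + 2^-1) * phi 0 (s i))).
  by rewrite big_bool /= mxE /sgb rmorphN rmorph1 !mul1r !mulN1r.
under [in RHS]eq_bigr do rewrite E.
rewrite bigA_distr_bigA /= mulr_sumr; apply: eq_bigr => f _.
rewrite -mulrA big_split /=; congr (_ * (_ * _)).
rewrite -expi_sum; congr expi; rewrite /dot (reindex_inj (@perm_inj _ s)) /=.
by apply: eq_bigr => i _; rewrite mxE permK mulrA.
Qed.

Definition weyl_norm : R := \sum_(i < n) (i%:R + 2^-1) ^+ 2.

Lemma det_terms_norm p : p \in det_terms -> dot p.2 p.2 = weyl_norm.
Proof.
move=> /allpairsP [[s f] /= [_ _ ->]] /=; rewrite /dot /weyl_norm.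
rewrite (reindex_inj (@perm_inj _ s)) /=; apply: eq_bigr => i _.
by rewrite !mxE permK mulrACA sgb_sq mul1r expr2.
Qed.

(** The determinant expansion has only signed permutations of (1/2, ..., n - 1/2) as exponents, all
    of one length. Since the product form has the same coefficients, the denominator is a Laplace
    eigenfunction. *)
Lemma evl_denominator phi :
  evl (denominator (pos_roots R n)) phi = weyl_norm%:C * ev (denominator (pos_roots R n)) phi.
Proof.
pose sg : R[i] := (-1) ^+ size (pos_pairs n).
pose t := [seq (sg * p.1, p.2) | p <- det_terms].
have evt psi : ev t psi = sg * \det (antisym_mx psi).
  rewrite -ev_det_terms /ev big_map mulr_sumr; apply: eq_bigr => p _.
  by rewrite mulrA.
have ct : coef (denominator (pos_roots R n)) =1 coef t.
  apply: (@coef_ev_eq _ _ [::]) => // psi _.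
  by rewrite evt ev_denominator_det.
have /= e := eq_coef_sum (fun x => (dot x x)%:C * expi (dot x phi)) ct.
rewrite /evl; under eq_bigr do rewrite -mulrA.
rewrite e.
rewrite ev_denominator_det -evt /ev mulr_sumr big_seq [RHS]big_seq.
apply: eq_bigr => p /mapP [q qd ->] /=.
by rewrite (det_terms_norm qd); ring.
Qed.

Lemma xcolK (k l : 'I_n) : involutive (xcol k l : 'rV[R]_n -> 'rV[R]_n).
Proof. by move=> x; apply/rowP => i; rewrite !mxE tpermK. Qed.

Lemma dot_xcol k l x y : dot (xcol k l x) y = dot x (xcol k l y).
Proof.
rewrite /dot (reindex_inj (@perm_inj _ (tperm k l))) /=.
by apply: eq_bigr => i _; rewrite !mxE tpermK.
Qed.

Lemma flipK (k : 'I_n) : involutive (@flip R n k).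
Proof.
by move=> x; apply/rowP => i; rewrite !mxE; case: ifP => _; ring.
Qed.

Lemma dot_flip k x y : dot (flip k x) y = dot x (flip k y).
Proof. by apply: eq_bigr => i _; rewrite !mxE; ring. Qed.

Lemma denominator_xcol k l phi : k != l ->
  ev (denominator (pos_roots R n)) (xcol k l phi) = - ev (denominator (pos_roots R n)) phi.
Proof.
move=> kl; rewrite !ev_denominator_det -mulrN; congr (_ * _).
have -> : antisym_mx (xcol k l phi) = antisym_mx phi *m perm_mx (tperm k l).
  rewrite -[tperm k l]invgK -col_permE tpermV; apply/matrixP => i j.
  by rewrite !mxE.
by rewrite det_mulmx det_perm odd_tperm kl expr1 mulrN1.
Qed.

Lemma denominator_flip k phi :
  ev (denominator (pos_roots R n)) (flip k phi) = - ev (denominator (pos_roots R n)) phi.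
Proof.
rewrite !ev_denominator_det -mulrN; congr (_ * _).
have -> : antisym_mx (flip k phi) = antisym_mx phi *m
    diag_mx (\row_i (if i == k then -1 else 1)).
  apply/matrixP => i j; rewrite mul_mx_diag !mxE.
  by case: ifP => _; rewrite ?mulN1r ?mul1r ?mulr1 // mulrN opprK mulrN1 opprB.
rewrite det_mulmx det_diag (bigD1 k) //= !mxE eqxx big1 ?mulr1 ?mulrN1 //.
by move=> i /negbTE ik; rewrite mxE ik.
Qed.

Lemma coef_antisym (g : 'rV[R]_n -> 'rV[R]_n) s :
  involutive g -> (forall x y, dot (g x) y = dot x (g y)) ->
  (forall phi, ev s (g phi) = - ev s phi) -> forall nu, coef s (g nu) = - coef s nu.
Proof.
move=> gK gd evg nu.
pose t := [seq (- p.1, g p.2) | p <- s].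
have -> : coef s (g nu) = coef t (g nu).
  apply: (@coef_ev_eq _ _ [::]) => // phi _.
  rewrite -[RHS]opprK -[LHS]opprK -evg; congr (- _).
  rewrite /ev big_map -sumrN; apply: eq_bigr => p _ /=.
  by rewrite mulNr opprK gd.
rewrite /coef big_map /= -sumrN; apply: eq_bigl => p.
by rewrite (inj_eq (can_inj gK)).
Qed.

End DenominatorSymmetry.

(** * The exponents of the numerator *)

Lemma seq_argmax (R : realType) (T : eqType) (f : T -> R) (P : T -> Prop) (r : seq T) :
  (exists2 x, x \in r & P x) ->
  exists x, [/\ x \in r, P x & forall y, y \in r -> P y -> f y <= f x].
Proof.
elim: r => [|z r IH] [x]; first by rewrite in_nil.
have [hex|hnex] := pselect (exists2 x, x \in r & P x).
  have [y [yr Py ymax]] := IH hex => _ _.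
  have [Pz|nPz] := pselect (P z); last first.
    exists y; split=> // [|t]; first by rewrite inE yr orbT.
    by rewrite inE => /orP[/eqP ->|/ymax].
  have [fz|fz] := leP (f z) (f y).
    exists y; split=> // [|t]; first by rewrite inE yr orbT.
    by rewrite inE => /orP[/eqP ->|/ymax].
  exists z; split=> // [|t]; first exact: mem_head.
  rewrite inE => /orP[/eqP ->//|tr Pt]; exact: le_trans (ymax _ tr Pt) (ltW fz).
rewrite inE => /orP[/eqP -> Pz|xr Px]; last by case: hnex; exists x.
exists z; split=> // [|t]; first exact: mem_head.
by rewrite inE => /orP[/eqP ->//|tr Pt]; case: hnex; exists t.
Qed.

Lemma abel_summation (R : comPzRingType) (d s : nat -> R) m :
  \sum_(i < m.+1) d i * s i =
  (\sum_(j < m.+1) d j) * s m + \sum_(i < m) (\sum_(j < i.+1) d j) * (s i - s i.+1).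
Proof.
elim: m => [|m IH]; first by rewrite !big_ord_recr !big_ord0 /= !add0r addr0.
rewrite big_ord_recr /= IH [in RHS]big_ord_recr /= [X in _ = _ + X]big_ord_recr /=.
ring.
Qed.

Section Support.
Variables (R : realType) (n d : nat) (wv : 'I_d -> 'rV[R]_n) (lam : 'rV[R]_n).
Implicit Types (phi nu x y : 'rV[R]_n).

Definition chi_terms : seq (R[i] * 'rV[R]_n) := [seq (1, wv j) | j <- enum 'I_d].

Lemma ev_chi phi : ev chi_terms phi = \sum_j expi (dot (wv j) phi).
Proof.
by rewrite /ev /chi_terms big_map big_enum /=; apply: eq_bigr => j _; rewrite mul1r.
Qed.

Local Notation D := (denominator (pos_roots R n)).
Local Notation mu := (lam + weyl_vector R n).
Definition numerator := esmul D chi_terms.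

Hypothesis chi_xcol : forall k l phi, ev chi_terms (xcol k l phi) = ev chi_terms phi.
Hypothesis chi_flip : forall k phi, ev chi_terms (flip k phi) = ev chi_terms phi.
Variable z : R[i].
Hypothesis chi_casimir : forall phi, regular phi ->
  z * ev chi_terms phi =
  \sum_j (dot (wv j) (wv j))%:C * expi (dot (wv j) phi) +
  \sum_(al <- pos_roots R n) (expi (dot al phi) + 1) / (expi (dot al phi) - 1) *
     \sum_j (dot al (wv j))%:C * expi (dot (wv j) phi).
Hypothesis wv_lev : forall j, lev (wv j) lam.
Hypothesis wv_lam : exists j, wv j = lam.
Hypothesis lam_dec : forall k l : 'I_n, (k <= l)%N -> lam 0 l <= lam 0 k.
Hypothesis lam_ge0 : forall k, 0 <= lam 0 k.

(** In the Leibniz rule for the Laplacian of D chi, the cross term 2 grad D . grad chi is D times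
    the first-order part of the Casimir equation, so only eigenvalues remain. *)
Lemma evl_numerator phi : regular phi ->
  evl numerator phi = (z + (weyl_norm R n)%:C) * ev numerator phi.
Proof.
move=> reg; rewrite /numerator evl_mul ev_mul evl_denominator.
have -> : \sum_(q <- chi_terms) q.1 * expi (dot q.2 phi) * evg q.2 D phi =
   ev D phi * (\sum_(al <- pos_roots R n) (expi (dot al phi) + 1) / (expi (dot al phi) - 1) *
     \sum_j (dot al (wv j))%:C * expi (dot (wv j) phi)) / 2.
  rewrite /chi_terms big_map big_enum /=.
  under eq_bigr do rewrite mul1r evg_denominator // mulrCA mulr_sumr.
  rewrite -mulr_sumr -mulrA; congr (_ * _); rewrite exchange_big mulr_suml /=.
  apply: eq_bigr => al _; rewrite -mulrA mulr_suml mulr_sumr; apply: eq_bigr => j _.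
  ring.
have -> : evl chi_terms phi = \sum_j (dot (wv j) (wv j))%:C * expi (dot (wv j) phi).
  by rewrite /evl /chi_terms big_map big_enum /=; apply: eq_bigr => j _; rewrite mul1r.
have := chi_casimir reg; set A := \sum_j _; set B := \sum_(al <- _) _ => e.
move: e; set c := ev chi_terms phi; set dd := ev D phi => e.
have e' : z * (dd * c) = dd * (A + B) by rewrite -e; ring.
by rewrite [RHS]mulrDl e'; field.
Qed.

Lemma numerator_norm nu : coef numerator nu != 0 ->
  (dot nu nu)%:C = z + (weyl_norm R n)%:C.
Proof.
set K := z + _ => nu0.
pose t := [seq (p.1 * ((dot p.2 p.2)%:C - K), p.2) | p <- numerator].
have tc : coef t nu = coef numerator nu * ((dot nu nu)%:C - K).
  by rewrite /coef /t big_map /= mulr_suml; apply: eq_bigr => p /eqP ->.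
have : coef t nu = 0.
  apply: (@ev_independent _ _ (pos_roots R n)); first exact: pos_roots_neq0.
  move=> phi reg.
  have -> : ev t phi = evl numerator phi - K * ev numerator phi.
    rewrite /ev /t big_map /= mulr_sumr -sumrB; apply: eq_bigr => p _; ring.
  by rewrite evl_numerator // subrr.
by move/eqP; rewrite tc mulf_eq0 (negbTE nu0) subr_eq0 => /eqP.
Qed.

Lemma numerator_lev p : p \in numerator -> lev p.2 mu.
Proof.
rewrite addrC -half_sum_pos_roots; apply: lev_esmul.
  exact: (denominator_lev (@pos_roots_lev R n)).
by move=> q /mapP[j _ ->] /=.
Qed.

Lemma numerator_top : coef numerator mu != 0.
Proof.
rewrite addrC -half_sum_pos_roots coef_esmul_top; last 2 first.
- exact: (denominator_lev (@pos_roots_lev R n)).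
- by move=> q /mapP[j _ ->] /=.
rewrite coef_denominator_top ?mul1r; last 2 first.
- exact: pos_roots_lev.
- exact: pos_roots_neq0.
rewrite /coef /chi_terms big_map big_enum_cond /= sumr_const pnatr_eq0.
have [j wj] := wv_lam.
rewrite -lt0n; apply/card_gt0P; exists j.
by have h : wv j == lam by [apply/eqP]; exact: h.
Qed.

Lemma numerator_xcol k l nu : k != l -> coef numerator (xcol k l nu) = - coef numerator nu.
Proof.
move=> kl; apply: coef_antisym; [exact: xcolK | exact: dot_xcol | move=> phi].
by rewrite /numerator !ev_mul chi_xcol denominator_xcol // mulNr.
Qed.

Lemma numerator_flip k nu : coef numerator (flip k nu) = - coef numerator nu.
Proof.
apply: coef_antisym; [exact: flipK | exact: dot_flip | move=> phi].
by rewrite /numerator !ev_mul chi_flip denominator_flip mulNr.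
Qed.

Lemma mu_dec (k l : 'I_n) : (k < l)%N -> mu 0 l < mu 0 k.
Proof.
move=> kl; rewrite !mxE; apply: ler_ltD; first exact/lam_dec/ltnW.
by rewrite ltrD2r ltr_nat; have := ltn_ord l; lia.
Qed.

Lemma mu_gt0 k : 0 < mu 0 k.
Proof.
rewrite !mxE; apply: ltr_wpDl; first exact: lam_ge0.
have : (1%:R : R) <= (n - k)%:R by rewrite ler_nat subn_gt0.
lra.
Qed.

(** The difference |mu|^2 - |nu|^2 is the sum of (mu - nu)_i (mu + nu)_i. After Abel summation it is
    a combination of the partial sums of mu - nu, which are nonnegative, with strictly positive
    coefficients because mu + nu is strictly decreasing and positive. All partial sums are therefore
    0. *)
Lemma dominant_norm_eq nu :
  (forall k l : 'I_n, (k < l)%N -> nu 0 l <= nu 0 k) -> (forall k, 0 <= nu 0 k) ->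
  lev nu mu -> dot nu nu = dot mu mu -> nu = mu.
Proof.
move: mu mu_dec mu_gt0 => m mdec mgt0 nd n0 nm nn.
case: (n) m nu mdec mgt0 nd n0 nm nn => [|n'] m x mdec mgt0 nd n0 nm nn.
  by apply/rowP => -[].
pose dd (i : nat) := m 0 (inord i) - x 0 (inord i).
pose ss (i : nat) := m 0 (inord i) + x 0 (inord i).
have S0 : \sum_(i < n'.+1) dd i * ss i = 0.
  transitivity (dot m m - dot x x); last by rewrite nn subrr.
  rewrite /dot -sumrB; apply: eq_bigr => i _; rewrite /dd /ss inord_val; ring.
have Pd (i : nat) : (i < n'.+1)%N -> \sum_(j < i.+1) dd j = psum m (inord i) - psum x (inord i).
  move=> il; rewrite /psum -sumrB (big_ord_widen_cond n'.+1 xpredT) //=.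
  rewrite inordK //; apply: eq_big => [j|j _]; first by rewrite ltnS.
  by rewrite /dd inord_val.
have D0 (i : nat) : (i < n'.+1)%N -> 0 <= \sum_(j < i.+1) dd j.
  by move=> il; rewrite Pd // subr_ge0.
have sd (i : nat) : (i < n')%N -> 0 < ss i - ss i.+1.
  move=> il; rewrite subr_gt0 /ss.
  have i1 : (i < n'.+1)%N by exact: ltnW.
  have lt : ((inord i : 'I_n'.+1) < (inord i.+1 : 'I_n'.+1))%N by rewrite !inordK.
  by apply: ltr_leD; [exact: mdec | exact: nd].
have sp : 0 < ss n' by rewrite /ss ltr_pwDl.
move: S0; rewrite abel_summation => S0.
have pos2 : 0 <= \sum_(i < n') (\sum_(j < i.+1) dd j) * (ss i - ss i.+1).
  by apply: sumr_ge0 => i _; apply: mulr_ge0; [apply: D0; exact: leqW (ltn_ord _) | exact: ltW (sd _ (ltn_ord _))].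
have pos1 : 0 <= (\sum_(j < n'.+1) dd j) * ss n' by apply: mulr_ge0 (ltW sp); exact: (D0 n' (ltnSn n')).
have z1 : (\sum_(j < n'.+1) dd j) * ss n' = 0 by lra.
have z2 : \sum_(i < n') (\sum_(j < i.+1) dd j) * (ss i - ss i.+1) = 0 by lra.
have allz (i : nat) : (i < n'.+1)%N -> \sum_(j < i.+1) dd j = 0.
  rewrite ltnS leq_eqVlt => /orP[/eqP ->|il].
    by move/eqP: z1; rewrite mulf_eq0 (gt_eqF sp) orbF => /eqP.
  have nn0 (j : 'I_n') : true -> 0 <= (\sum_(k < j.+1) dd k) * (ss j - ss j.+1).
    by move=> _; apply: mulr_ge0; [apply: D0; exact: leqW (ltn_ord _) | exact: ltW (sd _ (ltn_ord _))].
  have := psumr_eq0P nn0 z2 (i := Ordinal il) isT => /= /eqP.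
  by rewrite mulf_eq0 (gt_eqF (sd _ il)) orbF => /eqP.
apply: psum_inj => i; apply/eqP; rewrite eq_sym -subr_eq0.
by rewrite -(inord_val i) -Pd // allz.
Qed.

(** Among the exponents violating the claim, one of largest pairing with a strictly dominant vector
    is dominant, since a reflection would otherwise give a larger one. Having the length of mu and
    lying below it, it equals mu, which satisfies the claim. *)
Lemma numerator_support nu : coef numerator nu != 0 ->
  forall k, exists j, `|nu 0 k| = mu 0 j.
Proof.
move=> nu0; apply: contrapT => bad.
pose P x := coef numerator x != 0 /\ ~ (forall k, exists j, `|x 0 k| = mu 0 j).
pose w0 : 'rV[R]_n := \row_k (n - k)%:R.
have ins x : coef numerator x != 0 -> x \in map snd numerator.
  by apply: contraNT => /coef_out ->.
have [x [xin [x0 xbad] xmax]] := @seq_argmax R _ (fun x => dot x w0) P (map snd numerator)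
  (ex_intro2 _ _ nu (ins _ nu0) (conj nu0 bad)).
have xdec (k l : 'I_n) : (k < l)%N -> x 0 l <= x 0 k.
  move=> kl; rewrite leNgt; apply/negP => lt.
  have kl' : k != l by rewrite -val_eqE /= ltn_eqF.
  have c0 : coef numerator (xcol k l x) != 0 by rewrite numerator_xcol // oppr_eq0.
  have := xmax _ (ins _ c0) (conj c0 _).
  apply/not_implyP; split.
    move=> h; apply: xbad => i; have [j hj] := h (tperm k l i); exists j.
    by rewrite -hj !mxE tpermK.
  apply/negP; rewrite -ltNge -subr_gt0 dot_xcol.
  have -> : xcol k l w0 = w0 + (w0 0 l - w0 0 k) *: (delta_mx 0 k - delta_mx 0 l).
    apply/rowP => i; rewrite !mxE eqxx /=.
    case: (tpermP k l i) => [->|->|/eqP ik /eqP il].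
    - by rewrite eqxx (negbTE kl') subr0 mulr1 addrC subrK.
    - by rewrite eqxx eq_sym (negbTE kl') sub0r mulrN1 opprB addrC subrK.
    by rewrite (negbTE ik) (negbTE il) subrr mulr0 addr0.
  rewrite dotDr dotZr addrAC subrr add0r dot_sym dotBl !dot_delta.
  rewrite -mulrNN mulr_gt0 // oppr_gt0 subr_lt0 // !mxE ltr_nat.
  by have := ltn_ord l; lia.
have xge0 k : 0 <= x 0 k.
  rewrite leNgt; apply/negP => lt.
  have c0 : coef numerator (flip k x) != 0 by rewrite numerator_flip oppr_eq0.
  have := xmax _ (ins _ c0) (conj c0 _).
  apply/not_implyP; split.
    move=> h; apply: xbad => i; have [j hj] := h i; exists j.
    by rewrite -hj !mxE normrM; case: ifP => _; rewrite ?normrN ?normr1 mul1r.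
  apply/negP; rewrite -ltNge -subr_gt0 dot_flip.
  have -> : flip k w0 = w0 - (2 * w0 0 k) *: delta_mx 0 k.
    apply/rowP => i; rewrite !mxE eqxx /=.
    by case: eqP => [->|_] /=; [ring | rewrite mulr0 subr0 mul1r].
  rewrite dotDr addrAC subrr add0r -scaleNr dotZr dot_sym dot_delta.
  rewrite mulNr -mulrN mulr_gt0 // ?oppr_gt0 // mulr_gt0 // mxE ltr0n subn_gt0 //.
have xmu : x = mu.
  apply: dominant_norm_eq => //.
    have /mapP[p pn ->] := xin; exact: numerator_lev.
  have e1 := numerator_norm x0; have e2 := numerator_norm numerator_top.
  by have := congr1 (@complex.Re R) (etrans e1 (esym e2)).
apply: xbad => k; exists k; rewrite xmu ger0_norm //; exact/ltW/mu_gt0.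
Qed.

End Support.

Lemma eq_big_uniq_support (C : nmodType) (T : eqType) (r1 r2 : seq T) (F : T -> C) :
  uniq r1 -> uniq r2 ->
  (forall x, x \in r1 -> x \notin r2 -> F x = 0) ->
  (forall x, x \in r2 -> x \notin r1 -> F x = 0) ->
  \sum_(x <- r1) F x = \sum_(x <- r2) F x.
Proof.
move=> u1 u2 h1 h2.
have E (r r' : seq T) : (forall x, x \in r -> x \notin r' -> F x = 0) ->
    \sum_(x <- r) F x = \sum_(x <- [seq x <- r | x \in r']) F x.
  move=> h; rewrite big_filter [RHS]big_mkcond [LHS]big_seq [RHS]big_seq.
  by apply: eq_bigr => x xr; case: ifP => // /negbT; exact: h.
rewrite (E r1 r2) // (E r2 r1) //; apply: perm_big; apply: uniq_perm.
- exact: filter_uniq.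
- exact: filter_uniq.
by move=> x; rewrite !mem_filter andbC.
Qed.

(** * Restriction to a single angle *)

Section Restriction.
Variables (R : realType) (n d : nat) (wv : 'I_d -> 'rV[R]_n.+1) (mu : 'rV[R]_n.+1).
Implicit Types (phi nu x y : 'rV[R]_n.+1).
Hypothesis support : forall nu, coef (numerator wv) nu != 0 ->
  forall k, exists j, `|nu 0 k| = mu 0 j.

Let R0 := [seq al : 'rV[R]_n.+1 <- pos_roots R n.+1 | al 0 ord0 == 0].
Let R1 := [seq al : 'rV[R]_n.+1 <- pos_roots R n.+1 | al 0 ord0 != 0].

Lemma ev_denominator_split phi : ev (denominator (pos_roots R n.+1)) phi =
  ev (denominator R0) phi * ev (denominator R1) phi.
Proof.
by rewrite !ev_denominator !big_filter (bigID (fun al : 'rV[R]_n.+1 => al 0 ord0 == 0)).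
Qed.

Lemma denominator0_exp p : p \in denominator R0 -> p.2 0 ord0 = 0.
Proof.
have : forall al, al \in R0 -> al 0 ord0 = 0.
  by move=> al; rewrite mem_filter => /andP[/eqP].
elim: R0 p => [|al r IH] p h /=.
  by rewrite inE => /eqP ->; rewrite mxE.
move=> /allpairsP [[u v] /= [uf vr ->]] /=; rewrite mxE.
rewrite (IH v) //; last by move=> b br; apply: h; rewrite inE br orbT.
rewrite addr0; have a0 := h al (mem_head _ _).
by move: uf; rewrite !inE => /orP[] /eqP -> /=; rewrite !mxE a0 mulr0 ?oppr0.
Qed.

Let U := esmul (denominator R1) (chi_terms wv).
Let freq (p : (R[i] * 'rV[R]_n.+1)%type) : R := p.2 0 ord0.
Let Us (s : R) := [seq p <- U | freq p == s].

Lemma coef_slice s nu : coef (esmul (denominator R0) (Us s)) nu =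
  if nu 0 ord0 == s then coef (esmul (denominator R0) U) nu else 0.
Proof.
have big_coef t x : coef (esmul (denominator R0) t) x = \sum_(p <- denominator R0)
    \sum_(q <- t) (if p.2 + q.2 == x then p.1 * q.1 else 0).
  by rewrite /coef big_mkcond big_esmul.
rewrite !big_coef.
have E p : p \in denominator R0 ->
    \sum_(q <- Us s) (if p.2 + q.2 == nu then p.1 * q.1 else 0) =
    if nu 0 ord0 == s then \sum_(q <- U) (if p.2 + q.2 == nu then p.1 * q.1 else 0) else 0.
  move=> pd; have p0 := denominator0_exp pd.
  rewrite /Us big_filter big_mkcond /=; case: eqP => [ns|ns].
    apply: eq_bigr => q _; case: eqP => [_|qs] //; case: eqP => // e.
    by case: qs; rewrite -ns -e mxE p0 add0r.
  apply: big1 => q _; case: eqP => // qs; case: eqP => // e.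
  by case: ns; rewrite -qs -e mxE p0 add0r.
rewrite big_seq (eq_bigr _ E) -big_seq.
by case: eqP => // _; rewrite big1.
Qed.

Let freqs := undup ([seq mu 0 j | j <- enum 'I_n.+1] ++ [seq - mu 0 j | j <- enum 'I_n.+1]).

(** The slice of the numerator at s is [denominator R0] times the slice [Us s]. By the support
    condition it is 0, and at generic angles the first factor can be cancelled. *)
Lemma slice_eq0 s phi : s \notin freqs -> ev (Us s) phi = 0.
Proof.
move=> sS; have numc nu : coef (numerator wv) nu = coef (esmul (denominator R0) U) nu.
  apply: (@coef_ev_eq _ _ [::]) => // psi _.
  by rewrite /numerator /U !ev_mul ev_denominator_split mulrA.
have c0 nu : coef (esmul (denominator R0) (Us s)) nu = 0.
  rewrite coef_slice -numc; case: eqP => // ns; apply/eqP; apply: contrapT => /negP cn.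
  have [j hj] := support cn ord0; case/negP: sS; rewrite mem_undup mem_cat.
  rewrite -ns; have [x0|x0] := leP 0 (nu 0 ord0).
    by rewrite ger0_norm // in hj; rewrite hj (map_f (fun j => mu 0 j)) // mem_enum.
  rewrite ltr0_norm // in hj; rewrite -[nu 0 ord0]opprK hj.
  by rewrite (map_f (fun j => - mu 0 j)) ?orbT // mem_enum.
apply: (@sum_coef_eq0 R n.+1 (Us s) (fun x => expi (dot x phi))) => nu.
apply: (@ev_independent _ _ R0).
  by move=> al; rewrite mem_filter => /andP[_]; exact: pos_roots_neq0.
move=> psi reg; apply: (mulfI (ev_denominator_neq0 reg)).
rewrite mulr0 -ev_mul; exact: (@sum_coef_eq0 R n.+1 _ (fun x => expi (dot x psi))).
Qed.

Definition axis (th : R) : 'rV[R]_n.+1 := th *: delta_mx 0 ord0.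

Lemma dot_axis x th : dot x (axis th) = x 0 ord0 * th.
Proof. by rewrite /axis dotZr dot_sym dot_delta mulrC. Qed.

(** All roots in [R1] have first coordinate 1, so they contribute equal factors; they are e_0 and
    the n pairs e_0 - e_l, e_0 + e_l. *)
Lemma ev_denominator1_axis th : ev (denominator R1) (axis th) =
  (expi (th / 2) - expi (- (th / 2))) ^+ (2 * n).+1.
Proof.
rewrite ev_denominator big_filter big_mkcond big_pos_roots /=.
set X := expi (th / 2) - _.
have F (al : 'rV[R]_n.+1) (b : bool) : al 0 ord0 = b%:R ->
  (if al 0 ord0 != 0 then expi (dot al (axis th) / 2) - expi (- (dot al (axis th) / 2)) else 1) =
  if b then X else 1.
  move=> e; rewrite dot_axis e; case: b {e}; rewrite ?eqxx // oner_eq0 /= mul1r //.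
rewrite exprS mulnC exprM big_ord_recl (F _ true) ?mxE //.
rewrite big1 ?mulr1; last by move=> i _; rewrite (F _ false) // mxE.
congr (_ * _).
rewrite big_seq (eq_bigr (fun x : 'I_n.+1 * 'I_n.+1 => if x.1 == ord0 then X ^+ 2 else 1)); last first.
  move=> [k l]; rewrite mem_pos_pairs /= => kl.
  have l0 : (ord0 == l) = false by rewrite -val_eqE /= ltn_eqF // (leq_ltn_trans _ kl).
  rewrite !(F _ (ord0 == k)) ?mxE ?l0 /= ?subr0 ?addr0 // (eq_sym k).
  by case: eqP => _; rewrite ?mulr1 // expr2.
rewrite -big_seq /pos_pairs big_filter big_enum_cond /=.
rewrite -(pair_big_dep predT (fun k l : 'I_n.+1 => (k < l)%N)
  (fun k l => if k == ord0 then X ^+ 2 else 1)) /=.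
rewrite big_ord_recl [X in _ * X]big1 ?mulr1; last first.
  by move=> i _; rewrite big1.
rewrite eqxx big_mkcond big_ord_recl /= mul1r prodr_const card_ord.
by rewrite -exprM mulnC exprM.
Qed.

Lemma character_axis : exists c : R -> R[i], forall th,
  (expi (th / 2) - expi (- (th / 2))) ^+ (2 * n).+1 * \sum_j expi (dot (wv j) (axis th)) =
  \sum_(s <- freqs) c s * expi (s * th).
Proof.
pose c (s : R) : R[i] := \sum_(p <- U | freq p == s) p.1.
exists c => th; rewrite -ev_denominator1_axis -ev_chi -ev_mul -/U.
transitivity (\sum_(p <- U) p.1 * (fun s => expi (s * th)) (freq p)).
  by apply: eq_bigr => p _; rewrite dot_axis.
rewrite (sum_group U freq fst (fun s => expi (s * th))).
apply: eq_big_uniq_support; rewrite ?undup_uniq // => s _ hs.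
  have -> : \sum_(p <- U | freq p == s) p.1 = ev (Us s) 0.
    rewrite /ev /Us big_filter; apply: eq_bigr => p _.
    by rewrite dot_sym dot0l expi0 mulr1.
  by rewrite slice_eq0 ?mul0r.
rewrite big_seq_cond big1 ?mul0r // => p /andP[pU /eqP ps].
by move: hs; rewrite mem_undup -ps (map_f freq).
Qed.

End Restriction.

(** * Powers of the chord 2 sin(x/2) *)

Section HalfAngle.
Variable R : realType.
Implicit Types (x be : R) (b : seq R).

Definition chord x : R := 2 * sin (x / 2).

Lemma derive2E (f g h : R -> R) :
  (forall x, is_derive x 1 f (g x)) -> (forall x, is_derive x 1 g (h x)) ->
  forall x, (f^`(2)%classic) x = h x.
Proof.
move=> fg gh x.
have e1 : f^`()%classic = g.
  by apply/funext => y; rewrite derive1E; exact: (@derive_val _ _ _ _ _ _ _ (fg y)).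
rewrite /derive1n /= e1 derive1E; exact: (@derive_val _ _ _ _ _ _ _ (gh x)).
Qed.

Lemma is_derive_half x : is_derive x 1 (fun y : R => y / 2) (2^-1).
Proof.
have -> : (fun y : R => y / 2) = 2^-1 *: (@id R).
  by apply/funext => y; rewrite /GRing.scale /= mulrC.
by apply: is_derive_eq; rewrite /GRing.scale /= mulr1.
Qed.

Lemma is_derive_chord x : is_derive x 1 chord (cos (x / 2)).
Proof.
have -> : chord = 2 *: (@sin R \o (fun y : R => y / 2)) by apply/funext.
have h := @is_derive1_comp R (@sin R) (fun y => y / 2) x _ _ (is_derive_sin (x / 2)) (is_derive_half x).
by apply: is_derive_eq; rewrite /GRing.scale /=; field.
Qed.

Lemma is_derive_hc x : is_derive x 1 (fun y => cos (y / 2)) (- (chord x / 4)).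
Proof.
have h := @is_derive1_comp R (@cos R) (fun y => y / 2) x _ _ (is_derive_cos (x / 2)) (is_derive_half x).
by apply: (is_derive_eq h); rewrite /chord; field.
Qed.

(** The chord u satisfies u'^2 = 1 - u^2/4 and u'' = -u/4, so the operator becomes a differential
    operator on polynomials in u. *)
Lemma sqr_plus_D2_poly be (p : {poly R}) x :
  sqr_plus_D2 be (fun y => p.[chord y]) x =
  (be ^+ 2 *: p + p^`()^`() * (1 - 4^-1 *: 'X^2) - 4^-1 *: ('X * p^`())).[chord x].
Proof.
have d1 (q : {poly R}) (y : R) : is_derive y 1 (fun z => q.[chord z]) (q^`().[chord y] * cos (y / 2)).
  exact: (@is_derive1_comp R (horner q) chord y _ _ (is_derive_poly q (chord y)) (is_derive_chord y)).
have d2 (y : R) : is_derive y 1 (fun z => p^`().[chord z] * cos (z / 2))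
   (p^`()^`().[chord y] * cos (y / 2) ^+ 2 - p^`().[chord y] * chord y / 4).
  have h := is_deriveM (d1 p^`() y) (is_derive_hc y).
  by apply: (is_derive_eq h); rewrite /GRing.scale /=; ring.
rewrite /sqr_plus_D2 (derive2E (d1 p) d2).
have c2 : cos (x / 2) ^+ 2 = 1 - chord x ^+ 2 / 4.
  by have := cos2Dsin2 (x / 2); rewrite /chord exprMn; lra.
rewrite c2 !(hornerD, hornerN, hornerZ, hornerM, hornerXn, hornerX, hornerC).
by field.
Qed.

(* (be^2 + D^2) u^p = p (p - 1) u^(p-2) + (be^2 - p^2/4) u^p for u = 2 sin(x/2). *)
Lemma prod_sqr_plus_D2_chord b p : exists2 q : {poly R},
  forall x, prod_sqr_plus_D2 b (fun y => chord y ^+ (p + 2 * size b)) x = chord x ^+ p * q.[chord x] &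
  q.[0] = (p + 2 * size b)`!%:R / p`!%:R.
Proof.
elim: b p => [|be b IH] p.
  exists 1 => [x|]; first by rewrite /= muln0 addn0 hornerE mulr1.
  by rewrite muln0 addn0 hornerE divff // pnatr_eq0 -lt0n fact_gt0.
have [q qE q0] := IH p.+2.
(* The image of u^(p+2) q under be^2 + D^2, divided by u^p. At u = 0 only (p+2)(p+1) q survives,
   which builds up the quotient of factorials. *)
pose q1 := be ^+ 2 *: ('X^2 * q) +
  (((p.+2 * p.+1)%:R *: q + (2 * p.+2)%:R *: ('X * q^`()) + 'X^2 * q^`()^`()) *
    (1 - 4^-1 *: 'X^2)) - 4^-1 *: (p.+2%:R *: ('X^2 * q) + 'X^3 * q^`()).
have e (y : R) : (p + 2 * size (be :: b) = p.+2 + 2 * size b)%N by rewrite /= mulnS; lia.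
exists q1 => [x|].
  have ext : prod_sqr_plus_D2 b (fun y => chord y ^+ (p.+2 + 2 * size b)) =
      (fun y => ('X^(p.+2) * q).[chord y]).
    by apply/funext => y; rewrite qE hornerM hornerXn.
  rewrite (e 0) /prod_sqr_plus_D2 /= -/(prod_sqr_plus_D2 b _) ext.
  rewrite sqr_plus_D2_poly; set u := chord x.
  have sN k (v : {poly R}) : k%:R *: v = k%:R * v by rewrite scaler_nat mulr_natl.
  have d1 : ('X^(p.+2) * q)^`() = 'X^(p.+1) * (p.+2%:R *: q + 'X * q^`()).
    rewrite derivM derivXn /= -mulr_natl sN !exprS; ring.
  have d2 : ('X^(p.+2) * q)^`()^`() = 'X^p * ((p.+2 * p.+1)%:R *: q +
      (2 * p.+2)%:R *: ('X * q^`()) + 'X^2 * q^`()^`()).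
    rewrite d1 derivM derivXn /= derivD derivZ derivM derivX mul1r.
    rewrite -mulr_natl !sN exprS !natrM -!natr1; ring.
  rewrite d2 d1 /q1 !(hornerD, hornerN, hornerZ, hornerM, hornerXn, hornerX, hornerC).
  rewrite !exprS; ring.
have -> : q1.[0] = (p.+2 * p.+1)%:R * q.[0].
  rewrite /q1 !(hornerD, hornerN, hornerZ, hornerM, hornerXn, hornerX, hornerC).
  by ring.
rewrite (e 0) q0; move: ((p.+2 + 2 * size b)`!%:R : R) => F.
have -> : (p.+2)`! = (p.+2 * p.+1 * p`!)%N by rewrite (factS p.+1) (factS p) mulnA.
have f0 : (p`!%:R : R) != 0 by rewrite pnatr_eq0 -lt0n fact_gt0.
have g0 : ((p.+2 * p.+1)%:R : R) != 0 by rewrite pnatr_eq0.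
rewrite (natrM _ (p.+2 * p.+1)); move: ((p.+2 * p.+1)%:R : R) (p`!%:R : R) g0 f0 => G P g0 f0.
by field; rewrite f0 g0.
Qed.

Definition sin_sum (l : seq (R * R)) x : R := \sum_(p <- l) p.1 * sin (p.2 * x).

Lemma is_derive_sum_list (l : seq (R * R)) (F dF : R * R -> R -> R) x :
  (forall p, is_derive x 1 (F p) (dF p x)) ->
  is_derive x 1 (fun y => \sum_(p <- l) F p y) (\sum_(p <- l) dF p x).
Proof.
move=> h; elim: l => [|p l IH].
  by rewrite big_nil; under eq_fun do rewrite big_nil; exact: is_derive_cst.
by rewrite big_cons; under eq_fun do rewrite big_cons; exact: is_deriveD.
Qed.

Lemma sqr_plus_D2_sin_sum be (l : seq (R * R)) x :
  sqr_plus_D2 be (sin_sum l) x =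
  sin_sum [seq (p.1 * (be ^+ 2 - p.2 ^+ 2), p.2) | p <- l] x.
Proof.
have dl (s y : R) : is_derive y 1 (fun z : R => s * z) s.
  have -> : (fun z : R => s * z) = s *: (@id R) by apply/funext.
  by apply: is_derive_eq; rewrite /GRing.scale /= mulr1.
have d1 (y : R) : is_derive y 1 (sin_sum l) (\sum_(p <- l) p.1 * p.2 * cos (p.2 * y)).
  apply: (@is_derive_sum_list l (fun p z => p.1 * sin (p.2 * z))
    (fun p z => p.1 * p.2 * cos (p.2 * z))) => p.
  have h := @is_derive1_comp R (@sin R) (fun z => p.2 * z) y _ _ (is_derive_sin _) (dl p.2 y).
  have -> : (fun y => p.1 * sin (p.2 * y)) = p.1 *: (@sin R \o (fun z => p.2 * z)).
    by apply/funext.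
  by apply: is_derive_eq; rewrite /GRing.scale /=; ring.
have d2 (y : R) : is_derive y 1 (fun y => \sum_(p <- l) p.1 * p.2 * cos (p.2 * y))
    (\sum_(p <- l) - (p.1 * p.2 ^+ 2) * sin (p.2 * y)).
  apply: (@is_derive_sum_list l (fun p z => p.1 * p.2 * cos (p.2 * z))
    (fun p z => - (p.1 * p.2 ^+ 2) * sin (p.2 * z))) => p.
  have h := @is_derive1_comp R (@cos R) (fun z => p.2 * z) y _ _ (is_derive_cos _) (dl p.2 y).
  have -> : (fun y => p.1 * p.2 * cos (p.2 * y)) = (p.1 * p.2) *: (@cos R \o (fun z => p.2 * z)).
    by apply/funext.
  by apply: is_derive_eq; rewrite /GRing.scale /=; ring.
rewrite /sqr_plus_D2 (derive2E d1 d2) /sin_sum big_map mulr_sumr -big_split /=.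
by apply: eq_bigr => p _; ring.
Qed.

Lemma prod_sqr_plus_D2_sin_sum b (l : seq (R * R)) x :
  prod_sqr_plus_D2 b (sin_sum l) x =
  sin_sum [seq (p.1 * \prod_(be <- b) (be ^+ 2 - p.2 ^+ 2), p.2) | p <- l] x.
Proof.
elim: b x => [|be b IH] x.
  rewrite /= /sin_sum big_map; apply: eq_bigr => p _ /=.
  by rewrite big_nil mulr1.
have ext : prod_sqr_plus_D2 b (sin_sum l) =
   sin_sum [seq (p.1 * \prod_(be <- b) (be ^+ 2 - p.2 ^+ 2), p.2) | p <- l].
  by apply/funext => y; exact: IH.
rewrite /prod_sqr_plus_D2 /= -/(prod_sqr_plus_D2 b _) ext sqr_plus_D2_sin_sum.
rewrite /sin_sum !big_map; apply: eq_bigr => p _ /=.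
by rewrite big_cons; ring.
Qed.

(* u^2 sin(s x) = 2 sin(s x) - sin((s + 1) x) - sin((s - 1) x) for u = 2 sin(x/2). *)
Lemma chord_odd_power N : exists l : seq (R * R),
  (forall x, chord x ^+ (2 * N).+1 = sin_sum l x) /\
  (forall p, p \in l -> `|p.2| \in half_integers R N.+1).
Proof.
elim: N => [|N [l [lE lh]]].
  exists [:: (2, 2^-1)]; split=> [x|p].
    by rewrite /sin_sum big_seq1 muln0 expr1 /chord /= mulrC [2^-1 * x]mulrC mulrC.
  rewrite inE => /eqP -> /=; rewrite ger0_norm ?invr_ge0 // inE; apply/eqP; lra.
exists ([seq (2 * p.1, p.2) | p <- l] ++ [seq (- p.1, p.2 + 1) | p <- l] ++
        [seq (- p.1, p.2 - 1) | p <- l]).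
split=> [x|p].
  have -> : (2 * N.+1).+1 = (2 + (2 * N).+1)%N by lia.
  rewrite exprD lE /sin_sum !big_cat !big_map /= mulr_sumr -!big_split /=.
  apply: eq_bigr => p _.
  have -> : (p.2 + 1) * x = p.2 * x + x by ring.
  have -> : (p.2 - 1) * x = p.2 * x - x by ring.
  rewrite sinD sinB.
  have c1 : cos x = 1 - chord x ^+ 2 / 2.
    have {1}-> : x = x / 2 + x / 2 by lra.
    by rewrite cosD /chord exprMn; have := cos2Dsin2 (x / 2); rewrite !expr2; lra.
  by rewrite c1; field.
have half (s : R) : `|s| \in half_integers R N.+1 ->
    [/\ `|s| \in half_integers R N.+2, `|s + 1| \in half_integers R N.+2
      & `|s - 1| \in half_integers R N.+2].
  rewrite /half_integers => /mapP [k]; rewrite mem_iota => /andP[k1 kN] sk.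
  have mem (j : nat) (y : R) : (1 <= j <= N.+2)%N -> y = j%:R - 2^-1 ->
      y \in [seq k%:R - 2^-1 | k <- iota 1 N.+2].
    by move=> jN ->; apply/mapP; exists j => //; rewrite mem_iota; lia.
  have k1r : (1 : R) <= k%:R by rewrite ler1n.
  have up : `|s| + 1 = k.+1%:R - 2^-1 by rewrite sk -natr1; lra.
  (* For |s| = 1/2 the shift gives -1/2, whose absolute value is again the half-integer 1/2. *)
  have dn : exists2 j : nat, (1 <= j <= N.+2)%N & `| `|s| - 1 | = j%:R - 2^-1.
    have [k2|k2] := leqP 2 k.
      have k2r : (2 : R) <= k%:R by rewrite ler_nat.
      exists k.-1; first lia.
      by rewrite sk ger0_norm; [rewrite -subn1 natrB //; lra | lra].
    have kk : k = 1%N by lia.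
    by exists 1%N => //; rewrite sk kk ltr0_norm; lra.
  have [j jN jE] := dn.
  have [s0|s0] := leP 0 s.
    have ps := ger0_norm s0; rewrite ps in sk up jE; rewrite ps; split.
    - by apply: (mem k) => //; lia.
    - by rewrite ger0_norm; [apply: (mem k.+1) => //; lia | lra].
    - exact: mem jN jE.
    have ns := ltr0_norm s0; rewrite ns in sk up jE; rewrite ns; split.
  - by apply: (mem k) => //; lia.
  - by apply: mem jN _; rewrite -jE -normrN; congr `|_|; lra.
  - by rewrite ltr0_norm; [apply: (mem k.+1); [lia | lra] | lra].
by rewrite !mem_cat => /or3P[] /mapP[q /lh /half [h1 h2 h3] ->].
Qed.

End HalfAngle.

(** * Comparison of the two sides on the circle *)

Lemma abs_sin_le (R : realType) (x : R) : 0 < x -> `|sin x| <= x.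
Proof.
move=> x0.
have [|c _ e] := @MVT R (@sin R) (@cos R) 0 x x0 (fun y _ => is_derive_sin y).
  by apply: continuous_subspaceT; exact: continuous_sin.
rewrite sin0 !subr0 in e; rewrite e normrM (gtr0_norm x0) ler_piMl //; first exact: ltW.
by rewrite ler_norml cos_geN1 cos_le1.
Qed.

Section SumOnFrequencies.
Variable R : realType.

Lemma sum_freqs (L : seq (R[i] * R)) (freqs : seq R) :
  uniq freqs -> (forall p, p \in L -> p.2 \in freqs \/ p.1 = 0) ->
  forall th, \sum_(p <- L) p.1 * expi (p.2 * th) =
    \sum_(s <- freqs) (\sum_(p <- L | p.2 == s) p.1) * expi (s * th).
Proof.
move=> uf hL th; rewrite (sum_group L snd fst (fun s => expi (s * th))).
apply: eq_big_uniq_support; rewrite ?undup_uniq // => s.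
  move=> _ sf; rewrite big_seq_cond big1 ?mul0r // => p /andP[pL /eqP ps].
  by case: (hL p pL) => // pf; rewrite -ps pf in sf.
rewrite mem_undup => _ sL; rewrite big_seq_cond big1 ?mul0r // => p /andP[pL /eqP ps].
by rewrite -ps (map_f snd) in sL.
Qed.

Lemma ccont_small (f : R -> R[i]) : ccont f -> f 0 = 0 ->
  forall e, 0 < e -> exists2 r, 0 < r & forall t, 0 < t < r -> Normc.normc (f t) <= e.
Proof.
move=> [cr ci] f0 e e0.
have e2 : 0 < e / 2 by lra.
have near_small (g : R -> R) : continuous g -> g 0 = 0 ->
    exists2 r, 0 < r & forall t, 0 < t < r -> `|g t| <= e / 2.
  move=> cg g0; have /cvgrPdist_le /(_ _ e2) [r r0 hr] := cg 0.
  exists r => // t /andP[t0 tr]; have := hr t; rewrite g0 sub0r normrN; apply.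
  by rewrite /ball /= sub0r normrN gtr0_norm.
have [r1 r10 h1] := near_small _ cr (congr1 (@complex.Re R) f0).
have [r2 r20 h2] := near_small _ ci (congr1 (@complex.Im R) f0).
exists (Num.min r1 r2) => [|t /andP[t0]]; first by rewrite lt_min r10.
rewrite lt_min => /andP[t1 t2].
have {}h1 := h1 t; have {}h2 := h2 t; rewrite t0 t1 in h1; rewrite t0 t2 in h2.
move: (h1 isT) (h2 isT); case: (f t) => a b /= ha hb.
rewrite -(ger0_norm (ltW e0)) -sqrtr_sqr ler_wsqrtr //.
rewrite -[a ^+ 2]real_normK ?num_real // -[b ^+ 2]real_normK ?num_real //.
have a0 := normr_ge0 a; have b0 := normr_ge0 b; nra.
Qed.

End SumOnFrequencies.

Section Weights.
Variables (R : realType) (n d : nat) (rho : 'M[R]_((2 * n).+1) -> 'M[R[i]]_d).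
Hypothesis hrho : is_representation rho.
Variables (U : 'M[R[i]]_d) (w : 'I_d -> 'I_n -> int).
Hypothesis hw : weight_basis rho U w.
Variable lam : 'rV[int]_n.
Hypothesis hlam : is_highest_weight rho lam.

Definition real_weight (x : 'rV[int]_n) : 'rV[R]_n := map_mx intr x.

(** Duality between partial sums and simple roots; it translates the highest-weight condition into
    [lev]. *)
Lemma psum_simple_root (k i : 'I_n) : psum (real_weight (simple_root k)) i = (k == i)%:R.
Proof.
rewrite /psum /real_weight.
have -> : \sum_(j < n | (j <= i)%N) (map_mx intr (simple_root k)) 0 j =
  \sum_(j < n | (j <= i)%N) ((j == k)%:R - ((j : nat) == k.+1)%:R) :> R.
  by apply: eq_bigr => j _; rewrite !mxE rmorphB /= !rmorph_nat.
rewrite sumrB.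
have e1 : \sum_(j < n | (j <= i)%N) (j == k)%:R = (k <= i)%N%:R :> R.
  rewrite big_mkcond (bigD1 k) //= eqxx big1 ?addr0; first by case: (k <= i)%N.
  by move=> j /negbTE ->; case: ifP.
have e2 : \sum_(j < n | (j <= i)%N) ((j : nat) == k.+1)%:R = (k < i)%N%:R :> R.
  have [ki|ki] := ltnP k i.
    have kn : (k.+1 < n)%N by apply: leq_ltn_trans (ltn_ord i).
    rewrite (bigD1 (Ordinal kn)) //= eqxx big1 ?addr0 // => j /andP[_ jk].
    by case: eqP => // e; case/eqP: jk; exact: val_inj.
  rewrite big1 // => j ji; case: eqP => // e.
  by move: ki; rewrite leqNgt; case/negP; rewrite -e.
rewrite e1 e2 leq_eqVlt -val_eqE /=.
by case: (ltngtP k i) => _ /=; rewrite ?subrr ?subr0.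
Qed.

Lemma weight_lev j : lev (weight_vec R w j) (real_weight lam).
Proof.
have [c hc] := hlam.2 _ (torus_weight hrho hw j); move=> i.
rewrite -subr_ge0 -psumN -psumD.
have -> : real_weight lam - weight_vec R w j = \sum_k (c k)%:R *: real_weight (simple_root k).
  have := congr1 real_weight hc; rewrite /real_weight map_mxB raddf_sum /= => e.
  have -> : weight_vec R w j = map_mx intr (\row_k w j k) by apply/rowP => k; rewrite !mxE.
  rewrite e; apply: eq_bigr => k _; apply/rowP => l.
  by rewrite !mxE mulmxnE !mxE rmorphMn /= mulr_natl.
have p0 : psum (0 : 'rV[R]_n) i = 0 by rewrite -(scale0r 0) psumZ mul0r.
rewrite (big_morph (fun x : 'rV[R]_n => psum x i) (fun x y => psumD x y i) p0).
by apply: sumr_ge0 => k _; rewrite psumZ psum_simple_root mulr_ge0.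
Qed.

Lemma weight_top : exists j, weight_vec R w j = real_weight lam.
Proof.
have [v v0 hv] := hlam.1.
have Uu := hw.1.
have [j vj] : exists j, (U *m v) j 0 != 0.
  apply: contrapT => h; case/eqP: v0.
  rewrite -[v]mul1mx -(mulVmx Uu) -mulmxA; have -> : U *m v = 0; last by rewrite mulmx0.
  apply/colP => j; rewrite [RHS]mxE; apply/eqP; apply: contrapT => /negP hj.
  by apply: h; exists j.
exists j.
have E (phi : 'I_n -> R) : expi (\sum_k (w j k)%:~R * phi k) =
    expi (\sum_k (lam 0 k)%:~R * phi k).
  have := congr1 (mulmx U) (hv phi); rewrite (rep_torus hrho hw) /conj_diag !mulmxA.
  rewrite mulmxV // mul1mx -mulmxA -scalemxAr => /colP /(_ j).
  have sc (z : R[i]) (u : 'cV[R[i]]_d) : (z *: u) j 0 = z * u j 0 by rewrite mxE.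
  have dg (x : 'rV[R[i]]_d) (u : 'cV[R[i]]_d) : (diag_mx x *m u) j 0 = x 0 j * u j 0.
    by rewrite mul_diag_mx mxE.
  by rewrite sc dg mxE => /(mulIf vj).
apply/rowP => k; rewrite !mxE; apply/eqP; rewrite -subr_eq0; apply: contrapT => /negP de.
set dl := _ - _ in de.
have single (f : 'I_n -> R) t : \sum_l f l * (if l == k then t else 0) = f k * t.
  by rewrite (bigD1 k) //= eqxx big1 ?addr0 // => l /negbTE ->; rewrite mulr0.
(* If the k-th coordinates differed by dl, the angle 1/|dl| would make the phases differ by 1 or -1,
   which is not a multiple of 2 pi. *)
have := E (fun l => if l == k then `|dl|^-1 else 0).
rewrite !single => e1.
have : expi (dl * `|dl|^-1) = 1.
  by rewrite /dl mulrBl expiD expiN -/dl e1 divff ?expi_neq0.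
apply/eqP; apply: expi_neq1; rewrite normrM normfV normr_id divff ?normr_eq0 //.
by have := @pi_ge2 R; rewrite ltr01 /=; lra.
Qed.

End Weights.

Section CharacterOnRotation.
Variables (R : realType) (n d : nat) (rho : 'M[R]_((2 * n.+1).+1) -> 'M[R[i]]_d).
Hypotheses (hrho : is_representation rho) (hirr : is_irreducible rho).
Variable lam : 'rV[int]_n.+1.
Hypothesis hlam : is_highest_weight rho lam.
Hypothesis lam_dec : forall k l : 'I_n.+1, (k <= l)%N -> lam 0 l <= lam 0 k.
Hypothesis lam_ge0 : forall k, 0 <= lam 0 k.

Local Notation mu := (real_weight R lam + weyl_vector R n.+1).
Definition shifted_freqs : seq R :=
  undup ([seq mu 0 j | j <- enum 'I_n.+1] ++ [seq - mu 0 j | j <- enum 'I_n.+1]).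

Lemma trace_rot12 : exists (wt : 'I_d -> R) (c : R -> R[i]), forall th,
  \tr (rho (rot12 n.+1 th)) = \sum_j expi (wt j * th) /\
  (expi (th / 2) - expi (- (th / 2))) ^+ (2 * n).+1 * \sum_j expi (wt j * th) =
    \sum_(s <- shifted_freqs) c s * expi (s * th).
Proof.
have [U [w hw]] := weight_basis_exists hrho.
have [z hz] := casimir_character hrho hw hirr.
pose wv := weight_vec R w.
have chi phi : ev (chi_terms wv) phi = \sum_j expi (dot (wv j) phi) by exact: ev_chi.
have supp := @numerator_support R n.+1 d wv (real_weight R lam).
have {}supp : forall nu, coef (numerator wv) nu != 0 -> forall k, exists j, `|nu 0 k| = mu 0 j.
  apply: (supp _ _ z).
  - by move=> k l phi; rewrite !chi; exact: (trace_torus_swap hrho hw).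
  - by move=> k phi; rewrite !chi; exact: (trace_torus_flip hrho hw).
  - by move=> phi reg; rewrite chi; exact: (hz phi reg).
  - exact: (weight_lev hrho hw hlam).
  - exact: (weight_top hrho hw hlam).
  - by move=> k l kl; rewrite !mxE ler_int; exact: lam_dec.
  - by move=> k; rewrite !mxE ler0z; exact: lam_ge0.
have [c hc] := character_axis supp.
exists (fun j => (w j ord0)%:~R), c => th.
have dotw j : dot (wv j) (axis n th) = (w j ord0)%:~R * th by rewrite dot_axis mxE.
split.
  have -> : rot12 n.+1 th = plane_rot (ev_idx ord0) (od_idx ord0) th by [].
  rewrite (hw.2 ord0 th) -/(conj_diag U _) (trace_conj_diag hw.1).
  by apply: eq_bigr => j _; rewrite mxE.
rewrite -hc; congr (_ * _); apply: eq_bigr => j _.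
by rewrite dotw.
Qed.

End CharacterOnRotation.

Lemma expi_half_sub (R : realType) (th : R) :
  expi (th / 2) - expi (- (th / 2)) = 'i%C * (chord th)%:C.
Proof.
apply: complex_eq; rewrite ?ReD ?ImD ?Re_mul ?Im_mul ?raddfN /=.
  by rewrite cosN; ring.
by rewrite sinN /chord; ring.
Qed.

Lemma sin_expi (R : realType) (x : R) :
  (sin x)%:C = (expi x - expi (- x)) / (2 * 'i%C).
Proof.
have i0 : 2 * 'i%C != 0 :> R[i].
  rewrite mulf_neq0 ?pnatr_eq0 //; apply/eqP => /(congr1 (@complex.Im R)) /=.
  by apply/eqP; exact: oner_neq0.
apply: (mulIf i0); rewrite divfK //.
apply: complex_eq; rewrite ?ReD ?ImD ?Re_mul ?Im_mul ?raddfN /=.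
  by rewrite cosN; ring.
by rewrite sinN; ring.
Qed.

Lemma chord_le (R : realType) (t : R) : 0 < t -> `|chord t| <= t.
Proof.
move=> t0; have := @abs_sin_le R (t / 2); rewrite divr_gt0 // => /(_ isT).
rewrite /chord normrM (ger0_norm (ler0n _ 2)); lra.
Qed.

(* Both sides are combinations of the exponentials exp(i s x), s in fs, and
   agree up to o(x^p); there are at most p + 1 frequencies. *)
Lemma exp_sums_agree (R : realType) (fs : seq R) (p : nat) (c1 c2 : R -> R[i])
    (F1 F2 : R -> R[i]) :
  uniq fs -> ((size fs).-1 <= p)%N ->
  ccont F1 -> ccont F2 -> F1 0 = F2 0 ->
  (forall x, (chord x)%:C ^+ p * F1 x = \sum_(s <- fs) c1 s * expi (s * x)) ->
  (forall x, (chord x)%:C ^+ p * F2 x = \sum_(s <- fs) c2 s * expi (s * x)) ->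
  forall x, (chord x)%:C ^+ p * F1 x = (chord x)%:C ^+ p * F2 x.
Proof.
move=> ufs sz cF1 cF2 F0 h1 h2 x.
pose G x := F1 x + (-1) * F2 x.
have cG : ccont G by apply: ccontD cF1 _; apply: ccontM cF2; exact: ccont_cst.
have G0 : G 0 = 0 by rewrite /G F0 mulN1r subrr.
have hG y : \sum_(s <- fs) (c1 s - c2 s) * expi (s * y) = (chord y)%:C ^+ p * G y.
  rewrite /G mulrDr mulN1r mulrN h1 h2 -sumrB.
  by apply: eq_bigr => s _; rewrite mulrBl.
have c0 : forall s, s \in fs -> c1 s - c2 s = 0.
  apply: exp_sum_small_eq0 => // e e0.
  have [r r0 hr] := ccont_small cG G0 e0.
  exists (Num.min r 1) => [|t]; first by rewrite lt_min r0 ltr01.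
  rewrite lt_min => /and3P[t0 tr t1]; rewrite hG ncM.
  have nX (y : R[i]) k : Normc.normc (y ^+ k) = Normc.normc y ^+ k.
    elim: k => [|k IH]; first by rewrite !expr0 Normc.normc1.
    by rewrite !exprS ncM IH.
  have nR (y : R) : Normc.normc y%:C = `|y|.
    by rewrite /Normc.normc /= expr0n addr0 sqrtr_sqr.
  rewrite nX nR mulrC; apply: ler_pM; rewrite ?nc_ge0 ?exprn_ge0 //.
    by apply: hr; rewrite t0.
  apply: le_trans (_ : t ^+ p <= _).
    by rewrite lerXn2r ?nnegrE ?normr_ge0 ?(ltW t0) // chord_le.
  by apply: ler_wiXn2l => //; exact: ltW.
apply/eqP; rewrite -subr_eq0 h1 h2 -sumrB big_seq big1 // => s sfs.
by rewrite -mulrBl c0 // mul0r.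
Qed.

Theorem lemma2p2 (R : realType) (n : nat) (hn : (1 <= n)%N)
    (theta : R) (htheta : 0 < theta <= pi)
    (a : n.-tuple nat) (ha : sorted leq a)
    (d : nat) (rho : 'M[R]_((2 * n).+1) -> 'M[R[i]]_d)
    (hrho : is_representation rho) (hirr : is_irreducible rho)
    (hweight : is_highest_weight rho (weight_of a))
    (m : nat) (hm : m = last 0%N a)
    (b : m.-tuple R) (hbsorted : sorted (fun x y : R => y < x) b)
    (hb : forall x : R,
      (x \in b) = (x \in half_integers R (m + n)) && (x \notin atilde R a)) :
  char_ratio rho theta =
    ((2 * n - 1)`!%:R
       / ((2 * n + 2 * m - 1)`!%:R * (2 * sin (theta / 2)) ^+ (2 * n - 1))
       * prod_sqr_plus_D2 b
           (fun x : R => (2 * sin (x / 2)) ^+ (2 * n + 2 * m - 1)) theta)%:C.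
Proof.
have d0 : (0 < d)%N by case: hirr.
case: n hn a ha rho hrho hirr hweight hm hb => // n _ a ha rho hrho hirr hweight hm hb.
have sa : size a = n.+1 by rewrite size_tuple.
have aij (i j : nat) : (i <= j)%N -> (j < n.+1)%N -> (nth 0%N a i <= nth 0%N a j)%N.
  move=> ij jn; apply: (sorted_leq_nth leq_trans leqnn 0%N ha) => //.
    by rewrite inE sa (leq_ltn_trans ij).
  by rewrite inE sa.
have ldec (k l : 'I_n.+1) : (k <= l)%N -> weight_of a 0 l <= weight_of a 0 k.
  move=> kl; rewrite !mxE lez_nat !nth_rev ?sa ?ltn_ord //.
  by apply: aij; have := ltn_ord k; have := ltn_ord l; lia.
have lge0 k : 0 <= weight_of a 0 k by rewrite mxE.
have [wt [c htr]] := trace_rot12 hrho hirr hweight ldec lge0.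
set fs := shifted_freqs R (weight_of a) in htr.
pose mu : 'rV[R]_n.+1 := real_weight R (weight_of a) + weyl_vector R n.+1.
(* The coordinates of lambda + delta are the a~ in decreasing order: coordinate k, counted from 0,
   is a~ of index n - k + 1. *)
have muE k : mu 0 k = (nth 0%N a (n - k))%:R + (n - k).+1%:R - 2^-1.
  rewrite !mxE nth_rev ?sa ?ltn_ord // subSS -addrA; congr (_ + (_ - _)).
  by rewrite subSn // -ltnS ltn_ord.
have atilde_mu x : x \in atilde R a -> exists k, x = mu 0 k.
  move=> /mapP[j]; rewrite mem_iota => jn ->.
  have kn : (n.+1 - j < n.+1)%N by lia.
  exists (Ordinal kn); rewrite muE /=.
  have -> : (n - (n.+1 - j) = j.-1)%N by lia.
  by rewrite prednK //; lia.
pose p := (2 * n).+1.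
have -> : (2 * n.+1 - 1 = p)%N by rewrite /p; lia.
have -> : (2 * n.+1 + 2 * m - 1 = p + 2 * m)%N by rewrite /p; lia.
have [q qE q0] := prod_sqr_plus_D2_chord b p.
rewrite size_tuple in qE q0.
have [l [lE lh]] := chord_odd_power R (n + m).
have pE : (2 * (n + m)).+1 = (p + 2 * m)%N by rewrite /p; lia.
rewrite pE in lE.
pose Q := prod_sqr_plus_D2 b (fun x : R => chord x ^+ (p + 2 * m)).
have QE x : Q x = sin_sum [seq (y.1 * \prod_(be <- b) (be ^+ 2 - y.2 ^+ 2), y.2) | y <- l] x.
  rewrite -prod_sqr_plus_D2_sin_sum /Q; congr (prod_sqr_plus_D2 _ _ _).
  exact/funext.
have ufs : uniq fs by exact: undup_uniq.
have szfs : ((size fs).-1 <= p)%N.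
  have : (size fs <= 2 * n.+1)%N.
    rewrite /fs /shifted_freqs; apply: (leq_trans (size_undup _)).
    by rewrite size_cat !size_map -enumT size_enum_ord; lia.
  by rewrite /p; lia.
have murange k : mu 0 k \in fs /\ - mu 0 k \in fs.
  rewrite /fs /shifted_freqs !mem_undup !mem_cat.
  rewrite (map_f (fun j => mu 0 j)) ?mem_enum //.
  by rewrite (map_f (fun j => - mu 0 j)) ?mem_enum // orbT.
pose kap y : R := y.1 * \prod_(be <- b) (be ^+ 2 - y.2 ^+ 2).
(* The absolute value of each frequency of the chord power is one of 1/2, ..., up to m plus the rank
   minus 1/2. If it is a b~, its coefficient is killed by a vanishing factor; otherwise it is an
   a~. *)
have good (y : R * R) : y \in l -> (y.2 \in fs /\ - y.2 \in fs) \/ kap y = 0.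
  move=> yl; have [yb|yb] := boolP (`|y.2| \in b).
    right; rewrite /kap (big_rem _ yb) /= real_normK ?num_real //.
    by rewrite subrr mul0r mulr0.
  left; have := lh y yl; have -> : (n + m).+1 = (m + n.+1)%N by lia.
  move=> yh; have := hb `|y.2|; rewrite (negbTE yb) yh /= => /esym /negbFE.
  move=> /atilde_mu[k yk]; have [m1 m2] := murange k; rewrite -yk in m1 m2.
  have [y0|y0] := leP 0 y.2; first by rewrite ger0_norm in m1 m2.
  by rewrite ltr0_norm // opprK in m1 m2.
pose L : seq (R[i] * R) :=
  [seq ((kap y)%:C / (2 * 'i%C), y.2) | y <- l] ++
  [seq (- ((kap y)%:C / (2 * 'i%C)), - y.2) | y <- l].
have QL x : (Q x)%:C = \sum_(y <- L) y.1 * expi (y.2 * x).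
  rewrite QE /sin_sum big_map /L big_cat !big_map /= rmorph_sum -big_split /=.
  apply: eq_bigr => y _; rewrite rmorphM /= sin_expi -/(kap y).
  have -> : - y.2 * x = - (y.2 * x) by rewrite mulNr.
  ring.
have Lfs y : y \in L -> y.2 \in fs \/ y.1 = 0.
  rewrite mem_cat => /orP[] /mapP[x /good [[h1 h2]|h] ->] /=; try by left.
    by right; rewrite h mul0r.
  by right; rewrite h mul0r oppr0.
pose K : R := (p + 2 * m)`!%:R / p`!%:R.
pose chi x : R[i] := \sum_j expi (wt j * x).
(* Cancels the power of i coming from exp(ix/2) - exp(-ix/2) = i times the chord. *)
pose ip : R[i] := ('i%C ^+ p)^-1.
have i0 : 'i%C ^+ p != 0 :> R[i].
  rewrite expf_neq0 //; apply/eqP => /(congr1 (@complex.Im R)) /=.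
  by apply/eqP; exact: oner_neq0.
have cchi : ccont chi by apply: ccont_sum => j; exact: ccont_expi.
have cq : ccont (fun x => (q.[chord x])%:C).
  split=> /=; last by move=> x; exact: cvg_cst.
  move=> x; have h := @is_derive1_comp R (horner q) (@chord R) x _ _
    (is_derive_poly q (chord x)) (is_derive_chord x).
  by have [dq _] := h; move/derivable1_diffP/differentiable_continuous: dq.
(* The factors K and d normalize the two functions crosswise: as [chi] is d at 0 and [q.[0]] is K,
   both products take the value K d there. *)
have key := @exp_sums_agree R fs p
  (fun s => K%:C * (ip * c s)) (fun s => d%:R * \sum_(y <- L | y.2 == s) y.1)
  (fun x => K%:C * chi x) (fun x => d%:R * (q.[chord x])%:C) ufs szfs.
have {}key : forall x, (chord x)%:C ^+ p * (K%:C * chi x) =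
    (chord x)%:C ^+ p * (d%:R * (q.[chord x])%:C).
  apply: key.
  - by apply: ccontM cchi; exact: ccont_cst.
  - by apply: ccontM cq; exact: ccont_cst.
  - have -> : chord (0 : R) = 0 by rewrite /chord mul0r sin0 mulr0.
    rewrite q0 -/K mulrC; congr (_ * _); rewrite /chi.
    under eq_bigr do rewrite mulr0 expi0.
    by rewrite sumr_const card_ord.
  - move=> x; have := (htr x).2; rewrite expi_half_sub exprMn -/(chi x) => e.
    have -> : (chord x)%:C ^+ p * (K%:C * chi x) =
       K%:C * (ip * ('i%C ^+ p * (chord x)%:C ^+ p * chi x)).
      rewrite /ip; field; exact: i0.
    by rewrite e !mulr_sumr; apply: eq_bigr => s _; rewrite !mulrA.
  - move=> x; rewrite mulrCA -rmorphXn -rmorphM /= -qE -/(Q x) QL (sum_freqs ufs Lfs).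
    by rewrite mulr_sumr; apply: eq_bigr => s _; rewrite mulrA.
rewrite /char_ratio (htr theta).1 -/(chi theta).
have /andP[th0 thpi] := htheta.
(* Here theta/2 lies strictly between 0 and pi, so the power of the chord can be cancelled. *)
have s0 : 0 < chord theta.
  rewrite /chord mulr_gt0 // sin_gt0_pi //; apply/andP; split; first lra.
  by have := @pi_gt0 R; lra.
have K0 : K != 0 by rewrite /K mulf_neq0 ?invr_eq0 // pnatr_eq0 -lt0n fact_gt0.
have dn : d%:R != 0 :> R[i] by rewrite pnatr_eq0 -lt0n.
have -> : prod_sqr_plus_D2 b (fun x => (2 * sin (x / 2)) ^+ (p + 2 * m)) theta = chord theta ^+ p * q.[chord theta].
  exact: qE.
rewrite -/(chord theta).
have hp0 : chord theta ^+ p != 0 by rewrite expf_neq0 // gt_eqF.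
have e : K%:C * chi theta = d%:R * (q.[chord theta])%:C.
  have := key theta; apply: mulfI.
  by rewrite expf_neq0 // fmorph_eq0 gt_eqF.
have f1 : (p`!%:R : R) != 0 by rewrite pnatr_eq0 -lt0n fact_gt0.
have f2 : ((p + 2 * m)`!%:R : R) != 0 by rewrite pnatr_eq0 -lt0n fact_gt0.
have -> : p`!%:R / ((p + 2 * m)`!%:R * chord theta ^+ p) * (chord theta ^+ p * q.[chord theta]) =
    K^-1 * q.[chord theta].
  by rewrite /K; field; rewrite f1 f2 hp0.
have KC0 : K%:C != 0 :> R[i] by rewrite fmorph_eq0.
apply: (mulfI KC0); rewrite mulrA e mulrAC divff // mul1r -rmorphM /= mulrA divff //.
by rewrite mul1r.
Qed.
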